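(* For any $K_1>0$ there are $n_0=n_0(K_1)\in\mathbb N$ and $v=v(K_1)>0$ with the following property. Let $n\ge n_0$ and let $A$ be an $n\times n$ random matrix with independent rows such that each row $X$ of $A$ satisfies: for every $3$-dimensional linear subspace $F\subset\mathbb R^n$, the random vector $\mathrm{Proj}_F(X)$ has a distribution density $\rho$ on $F$ with $$\rho(x)\le \frac{K_1}{\max(1,\|x\|_2^{2000})},\qquad x\in F.$$ Then for any fixed $n\times n$ real matrix $M$ we have $$\mathbb P\big\{\|(A+M)^{-1}\|_{HS}\ge t\sqrt n\big\}\le \frac{v}{t},\qquad t>0.$$
   Context: All matrices are real. $\mathrm{Proj}_F$ is the orthogonal projection onto $F$; densities on $F$ are with respect to Lebesgue measure on $F$. $\|B\|_{HS}=\sqrt{\sum_{i,j}b_{ij}^2}$ is the Hilbert--Schmidt norm. Under the hypotheses $A+M$ is almost surely invertible, so the event is defined up to a null set. *)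

(* Defs.v *)
From HB Require Import structures.
From mathcomp Require Import all_boot all_order all_algebra.
From mathcomp Require Import all_classical all_reals all_analysis.
From mathcomp Require Import measurable_realfun.

Set Implicit Arguments.
Unset Strict Implicit.
Unset Printing Implicit Defensive.

Import Order.TTheory GRing.Theory Num.Theory.
Import numFieldNormedType.Exports.

Local Open Scope classical_set_scope.
Local Open Scope ring_scope.

(* Matrices carry the sigma-algebra generated by their entries; over a
   realType this is the Borel sigma-algebra. *)
Definition measure_matrix_display : measure_display -> measure_display.
Proof. exact. Qed.

Section measurable_matrix.
Context {d} {T : measurableType d}.
Variables m n : nat.

Definition matrix_cylinders : set (set 'M[T]_(m, n)) :=
  [set C | exists i j (B : set T),
     measurable B /\ C = [set M : 'M[T]_(m, n) | B (M i j)]].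

HB.instance Definition _ := @isMeasurable.Build (measure_matrix_display d)
  'M[T]_(m, n) <<s matrix_cylinders >>
  (@sigma_algebra0 _ setT matrix_cylinders)
  (@sigma_algebraC _ matrix_cylinders)
  (@sigma_algebra_bigcup _ setT matrix_cylinders).

Lemma measurable_fun_matrixP d' (U : measurableType d') (f : U -> 'M[T]_(m, n)) :
  measurable_fun setT f <->
  forall i j, measurable_fun setT (fun u => f u i j).
Proof.
split=> [mf i j _ B mB|mf].
  rewrite setTI; have := mf measurableT [set M : 'M[T]_(m, n) | B (M i j)].
  rewrite setTI; apply; apply: sub_sigma_algebra.
  by exists i, j, B.
apply: (@measurability _ _ _ _ _ _ matrix_cylinders) => //.
move=> _ [_ [i [j [B [mB ->]]]] <-].
exact: mf.
Qed.

End measurable_matrix.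

Section definitions.
Context {R : realType}.

Definition hs_norm (m n : nat) (B : 'M[R]_(m, n)) : R :=
  Num.sqrt (\sum_i \sum_j B i j ^+ 2).

Definition norm2 (n : nat) (x : 'rV[R]_n) : R :=
  Num.sqrt (\sum_j x 0 j ^+ 2).

(* A linear subspace of R^n is the row space of some F : 'M_n, of dimension
   \rank F. Since u *m F^T lists the inner products of u with the rows of F,
   the row space of kermx F^T is the orthogonal complement of that of F. *)
Definition proj_orth (n : nat) (F : 'M[R]_n) (x : 'rV[R]_n) : 'rV[R]_n :=
  x *m proj_mx F (kermx F^T).

Definition orthonormal_basis (k n : nat) (F : 'M[R]_n) (U : 'M[R]_(k, n)) :=
  U *m U^T = 1%:M /\ (U :=: F)%MS.

Notation R3 :=
  (measurableTypeR R * measurableTypeR R * measurableTypeR R)%type.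

Definition lebesgue3 : set R3 -> \bar R :=
  ((lebesgue_measure \x lebesgue_measure) \x lebesgue_measure)%E.

HB.instance Definition _ := Measure.on lebesgue3.

Definition frame_map (n : nat) (U : 'M[R]_(3, n)) (p : R3) : 'rV[R]_n :=
  (p.1.1 : R) *: row 0 U + (p.1.2 : R) *: row 1 U + (p.2 : R) *: row 2%:R U.

Lemma measurable_frame_map (n : nat) (U : 'M[R]_(3, n)) :
  measurable_fun setT (frame_map U).
Proof.
apply/measurable_fun_matrixP => i j.
rewrite (_ : (fun _ => _) = (fun p : R3 =>
  (p.1.1 : R) * U 0 j + (p.1.2 : R) * U 1 j + (p.2 : R) * U 2%:R j)); last first.
  by apply/funext => p; rewrite !mxE.
apply: measurable_funD; first apply: measurable_funD.
- apply: measurable_funM => //.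
  exact: (measurableT_comp measurable_fst measurable_fst).
- apply: measurable_funM => //.
  exact: (measurableT_comp measurable_snd measurable_fst).
- by apply: measurable_funM.
Qed.

HB.instance Definition _ (n : nat) (U : 'M[R]_(3, n)) :=
  isMeasurableFun.Build _ _ _ _ (frame_map U) (measurable_frame_map U).

(* When the rows of U are an orthonormal basis of a 3-dimensional subspace F,
   this is Lebesgue measure on F, seen as a measure on R^n carried by F. *)
Definition lebesgue_frame (n : nat) (U : 'M[R]_(3, n)) : set 'rV[R]_n -> \bar R :=
  pushforward lebesgue3 (frame_map U).

Section lebesgue_frame_measure.
Variables (n : nat) (U : 'M[R]_(3, n)).

Let lebesgue_frame0 : lebesgue_frame U set0 = 0%E.
Proof. by rewrite /lebesgue_frame /pushforward preimage_set0 measure0. Qed.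

Let lebesgue_frame_ge0 B : (0 <= lebesgue_frame U B)%E.
Proof. exact: measure_ge0. Qed.

Let lebesgue_frame_sigma_additive : semi_sigma_additive (lebesgue_frame U).
Proof.
have mf := measurable_frame_map U.
exact: (@measure_semi_sigma_additive _ _ _
  (measure_function_pushforward__canonical__measure_function_Measure
     lebesgue3 mf)).
Qed.

HB.instance Definition _ := isMeasure.Build _ _ _ (lebesgue_frame U)
  lebesgue_frame0 lebesgue_frame_ge0 lebesgue_frame_sigma_additive.

End lebesgue_frame_measure.

(* nu is a law carried by the 3-dimensional subspace F, and only the values of
   rho on F are used. Lebesgue measure on F does not depend on the orthonormal
   basis used to transport it from R^3, hence the quantification over all of
   them. *)
Definition is_density_on (n : nat) (F : 'M[R]_n)
    (nu : set 'rV[R]_n -> \bar R) (rho : 'rV[R]_n -> R) : Prop :=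
  let inF := [set x : 'rV[R]_n | (x <= F)%MS] in
  [/\ measurable_fun inF rho,
      (forall x, inF x -> 0 <= rho x) &
      forall U : 'M[R]_(3, n), orthonormal_basis F U ->
      forall B, measurable B ->
        nu B = (\int[lebesgue_frame U]_(x in inF `&` B) (rho x)%:E)%E].

End definitions.

Definition independent_rows {d} {T : measurableType d} {R : realType}
    (P : probability T R) (m n : nat) (A : T -> 'M[R]_(m, n)) : Prop :=
  forall B : 'I_m -> set 'rV[R]_n, (forall i, measurable (B i)) ->
    P [set w | forall i, B i (row i (A w))] =
    (\prod_(i < m) P [set w | B i (row i (A w))])%E.

(* Main.v *)
Require Import Defs.
From HB Require Import structures.
From mathcomp Require Import all_boot all_order all_algebra.
From mathcomp Require Import all_classical all_reals all_analysis.
From mathcomp Require Import measurable_realfun ring lra zify.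

Set Implicit Arguments.
Unset Strict Implicit.
Unset Printing Implicit Defensive.

Import Order.TTheory GRing.Theory Num.Theory.
Import numFieldNormedType.Exports.

Local Open Scope classical_set_scope.
Local Open Scope ring_scope.

(* Write B = A + M, tau = t sqrt n, and split the indicator of ||B^-1||_HS >= tau
   into the shares |B^-1 e_i|^2 / ||B^-1||_HS^2 of the columns. To bound share i,
   resample row i: let nu be the unit normal to the other rows, u the component
   of row i along nu, and rho_k = u <nu B^-1, e_k>. Then share i is at most
   2 / (sum_k rho_k^2 + tau^2 u^2), with rho_i = 1. In the orthogonal complement
   of all rows but i, j, l, which is 3-dimensional and contains nu, the two
   components of row i orthogonal to nu are at most (rho_j^2 + rho_l^2)^(1/2)
   times the lengths of rows j and l, so the density bound controls the
   expectation of 1 / (h (rho_j^2 + rho_l^2) + tau^2 u^2) by C / (tau sqrt h).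
   Averaging over h^2 pairs (j, l) with degrees at most h, by convexity of 1/x,
   bounds share i by about (C / tau) n^(1/4) h^(-3/4). Such pairs exist for h the
   h-index of the graph of good pairs at i, and only O(m) indices i have h-index
   below m, so the shares add up to (C / tau) sqrt n = C / t. *)

(** * One-dimensional integrals of the Cauchy and inverse square root kernels *)

Section one_dim.
Context {R : realType}.
Notation mu := (@lebesgue_measure R).

(** Keeping only [rho_i = 1] in a share gives [C / tau] per column, hence [C sqrt n / t] in all: a
    factor sqrt n has to come from the other [rho_k]. Integrating out the component along nu leaves
    the inverse length of the remaining components, which is locally integrable in dimension two but
    not in dimension one; this is why i gets two companions j, l and the subspaces have dimension 3.
    The deterministic parts of rows j and l may be arbitrarily long; they are absorbed by choosing
    which of the three indices is resampled. Their random parts have only moments, and the pairs (j,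
    l) are selected by looking at these very rows, so an expectation over a selected pair is not
    accessible. The lengths are therefore truncated at [(n / h)^(1/4)], which turns
    [C / (tau sqrt h)] into the bound with [n^(1/4) h^(-3/4)]. The excess is paid by twelfth moments
    summed over all pairs, selected or not: over all i this costs [n^3 / n^(5/2) = sqrt n], the same
    order as the main term, in which the sum of [h^(-3/4)] is of order [n^(1/4)]. *)

Lemma measurable_inv : measurable_fun [set: R] (@GRing.inv R).
Proof.
have setN0 : [set x : R | x != 0] = ~` [set 0].
  by apply/seteqP; split => x /= /eqP.
have mN0 : measurable [set x : R | x != 0] by rewrite setN0; exact: measurableC.
have -> : [set: R] = [set x : R | x != 0] `|` [set 0].
  by rewrite setN0 setUC setUv.
apply/measurable_funU => //; split; last exact: measurable_fun_set1.
apply: open_continuous_measurable_fun.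
  by rewrite setN0; exact/closed_openC/closed_eq.
by move=> x; rewrite inE/= => x0; exact: inv_continuous.
Qed.

Lemma measurable_funV d (T : measurableType d) (f : T -> R) :
  measurable_fun setT f -> measurable_fun setT (fun x => (f x)^-1).
Proof. by move=> mf; exact: (measurableT_comp measurable_inv). Qed.

Lemma measurable_sqrt d (T : measurableType d) (f : T -> R) :
  measurable_fun setT f -> measurable_fun setT (fun x => Num.sqrt (f x)).
Proof.
move=> mf; apply: (measurableT_comp _ mf).
apply: continuous_measurable_fun; exact: sqrt_continuous.
Qed.

(** The fundamental theorem of calculus on each compact piece, then monotone convergence. Exhausting
    [D] from inside covers both the whole line and an open half-line with a singular end point. *)
Lemma integral_le_antiderivative (a b : nat -> R) (f F : R -> R) (K : R) :
  let D := \bigcup_n `[a n, b n]%classic in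
  (forall n, a n < b n) -> (forall n, a n.+1 <= a n) ->
  (forall n, b n <= b n.+1) ->
  (forall x, D x -> is_derive x (1 : R) F (f x)) ->
  (forall x, D x -> {for x, continuous f}) -> (forall x, 0 <= f x) ->
  (forall x y, F y - F x <= K) ->
  (\int[mu]_(x in D) (f x)%:E <= K%:E)%E.
Proof.
move=> D ab a_ni b_nd dF cf f0 FK.
have DS n x : `[a n, b n]%classic x -> D x by exists n.
have cfn n : {within `[a n, b n], continuous f}.
  by apply: continuous_in_subspaceT => x; rewrite inE => /DS; exact: cf.
have mf n : measurable_fun `[a n, b n]%classic (EFin \o f).
  by apply/measurable_EFinP; exact: subspace_continuous_measurable_fun.
have cF x : D x -> {for x, continuous F}.
  by move=> /dF h; apply/differentiable_continuous/derivable1_diffP/ex_derive.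
have cvgI : (\int[mu]_(x in `[a n, b n]%classic) (f x)%:E)%E @[n --> \oo] -->
    (\int[mu]_(x in D) (f x)%:E)%E.
  apply: ge0_nondecreasing_set_cvg_integral => //.
  - apply/nondecreasing_seqP => n.
    by apply/subsetPset/subset_itv; rewrite bnd_simp.
  - by move=> i x _; rewrite lee_fin.
apply: cvge_le cvgI; near=> n; rewrite (continuous_FTC2 (F := F))//.
- by rewrite -EFinB lee_fin.
- have Da : D (a n) by apply: (DS n); rewrite /= bound_itvE ltW.
  have Db : D (b n) by apply: (DS n); rewrite /= bound_itvE ltW.
  split=> [x xab||]; last 2 first.
      by apply: cvg_at_right_filter; exact: cF.
    by apply: cvg_at_left_filter; exact: cF.
  have : D x by apply: (DS n); apply: subset_itv_oo_cc xab.
  by move/dF => h; exact: ex_derive.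
- move=> x xab; rewrite derive1E.
  have : D x by apply: (DS n); apply: subset_itv_oo_cc xab.
  by move/dF => h; rewrite derive_val.
Unshelve. all: by end_near. Qed.

(** The successor keeps the interval nondegenerate at [i = 0], as [integral_le_antiderivative]
    requires. *)
Lemma bigcup_itv_Nn_n :
  \bigcup_i `[(- i.+1%:R)%R, i.+1%:R]%classic = [set: R].
Proof.
apply/seteqP; split => // x _.
have : setT x by []. rewrite -(bigcup_itvT false true) => -[n _ /= xn].
exists n => //=; move: xn; rewrite !in_itv/= => /andP[h1 h2]; apply/andP; split.
  by rewrite (le_trans _ (ltW h1))// lerN2 ler_nat.
by rewrite (le_trans (ltW h2))// ler_nat.
Qed.

(** The exact value is [pi / (c * t)]; the constant 4 comes from [pi / 2 < 2]. *)
Lemma integral_cauchy_le (c t a : R) : 0 < c -> 0 < t ->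
  (\int[mu]_x ((c ^+ 2 + t ^+ 2 * (x + a) ^+ 2)^-1)%:E <= (4 / (c * t))%:E)%E.
Proof.
move=> c0 t0.
have c20 x : 0 < c ^+ 2 + t ^+ 2 * (x + a) ^+ 2.
  by rewrite ltr_pwDl ?exprn_gt0// mulr_ge0 ?sqr_ge0.
rewrite -bigcup_itv_Nn_n.
apply: (@integral_le_antiderivative _ _ _
  (fun x => (c * t)^-1 * atan (t / c * (x + a)))).
- by move=> n; rewrite (@lt_trans _ _ 0)// ?oppr_lt0// ltr0n.
- by move=> n; rewrite lerN2 ler_nat.
- by move=> n; rewrite ler_nat.
- move=> x _; apply: is_derive_eq.
  rewrite /GRing.scale/=.
  rewrite !(mulr0,add0r,addr0,mul0r,mulr1).
  have := c20 x => /gt_eqF/negbT h; field.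
  by rewrite exprMn h !gt_eqF.
- move=> x _; apply: cvgV; first by rewrite gt_eqF.
  apply: cvgD; first exact: cvg_cst.
  apply: cvgM; first exact: cvg_cst.
  rewrite expr2; under eq_fun do rewrite expr2.
  by apply: cvgM; apply: cvgD => //; exact: cvg_cst.
- by move=> x; rewrite invr_ge0 ltW.
- move=> x y; rewrite -mulrBr mulrC ler_pM2r ?invr_gt0 ?mulr_gt0//.
  have := atan_ltpi2 (t / c * (y + a)); have := atan_gtNpi2 (t / c * (x + a)).
  have /andP[_] := @pihalf_02 R; lra.
Qed.

Lemma integral_cauchy1_le : (\int[mu]_x ((1 + x ^+ 2)^-1)%:E <= 4%:E)%E.
Proof.
have := @integral_cauchy_le 1 1 0 ltr01 ltr01.
under eq_integral do rewrite addr0 !expr1n mul1r.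
by rewrite mul1r divr1.
Qed.

(** The antiderivative [2 * atan (Num.sqrt (x + a))] varies by at most pi. The integrand blows up at
    [- a], so the half-line is exhausted by intervals that stay away from this point. *)
Lemma integral_invsqrt_pos_le (a : R) :
  (\int[mu]_(x in `](- a)%R, +oo[)
     ((Num.sqrt `|x + a| * (1 + `|x + a|))^-1)%:E <= 4%:E)%E.
Proof.
have -> : `]- a, +oo[%classic =
    \bigcup_n `[- a + n.+1%:R^-1, - a + n.+2%:R]%classic.
  apply/seteqP; split => x; last first.
    move=> [n _]; rewrite /= !in_itv/= => /andP[h _]; rewrite andbT.
    by apply: lt_le_trans h; rewrite ltrDl invr_gt0.
  rewrite /= in_itv/= andbT => xa.
  have d0 : 0 < x + a by rewrite -(opprK a) subr_gt0.
  (* The first entry pushes the right end beyond x, the second brings the left end below it. *)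
  pose n := maxn (Num.truncn (x + a)) (Num.truncn (x + a)^-1).
  exists n => //=; rewrite in_itv/= -!lerBrDl opprK; apply/andP; split.
    rewrite invf_ple ?posrE// ltW//.
    by rewrite (lt_le_trans (truncnS_gt _))// ler_nat ltnS leq_maxr.
  rewrite addrC lerBrDl addrC ltW// (lt_le_trans (truncnS_gt _))// ler_nat.
  by rewrite leqW// ltnS leq_maxl.
have Dpos x : (\bigcup_n `[- a + n.+1%:R^-1, - a + n.+2%:R]%classic) x ->
    0 < x + a.
  move=> [n _]; rewrite /= in_itv/= -lerBrDl opprK => /andP[h _].
  by apply: lt_le_trans h; rewrite invr_gt0.
apply: (@integral_le_antiderivative _ _ _
  (fun x => 2 * atan (Num.sqrt (x + a)))).
- move=> n; rewrite ltrD2l (@le_lt_trans _ _ 1)// ?invf_le1// ?ler1n//.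
  by rewrite ltr1n.
- by move=> n; rewrite lerD2l lef_pV2 ?posrE// ler_nat.
- by move=> n; rewrite lerD2l ler_nat.
- move=> x /Dpos xa.
  have h : is_derive (x + a) (1 : R) Num.sqrt (2 * Num.sqrt (x + a))^-1.
    exact: is_derive1_sqrt.
  apply: is_derive_eq.
  rewrite /GRing.scale/= gtr0_norm// sqr_sqrtr ?ltW//.
  have s0 : Num.sqrt (x + a) != 0 by rewrite gt_eqF// sqrtr_gt0.
  by field; rewrite s0 gt_eqF// ltr_pwDl// ltW.
- move=> x /Dpos xa; apply: cvgV.
    by rewrite mulf_neq0// gt_eqF// ?sqrtr_gt0 ?normr_gt0 ?gt_eqF// ltr_pwDl.
  have cn : (fun x => `|x + a|) y @[y --> x] --> `|x + a|.
    by apply: cvg_norm; apply: cvgD => //; exact: cvg_cst.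
  apply: cvgM; last by apply: cvgD => //; exact: cvg_cst.
  by apply: (continuous_cvg _ _ cn); exact: sqrt_continuous.
- by move=> x; rewrite invr_ge0 mulr_ge0 ?sqrtr_ge0// addr_ge0.
- move=> x y; rewrite -mulrBr.
  have := atan_ltpi2 (Num.sqrt (y + a)).
  have : 0 <= atan (Num.sqrt (x + a)).
    by rewrite -(@atan0 R) le_atan// sqrtr_ge0.
  have /andP[_] := @pihalf_02 R; lra.
Qed.

Lemma integral_reflect (f : R -> \bar R) (D : set R) : measurable D ->
  measurable_fun D f -> (forall x, 0 <= f x)%E ->
  (\int[mu]_(x in -%R @^-1` D) f (- (x : R))%R = \int[mu]_(x in D) f x)%E.
Proof.
move=> mD mf f0.
have mN : measurable_fun setT (-%R : measurableTypeR R -> measurableTypeR R).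
  exact: oppr_measurable.
have := @ge0_integral_pushforward _ _ _ _ R _ mN mu D f mD mf (fun x _ => f0 x).
move=> <-.
by apply: eq_measure_integral => A mA _; exact: lebesgue_measureN.
Qed.

Let invsqrt_fun (a x : R) : R := (Num.sqrt `|x + a| * (1 + `|x + a|))^-1.

Let measurable_invsqrt_fun a : measurable_fun setT (EFin \o invsqrt_fun a).
Proof.
apply/measurable_EFinP/measurable_funV/measurable_funM.
  apply: measurable_sqrt; apply/measurableT_comp => //.
  exact: measurable_funD.
apply: measurable_funD => //; apply/measurableT_comp => //.
exact: measurable_funD.
Qed.

Lemma integral_invsqrt_le (a : R) :
  (\int[mu]_x ((Num.sqrt `|x + a| * (1 + `|x + a|))^-1)%:E <= 8%:E)%E.
Proof.
have f0 b x : (0 <= (invsqrt_fun b x)%:E)%E.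
  by rewrite lee_fin invr_ge0 mulr_ge0 ?sqrtr_ge0// addr_ge0.
have -> : [set: R] = `]-oo, (- a)%R[%classic `|` `[(- a)%R, +oo[%classic.
  apply/seteqP; split => // x _ /=; rewrite !in_itv/= andbT.
  by apply/orP; rewrite orbC leNgt orNb.
rewrite ge0_integral_setU//=; last 2 first.
- exact: (measurable_funS measurableT (@subsetT _ _) (measurable_invsqrt_fun _)).
- rewrite disj_set2E; apply/eqP/seteqP; split => // x [] /=.
  by rewrite !in_itv/= andbT ltNge => /negP.
rewrite (_ : 8 = 4 + 4 :> R); last by lra.
rewrite EFinD leeD//; last first.
  rewrite -integral_itv_obnd_cbnd; first exact: integral_invsqrt_pos_le.
  exact: (measurable_funS measurableT (@subsetT _ _) (measurable_invsqrt_fun _)).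
(* The reflection of the line carries the left half to a right half, with [- a] in place of [a]. *)
have := integral_invsqrt_pos_le (- a); rewrite opprK; apply: le_trans.
rewrite -integral_reflect//; last first.
  exact: (measurable_funS measurableT (@subsetT _ _) (measurable_invsqrt_fun _)).
rewrite (_ : -%R @^-1` `]a, +oo[%classic = `]-oo, (- a)%R[%classic); last first.
  by apply/seteqP; split => x; rewrite /= !in_itv/= andbT ltrNr.
rewrite le_eqVlt; apply/orP; left; apply/eqP; apply: eq_integral => x _.
by rewrite -opprD normrN.
Qed.

End one_dim.

(** The integral of a nonnegative function is a supremum over simple functions below it, hence
    monotone without measurability. Iterated integrals can then be compared level by level. *)
Lemma ge0_le_integral_nomeas d (T : measurableType d) (R : realType)
    (mu : {measure set T -> \bar R}) (D : set T) (f g : T -> \bar R) :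
  (forall x, D x -> 0 <= f x)%E -> (forall x, D x -> f x <= g x)%E ->
  (\int[mu]_(x in D) f x <= \int[mu]_(x in D) g x)%E.
Proof.
move=> f0 fg.
have g0 x : D x -> (0 <= g x)%E by move=> Dx; apply: le_trans (f0 x Dx) (fg x Dx).
rewrite !ge0_integralE//; apply: le_ereal_sup => _ [h/= hf <-]; exists h => // x.
apply: le_trans (hf x) _; rewrite !patchE; case: ifPn => // /set_mem Dx.
exact: fg.
Qed.

Lemma ge0_integral_lincomb d (T : measurableType d) (R : realType)
    (mu : {measure set T -> \bar R}) (a b : R) (f g : T -> R) :
  0 <= a -> 0 <= b -> (forall x, 0 <= f x) -> (forall x, 0 <= g x) ->
  measurable_fun setT f -> measurable_fun setT g ->
  (\int[mu]_x (a * f x + b * g x)%:E =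
     a%:E * \int[mu]_x (f x)%:E + b%:E * \int[mu]_x (g x)%:E)%E.
Proof.
move=> a0 b0 f0 g0 mf mg; under eq_integral do rewrite EFinD !EFinM.
rewrite ge0_integralD//; first last.
- by rewrite -/(measurable_fun _ _); apply/measurable_EFinP/measurable_funM.
- by move=> x _; rewrite -EFinM lee_fin mulr_ge0.
- by apply/measurable_EFinP/measurable_funM.
- by move=> x _; rewrite -EFinM lee_fin mulr_ge0.
rewrite !ge0_integralZl_EFin//.
- by move=> x _; rewrite lee_fin.
- exact/measurable_EFinP.
- by move=> x _; rewrite lee_fin.
- exact/measurable_EFinP.
Qed.

Lemma ge0_integral_scale d (T : measurableType d) (R : realType)
    (mu : {measure set T -> \bar R}) (a : R) (f : T -> R) :
  0 <= a -> (forall x, 0 <= f x) -> measurable_fun setT f ->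
  (\int[mu]_x (a * f x)%:E = a%:E * \int[mu]_x (f x)%:E)%E.
Proof.
move=> a0 f0 mf; under eq_integral do rewrite EFinM.
rewrite ge0_integralZl_EFin//; last exact/measurable_EFinP.
by move=> x _; rewrite lee_fin.
Qed.

(** * The singular integral over three coordinates *)

Section three_dim.
Context {R : realType}.
Notation mu := (@lebesgue_measure R).
(** A product of three [q] is the envelope left of the density of a projected row; [k] carries the
    singularity that survives the innermost integration. *)
Let q (s : R) : R := (1 + s ^+ 2)^-1.
Let k (s : R) : R := (Num.sqrt `|s|)^-1.

Let q0 s : 0 <= q s.
Proof. by rewrite invr_ge0 addr_ge0// sqr_ge0. Qed.

Let q1 s : q s <= 1.
Proof. by rewrite invf_le1// ?lerDl ?sqr_ge0// ltr_pwDl// sqr_ge0. Qed.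

Let k0 s : 0 <= k s.
Proof. by rewrite invr_ge0 sqrtr_ge0. Qed.

Let mq : measurable_fun setT q.
Proof. by apply: measurable_funV; apply: measurable_funD. Qed.

Let mk a : measurable_fun setT (fun s : R => k (s + a)).
Proof.
apply: measurable_funV; apply: measurable_sqrt; apply/measurableT_comp => //.
exact: measurable_funD.
Qed.

Lemma integral_cauchy_invsqrt_le (a : R) :
  (\int[mu]_x (q x * k (x + a))%:E <= 20%:E)%E.
Proof.
(* Away from 0 the kernel is at most 1; near 0 it is comparable to the integrable kernel of
   [integral_invsqrt_le]. Hence [20 = 4 + 2 * 8]. *)
have kle s : k s <= 1 + 2 * (Num.sqrt `|s| * (1 + `|s|))^-1.
  have [s1|s1] := lerP 1 `|s|.
    rewrite (@le_trans _ _ 1)//.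
      rewrite /k invf_le1 ?sqrtr_gt0 ?(lt_le_trans _ s1)//.
      by rewrite -[leLHS]sqrtr1 ler_wsqrtr.
    by rewrite lerDl mulr_ge0// invr_ge0 mulr_ge0 ?sqrtr_ge0// addr_ge0.
  rewrite invfM mulrCA mulrA -/(k s) (@le_trans _ _ (k s * 2 / 2)) //.
    by rewrite mulfK.
  rewrite (@le_trans _ _ (k s * 2 / (1 + `|s|)))//; last by rewrite lerDr.
  rewrite ler_wpM2l// ?mulr_ge0// lef_pV2 ?posrE//.
  by move: s1; lra.
have i0 x : 0 <= (Num.sqrt `|x + a| * (1 + `|x + a|))^-1.
  by rewrite invr_ge0 mulr_ge0 ?sqrtr_ge0// addr_ge0.
have mi : measurable_fun setT (fun x : R => (Num.sqrt `|x + a| * (1 + `|x + a|))^-1).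
  have mn : measurable_fun setT (fun x : R => `|x + a|).
    by apply/measurableT_comp => //; exact: measurable_funD.
  apply/measurable_funV/measurable_funM; first exact: measurable_sqrt.
  exact: measurable_funD.
apply: (@le_trans _ _ (\int[mu]_x (1 * q x +
    2 * (Num.sqrt `|x + a| * (1 + `|x + a|))^-1)%:E)%E).
  apply: ge0_le_integral_nomeas => x _; first by rewrite lee_fin mulr_ge0.
  rewrite lee_fin (le_trans (ler_wpM2l (q0 x) (kle _)))//.
  by rewrite mulrDr mulr1 mul1r lerD2l ler_piMl// mulr_ge0.
rewrite ge0_integral_lincomb// mul1e.
rewrite (_ : 20 = 4 + 2 * 8 :> R); last by lra.
apply: le_trans (leeD integral_cauchy1_le
  (lee_wpmul2l _ (integral_invsqrt_le a))) _ => //.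
Qed.

(** The numerator is split into [1 + d], paid by the Cauchy integral, and [|p + a|], which the
    denominator absorbs by the inequality between arithmetic and geometric means. The sum is
    [(8 + 12 / d) / (b * t)], and the same inequality bounds [1 / d] by a product of one function of
    [P0] and one of [P1]. *)
Lemma key_integral_inner (b t P0 P1 a : R) : 0 < b -> 0 < t ->
  P0 != 0 -> P1 != 0 ->
  (\int[mu]_p (q p * ((1 + `|P0| + `|P1| + `|p + a|) /
      (b ^+ 2 * (P0 ^+ 2 + P1 ^+ 2) + t ^+ 2 * (p + a) ^+ 2)))%:E <=
    ((8 + 6 * (k P0 * k P1)) / (b * t))%:E)%E.
Proof.
move=> b0 t0 P00 P10.
(* With this [c], the squared length of [(P0, P1)] is replaced by a multiple of the square of [d],
   which brings the denominator to the form of [integral_cauchy_le]. *)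
pose d : R := `|P0| + `|P1|; pose c : R := b * d / 2.
have d0 : 0 < d by rewrite addr_gt0 ?normr_gt0.
have c0 : 0 < c by rewrite divr_gt0 ?mulr_gt0.
have cle : c ^+ 2 <= b ^+ 2 * (P0 ^+ 2 + P1 ^+ 2).
  rewrite /c -mulrA exprMn ler_pM2l ?exprn_gt0// /d -(real_normK (num_real P0)).
  rewrite -(real_normK (num_real P1)).
  have := normr_ge0 P0; have := normr_ge0 P1; nra.
have den0 p : 0 < c ^+ 2 + t ^+ 2 * (p + a) ^+ 2.
  by rewrite ltr_pwDl ?exprn_gt0// mulr_ge0 ?sqr_ge0.
apply: (@le_trans _ _ (\int[mu]_p
   ((1 + d) * (c ^+ 2 + t ^+ 2 * (p + a) ^+ 2)^-1 +
    (2 * c * t)^-1 * q p)%:E)%E).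
  apply: ge0_le_integral_nomeas => p _.
    rewrite lee_fin mulr_ge0// divr_ge0// ?addr_ge0// mulr_ge0 ?sqr_ge0//.
    by rewrite addr_ge0 ?sqr_ge0.
  rewrite lee_fin.
  rewrite (@le_trans _ _ (q p * ((1 + d + `|p + a|) /
      (c ^+ 2 + t ^+ 2 * (p + a) ^+ 2))))//.
    rewrite ler_wpM2l// /d -!addrA ler_wpM2l ?addr_ge0// lef_pV2 ?posrE//.
      by rewrite lerD2r.
    by rewrite (lt_le_trans (den0 p))// lerD2r.
  rewrite [X in q p * X]mulrDl mulrDr lerD//.
    by rewrite ler_piMl// divr_ge0 ?(ltW (den0 _))// addr_ge0// (ltW d0).
  rewrite mulrC ler_wpM2r// ler_pdivrMr// mulrC ler_pdivlMr ?mulr_gt0//.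
  have := sqr_ge0 (c - t * `|p + a|).
  rewrite -(real_normK (num_real (p + a))); nra.
have mc : measurable_fun setT (fun p : R => (c ^+ 2 + t ^+ 2 * (p + a) ^+ 2)^-1).
  apply: measurable_funV; apply: measurable_funD => //.
  by apply: measurable_funM => //; apply: measurable_funX; exact: measurable_funD.
rewrite ge0_integral_lincomb//; first last.
- by move=> p; rewrite invr_ge0 ltW.
- by rewrite invr_ge0 !mulr_ge0// ltW.
- by rewrite addr_ge0// ltW.
apply: (@le_trans _ _ ((1 + d)%:E * (4 / (c * t))%:E + ((2 * c * t)^-1)%:E * 4%:E)%E).
  apply: leeD.
    apply: lee_wpmul2l; first by rewrite lee_fin addr_ge0// ltW.
    exact: integral_cauchy_le.
  apply: lee_wpmul2l; first by rewrite lee_fin invr_ge0 !mulr_ge0// ltW.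
  exact: integral_cauchy1_le.
rewrite -!EFinM -EFinD lee_fin.
have -> : (1 + d) * (4 / (c * t)) + (2 * c * t)^-1 * 4 = (8 + 12 * d^-1) / (b * t).
  by rewrite /c; field; rewrite !gt_eqF.
rewrite ler_pM2r ?invr_gt0 ?mulr_gt0// lerD2l.
have -> : 12 * d^-1 = 6 * (d / 2)^-1 by field; rewrite gt_eqF.
rewrite ler_pM2l// /k -invfM lef_pV2 ?posrE ?divr_gt0// ?mulr_gt0 ?sqrtr_gt0 ?normr_gt0//.
have := sqr_ge0 (Num.sqrt `|P0| - Num.sqrt `|P1|).
have := sqr_sqrtr (normr_ge0 P0); have := sqr_sqrtr (normr_ge0 P1).
by rewrite /d; nra.
Qed.

Lemma ge0_le_integral_off_point (f g : R -> \bar R) (r : R) :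
  (forall x, 0 <= f x)%E -> (forall x, 0 <= g x)%E -> measurable_fun setT g ->
  (forall x, x != r -> f x <= g x)%E ->
  (\int[mu]_x f x <= \int[mu]_x g x)%E.
Proof.
move=> f0 g0 mg fg.
pose g' x := if x == r then +oo%E else g x.
have gg' : {in setT `\ r, g =1 g'}.
  by move=> x; rewrite inE /g' => -[_ /eqP/negPf ->].
have mgD : measurable_fun (setT `\ r) g by exact: (measurable_funS measurableT).
have mg'D : measurable_fun (setT `\ r) g' by apply: eq_measurable_fun mgD.
apply: (@le_trans _ _ (\int[mu]_x g' x)%E).
  apply: ge0_le_integral_nomeas => // x _; rewrite /g'; case: eqVneq => [_|/fg//].
  by rewrite leey.
have mD : measurable ([set: R] `\ r) by exact: measurableD.
rewrite -(integral_setD1 mD mg'D) -(integral_setD1 mD mgD).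
by rewrite le_eqVlt; apply/orP; left; apply/eqP/eq_integral => x /gg'.
Qed.

(* Integrating p2 first leaves a factor (|P0| + |P1|)^-1, which is at most
   (|P0| |P1|)^(-1/2), so that the other two integrals converge separately. *)
Lemma key_integral (b t a0 a1 a2 : R) : 0 < b -> 0 < t ->
  (\int[mu]_p0 \int[mu]_p1 \int[mu]_p2 (q p0 * (q p1 * (q p2 *
    ((1 + `|p0 + a0| + `|p1 + a1| + `|p2 + a2|) /
      (b ^+ 2 * ((p0 + a0) ^+ 2 + (p1 + a1) ^+ 2) +
       t ^+ 2 * (p2 + a2) ^+ 2)))))%:E <= (2600 / (b * t))%:E)%E.
Proof.
move=> b0 t0.
have bt0 : 0 < b * t by rewrite mulr_gt0.
pose h (P0 P1 p : R) := q p * ((1 + `|P0| + `|P1| + `|p + a2|) /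
      (b ^+ 2 * (P0 ^+ 2 + P1 ^+ 2) + t ^+ 2 * (p + a2) ^+ 2)).
have h0 P0 P1 p : 0 <= h P0 P1 p.
  rewrite mulr_ge0// divr_ge0// ?addr_ge0// mulr_ge0 ?sqr_ge0//.
  by rewrite addr_ge0 ?sqr_ge0.
have mh P0 P1 : measurable_fun setT (h P0 P1).
  apply: measurable_funM => //; apply: measurable_funM.
    apply: measurable_funD => //; apply/measurableT_comp => //.
    exact: measurable_funD.
  apply: measurable_funV; apply: measurable_funD => //.
  apply: measurable_funM => //; apply: measurable_funX.
  exact: measurable_funD.
pose G (p0 p1 : R) : R := q p1 * (8 + 6 * (k (p0 + a0) * k (p1 + a1))).
have G0 p0 p1 : 0 <= G p0 p1.
  by rewrite mulr_ge0// addr_ge0// mulr_ge0// mulr_ge0.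
have mG p0 : measurable_fun setT (G p0).
  by apply: measurable_funM => //; apply: measurable_funD => //;
     do 2![apply: measurable_funM => //].
have mqk a : measurable_fun setT (fun s : R => q s * k (s + a)).
  by apply: measurable_funM => //; exact: mk.
have intG p0 : (\int[mu]_p1 (G p0 p1)%:E <= (32 + 120 * k (p0 + a0))%:E)%E.
  have -> : (fun p1 => (G p0 p1)%:E) = (fun p1 => (8 * q p1 +
      6 * k (p0 + a0) * (q p1 * k (p1 + a1)))%:E).
    by apply/funext => p1; rewrite /G; congr (_%:E); ring.
  rewrite ge0_integral_lincomb//; first last.
  - exact: mqk.
  - by move=> x; rewrite mulr_ge0.
  - by rewrite mulr_ge0.
  rewrite (_ : 32 + _ = 8 * 4 + 6 * k (p0 + a0) * 20); last by ring.
  have k60 : (0 <= (6 * k (p0 + a0))%:E)%E by rewrite lee_fin mulr_ge0.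
  apply: le_trans (leeD (lee_wpmul2l _ integral_cauchy1_le)
    (lee_wpmul2l k60 (integral_cauchy_invsqrt_le a1))) _ => //.
have inner p0 p1 : p0 != - a0 -> p1 != - a1 ->
    (\int[mu]_p2 (q p0 * (q p1 * h (p0 + a0) (p1 + a1) p2))%:E <=
      (q p0 / (b * t) * G p0 p1)%:E)%E.
  rewrite -(subr_eq0 p0) -(subr_eq0 p1) !opprK => P0 P1.
  under eq_integral do rewrite mulrA.
  rewrite ge0_integral_scale ?mulr_ge0//; last exact: mh.
  apply: (@le_trans _ _ ((q p0 * q p1)%:E * _)%E).
    apply: lee_wpmul2l; first by rewrite lee_fin mulr_ge0.
    exact: (key_integral_inner a2 b0 t0 P0 P1).
  rewrite -EFinM lee_fin /G le_eqVlt; apply/orP; left; apply/eqP.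
  by field; rewrite !gt_eqF.
apply: (@le_trans _ _
  (\int[mu]_p0 (q p0 / (b * t) * (32 + 120 * k (p0 + a0)))%:E)%E).
  apply: (@ge0_le_integral_off_point _ _ (- a0)).
  - move=> x; do 2![apply: integral_ge0 => ? _]; rewrite lee_fin.
    exact: mulr_ge0 (q0 _) (mulr_ge0 (q0 _) (h0 _ _ _)).
  - by move=> x; rewrite lee_fin mulr_ge0 ?divr_ge0 ?addr_ge0 ?mulr_ge0// ltW.
  - apply/measurable_EFinP; apply: measurable_funM; first exact: measurable_funM.
    by apply: measurable_funD => //; apply: measurable_funM => //; exact: mk.
  move=> p0 p0a.
  apply: (@le_trans _ _ (\int[mu]_p1 (q p0 / (b * t) * G p0 p1)%:E)%E).
    apply: (@ge0_le_integral_off_point _ _ (- a1)).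
    - move=> x; apply: integral_ge0 => ? _; rewrite lee_fin.
      exact: mulr_ge0 (q0 _) (mulr_ge0 (q0 _) (h0 _ _ _)).
    - by move=> x; rewrite lee_fin mulr_ge0 ?divr_ge0// ltW.
    - by apply/measurable_EFinP; apply: measurable_funM.
    - by move=> p1; exact: inner.
  rewrite ge0_integral_scale;
    [|by rewrite divr_ge0// ltW|exact: G0|exact: mG].
  rewrite (EFinM _ (32 + _)); apply: lee_wpmul2l; last exact: intG.
  by rewrite lee_fin divr_ge0// ltW.
have -> : (fun p0 => (q p0 / (b * t) * (32 + 120 * k (p0 + a0)))%:E) =
    (fun p0 => (32 / (b * t) * q p0 +
      120 / (b * t) * (q p0 * k (p0 + a0)))%:E).
  apply/funext => p1; congr (_%:E).
  by field; rewrite !gt_eqF.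
rewrite ge0_integral_lincomb//; first last.
- exact: mqk.
- by move=> x; rewrite mulr_ge0.
- by rewrite divr_ge0// ltW.
- by rewrite divr_ge0// ltW.
rewrite (@le_trans _ _ ((32 / (b * t) * 4 + 120 / (b * t) * 20)%:E))//.
  rewrite [leRHS]EFinD (EFinM _ 4) (EFinM _ 20) leeD//.
    apply: lee_wpmul2l; first by rewrite lee_fin divr_ge0// ltW.
    exact: integral_cauchy1_le.
  apply: lee_wpmul2l; first by rewrite lee_fin divr_ge0// ltW.
  exact: integral_cauchy_invsqrt_le.
rewrite lee_fin.
have -> : 32 / (b * t) * 4 + 120 / (b * t) * 20 = 2528 / (b * t).
  by field; rewrite !gt_eqF.
by rewrite ler_pM2r ?invr_gt0//; lra.
Qed.

End three_dim.

(** * Measurability of matrix operations *)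

Section matrix_measurability.
Context {R : realType} {d} {T : measurableType d}.

Lemma measurable_bigsum (I : Type) (r : seq I) (p : pred I) (F : I -> T -> R) :
  (forall i, measurable_fun setT (F i)) ->
  measurable_fun setT (fun w => \sum_(i <- r | p i) F i w).
Proof.
move=> mF; elim: r => [|i r IH].
  by under eq_fun do rewrite big_nil; exact: measurable_cst.
under eq_fun do rewrite big_cons; case: (p i) => //.
exact: measurable_funD.
Qed.

Lemma measurable_bigprod (I : Type) (r : seq I) (p : pred I) (F : I -> T -> R) :
  (forall i, measurable_fun setT (F i)) ->
  measurable_fun setT (fun w => \prod_(i <- r | p i) F i w).
Proof.
move=> mF; elim: r => [|i r IH].
  by under eq_fun do rewrite big_nil; exact: measurable_cst.
under eq_fun do rewrite big_cons; case: (p i) => //.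
exact: measurable_funM.
Qed.

Lemma measurable_det n (F : T -> 'M[R]_n) :
  (forall i j, measurable_fun setT (fun w => F w i j)) ->
  measurable_fun setT (fun w => \det (F w)).
Proof.
move=> mF; apply: measurable_bigsum => s; apply: measurable_funM => //.
by apply: measurable_bigprod.
Qed.

Lemma measurable_mulmx m n p (F : T -> 'M[R]_(m, n)) (G : T -> 'M[R]_(n, p)) :
  (forall i j, measurable_fun setT (fun w => F w i j)) ->
  (forall i j, measurable_fun setT (fun w => G w i j)) ->
  forall i j, measurable_fun setT (fun w => (F w *m G w) i j).
Proof.
move=> mF mG i j; under eq_fun do rewrite mxE.
by apply: measurable_bigsum => k; exact: measurable_funM.
Qed.

Lemma measurable_trmx m n (F : T -> 'M[R]_(m, n)) :
  (forall i j, measurable_fun setT (fun w => F w i j)) ->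
  forall i j, measurable_fun setT (fun w => (F w)^T i j).
Proof. by move=> mF i j; under eq_fun do rewrite mxE; exact: mF. Qed.

Lemma measurable_addmx m n (F G : T -> 'M[R]_(m, n)) :
  (forall i j, measurable_fun setT (fun w => F w i j)) ->
  (forall i j, measurable_fun setT (fun w => G w i j)) ->
  forall i j, measurable_fun setT (fun w => (F w + G w) i j).
Proof.
move=> mF mG i j; under eq_fun do rewrite mxE.
by apply: measurable_funD.
Qed.

Lemma measurable_oppmx m n (F : T -> 'M[R]_(m, n)) :
  (forall i j, measurable_fun setT (fun w => F w i j)) ->
  forall i j, measurable_fun setT (fun w => (- F w) i j).
Proof.
move=> mF i j; under eq_fun do rewrite mxE.
exact: measurable_funN (mF i j).
Qed.

(** Cramer's formula makes every entry a quotient of polynomials in the entries, with value 0 at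
    singular matrices, so no case distinction on invertibility arises. *)
Lemma measurable_adj_inv n (F : T -> 'M[R]_n) :
  (forall i j, measurable_fun setT (fun w => F w i j)) ->
  forall i j, measurable_fun setT (fun w => ((\det (F w))^-1 *: \adj (F w)) i j).
Proof.
move=> mF i j; under eq_fun do rewrite !mxE.
apply: measurable_funM; first by apply: measurable_funV; exact: measurable_det.
apply: measurable_funM => //; apply: measurable_det => k l.
by under eq_fun do rewrite !mxE; exact: mF.
Qed.

Lemma measurable_hs_norm m n (F : T -> 'M[R]_(m, n)) :
  (forall i j, measurable_fun setT (fun w => F w i j)) ->
  measurable_fun setT (fun w => hs_norm (F w)).
Proof.
move=> mF; apply: measurable_sqrt; apply: measurable_bigsum => i.
by apply: measurable_bigsum => j; exact: measurable_funX.
Qed.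

End matrix_measurability.

(** * Replacing a row, and boxes of rows *)

Definition set_row {R : realType} m n (i : 'I_m) (x : 'rV[R]_n) (X : 'M[R]_(m, n)) :
  'M[R]_(m, n) := \matrix_(k, j) if k == i then x 0 j else X k j.

Lemma row_set_row {R : realType} m n (i k : 'I_m) (x : 'rV[R]_n) (X : 'M[R]_(m, n)) :
  row k (set_row i x X) = if k == i then x else row k X.
Proof.
apply/rowP => j; rewrite !mxE; case: eqP => // _.
by rewrite mxE.
Qed.

Lemma measurable_mx_entry {R : realType} m n (i : 'I_m) (j : 'I_n) :
  measurable_fun setT (fun X : 'M[R]_(m, n) => X i j).
Proof.
by have /measurable_fun_matrixP := @measurable_id _ 'M[R]_(m, n) setT; exact.
Qed.

Lemma measurable_row {R : realType} m n (i : 'I_m) :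
  measurable_fun setT (row i : 'M[R]_(m, n) -> 'rV[R]_n).
Proof.
apply/measurable_fun_matrixP => k j; under eq_fun do rewrite mxE.
exact: measurable_mx_entry.
Qed.

Lemma measurable_set_row {R : realType} m n (i : 'I_m) :
  measurable_fun setT
    (fun p : 'M[R]_(m, n) * 'rV[R]_n => set_row i p.2 p.1).
Proof.
apply/measurable_fun_matrixP => k j; under eq_fun do rewrite mxE.
case: eqP => _.
  exact: (measurableT_comp (measurable_mx_entry _ _) measurable_snd).
exact: (measurableT_comp (measurable_mx_entry _ _) measurable_fst).
Qed.

(* A box prescribes a measurable set for each row: independence is a statement
   about boxes, and they generate the sigma-algebra. *)
Definition row_boxes {R : realType} m n : set (set 'M[R]_(m, n)) :=
  [set C | exists B : 'I_m -> set 'rV[R]_n, (forall i, measurable (B i)) /\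
     C = [set X | forall i, B i (row i X)]].

Lemma row_box_measurable {R : realType} m n (C : set 'M[R]_(m, n)) :
  row_boxes C -> measurable C.
Proof.
move=> [B [mB ->]].
have -> : [set X : 'M[R]_(m, n) | forall i, B i (row i X)] =
    \bigcap_(i in [set: 'I_m]) (row i @^-1` B i).
  by apply/seteqP; split => [X h i _|X h i]; exact: h.
apply: fin_bigcap_measurable => // i _.
by rewrite -[X in measurable X]setTI; exact: measurable_row.
Qed.

Lemma row_boxes_generate {R : realType} m n (C : set 'M[R]_(m, n)) :
  measurable C -> <<s @row_boxes R m n >> C.
Proof.
apply: smallest_sub; first exact: smallest_sigma_algebra.
move=> _ [i [j [B [mB ->]]]]; apply: sub_sigma_algebra.
exists (fun k => if k == i then [set x : 'rV[R]_n | B (x 0 j)] else setT); split.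
  move=> k; case: eqP => // _.
  by rewrite -[X in measurable X]setTI; exact: measurable_mx_entry.
apply/seteqP; split => [X /= BX k|X /= /(_ i)].
  by case: eqP => // -> /=; rewrite mxE.
by rewrite eqxx /= mxE.
Qed.

(** * Resampling one row *)

Section resampling.
Context {R : realType} {d} {T : measurableType d} (P : probability T R).
Variables (m n : nat) (A : T -> 'M[R]_(m, n)).
Hypothesis mA : measurable_fun setT A.
Hypothesis indA : independent_rows P A.

Let resampled (i : 'I_m) (p : T * T) : 'M[R]_(m, n) :=
  set_row i (row i (A p.2)) (A p.1).

Let measurable_resampled i : measurable_fun setT (resampled i).
Proof.
have h : measurable_fun setT (fun p : T * T => (A p.1, row i (A p.2))).
  apply/measurable_fun_pairP; split => /=.
    exact: (measurableT_comp mA measurable_fst).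
  apply: (measurableT_comp (measurable_row i)).
  exact: (measurableT_comp mA measurable_snd).
exact: (measurableT_comp (measurable_set_row i) h).
Qed.

(** Boxes form a pi-system that generates the sigma-algebra, so comparing both laws on boxes is
    enough. On a box, independence is applied once to the given sides and once to the box [B'] whose
    side i is the whole space; the second copy supplies the missing factor. *)
Lemma resampled_distribution i (C : set 'M[R]_(m, n)) : measurable C ->
  pushforward P A C = pushforward (P \x P)%E (resampled i) C.
Proof.
move=> mC.
pose m1 : {measure set 'M[R]_(m, n) -> \bar R} :=
  measure_function_pushforward__canonical__measure_function_Measure P mA.
pose m2 : {measure set 'M[R]_(m, n) -> \bar R} :=
  measure_function_pushforward__canonical__measure_function_Measure
    (P \x P)%E (measurable_resampled i).
have m1T : m1 setT = 1%E by rewrite /m1 /= /pushforward preimage_setT probability_setT.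
apply: (@g_sigma_algebra_measure_unique _ R _ (@row_boxes R m n)
  (@row_box_measurable R m n) (fun=> setT) _ _ m1 m2).
- move=> _; exists (fun=> setT); split => //.
  by apply/seteqP; split.
- by rewrite bigcup_const//; exists 0%N.
- move=> _ _ [B [mB ->]] [B' [mB' ->]].
  exists (fun i => B i `&` B' i); split=> [k|]; first exact: measurableI.
  apply/seteqP; split => [X [h h'] k|X h]; first by split; [exact: h|exact: h'].
  by split => k; have [] := h k.
- move=> _ [B [mB ->]].
  rewrite /m1 /m2 /= /pushforward.
  have mrow k : measurable [set w | B k (row k (A w))].
    rewrite -[X in measurable X]setTI.
    exact: (measurableT_comp (measurable_row k) mA).
  pose B' k := if k == i then setT else B k.
  have -> : resampled i @^-1` [set X | forall i, B i (row i X)] =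
      [set w | forall k, B' k (row k (A w))] `*` [set w | B i (row i (A w))].
    apply/seteqP; split => [[w w']/= h|[w w']/= [h h'] k].
      split=> [k|]; last by have := h i; rewrite /resampled row_set_row eqxx.
      by have := h k; rewrite /resampled row_set_row /B'; case: eqP.
    rewrite /resampled row_set_row; have := h k; rewrite /B'.
    by case: eqP => // ->.
  have mB' k : measurable (B' k) by rewrite /B'; case: eqP.
  have mbox : measurable [set w | forall k, B' k (row k (A w))].
    rewrite (_ : [set w | _] = A @^-1` [set X | forall k, B' k (row k X)])//.
    rewrite -[X in measurable X]setTI; apply: mA => //.
    by apply: row_box_measurable; exists B'.
  rewrite product_measure1E//= !indA//.
  rewrite [in LHS](bigD1 i)//= [in RHS](bigD1 i)//= {1}/B' eqxx.
  rewrite (_ : [set w | setT (row i (A w))] = setT) ?probability_setT ?mul1e; last first.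
    by apply/seteqP; split.
  rewrite muleC; congr (_ * _)%E; apply: eq_bigr => k ki.
  by rewrite /B' (negPf ki).
- by move=> _; rewrite m1T ltry.
- exact: row_boxes_generate.
Qed.

(** This replaces conditioning on the rows other than i: in the inner integral they are frozen and
    only row i varies, so all linear algebra there concerns a fixed matrix. *)
Lemma integral_resample i (phi : 'M[R]_(m, n) -> \bar R) :
  measurable_fun setT phi -> (forall X, 0 <= phi X)%E ->
  (\int[P]_w phi (A w) =
   \int[P]_w \int[P]_w' phi (set_row i (row i (A w')) (A w)))%E.
Proof.
move=> mphi phi0.
transitivity (\int[pushforward P A]_X phi X)%E.
  by rewrite (ge0_integral_pushforward mA)// => X _.
transitivity (\int[pushforward (P \x P)%E (resampled i)]_X phi X)%E.
  apply: eq_measure_integral => C mC _; exact: (resampled_distribution i mC).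
rewrite (ge0_integral_pushforward (measurable_resampled i))//.
rewrite preimage_setT fubini_tonelli1//; last by move=> p; exact: phi0.
exact: (measurableT_comp mphi).
Qed.

Lemma measurable_integral_resample i (phi : 'M[R]_(m, n) -> \bar R) :
  measurable_fun setT phi -> (forall X, 0 <= phi X)%E ->
  measurable_fun setT
    (fun w => \int[P]_w' phi (set_row i (row i (A w')) (A w)))%E.
Proof.
move=> mphi phi0.
apply: (@measurable_fun_fubini_tonelli_F _ _ _ _ R P (phi \o resampled i)).
  exact: (measurableT_comp mphi).
by move=> p; exact: phi0.
Qed.

End resampling.

(** * Measures dominated by a density, and iterated integrals *)

Section density_domination.
Context d (T : measurableType d) (R : realType).
Variables (m mu : {measure set T -> \bar R}) (f : T -> R).
Hypothesis f0 : forall x, 0 <= f x.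
Hypothesis mf : measurable_fun setT f.
Hypothesis le_density : forall D, measurable D ->
  (m D <= \int[mu]_(x in D) (f x)%:E)%E.

Import HBNNSimple.

(** A simple function below [g] is a finite sum over its level sets, to each of which the setwise
    bound applies; at a point x only the level [h x] contributes. *)
Lemma le_density_integral (g : T -> R) : (forall x, 0 <= g x) ->
  (\int[m]_x (g x)%:E <= \int[mu]_x (g x * f x)%:E)%E.
Proof.
move=> g0; rewrite ge0_integralE//; last by move=> x _; rewrite lee_fin.
rewrite ge_ereal_sup// => _ [h hg <-].
have fin_h : finite_set (range h) by [].
have mh y : measurable (h @^-1` [set y]) by [].
rewrite sintegralE.
apply: (@le_trans _ _
    (\sum_(y \in range h) \int[mu]_x (y * \1_(h @^-1` [set y]) x * f x)%:E)%E).
  apply: lee_fsum => // _ [t _ <-].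
  apply: (@le_trans _ _
      ((h t)%:E * \int[mu]_(x in h @^-1` [set h t]) (f x)%:E)%E).
    by apply: lee_wpmul2l; rewrite ?lee_fin//; exact: le_density.
  rewrite integral_mkcond -ge0_integralZl//; first last.
  - by rewrite lee_fin.
  - by move=> x _; apply: erestrict_ge0 => y _; rewrite lee_fin.
  - apply/(measurable_restrictT (EFin \o f)) => //; apply/measurable_EFinP.
    exact: measurable_funS mf.
  rewrite le_eqVlt; apply/orP; left; apply/eqP; apply: eq_integral => x _.
  by rewrite patchE indicE; case: ifPn => _; rewrite ?mulr1 ?mulr0 ?mul0r ?mule0.
rewrite -ge0_integral_fsum//; last 2 first.
- move=> y; apply/measurable_EFinP; apply: measurable_funM => //.
  by apply: measurable_funM => //; exact: measurable_indic.
- move=> y x _; rewrite lee_fin mulr_ge0// indicE.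
  by case: (boolP (x \in _)) => [/set_mem /= <-|_]; rewrite ?mulr1 ?mulr0.
apply: ge0_le_integral_nomeas => x _.
  apply: fsume_ge0 => _ [y _ <-]; rewrite lee_fin mulr_ge0// mulr_ge0//.
rewrite (fsbigD1 (h x))//.
rewrite fsbig1; last first.
  by move=> y [_ /= /nesym yhx]; rewrite indicE memNset ?mulr0 ?mul0r.
rewrite -[leLHS]/((h x * \1_(h @^-1` [set h x]) x * f x)%:E + 0)%E adde0.
rewrite indicE mem_set// mulr1 lee_fin ler_wpM2r//.
by have := hg x; rewrite patchE mem_set// lee_fin.
Qed.
End density_domination.

Lemma product_measure_sigma_finite d1 d2 (T1 : measurableType d1)
    (T2 : measurableType d2) (R : realType)
    (m1 : {sigma_finite_measure set T1 -> \bar R})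
    (m2 : {sigma_finite_measure set T2 -> \bar R}) :
  sigma_finite setT (m1 \x m2)%E.
Proof.
have /sigma_finiteP[F [TF ndF Foo]] := sigma_finiteT m1.
have /sigma_finiteP[G [TG ndG Goo]] := sigma_finiteT m2.
exists (fun n => F n `*` G n).
  apply/seteqP; split=> // -[x y] _.
  have [n _ Fnx] : (\bigcup_k F k) x by rewrite -TF.
  have [k _ Gky] : (\bigcup_k G k) y by rewrite -TG.
  exists (maxn n k) => //; split.
    by move: x Fnx; exact/subsetPset/ndF/leq_maxl.
  by move: y Gky; exact/subsetPset/ndG/leq_maxr.
move=> k; have [mF Fk] := Foo k; have [mG Gk] := Goo k.
split; first exact: measurableX.
by rewrite product_measure1E// lte_mul_pinfty// ge0_fin_numE.
Qed.

Lemma fubini_tonelli3 d1 d2 d3 (T1 : measurableType d1) (T2 : measurableType d2)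
    (T3 : measurableType d3) (R : realType)
    (m1 : {sigma_finite_measure set T1 -> \bar R})
    (m2 : {sigma_finite_measure set T2 -> \bar R})
    (m3 : {sigma_finite_measure set T3 -> \bar R}) (f : T1 * T2 * T3 -> \bar R) :
  measurable_fun setT f -> (forall p, 0 <= f p)%E ->
  (\int[((m1 \x m2) \x m3)%E]_p f p =
   \int[m1]_a \int[m2]_b \int[m3]_c f ((a, b), c))%E.
Proof.
move=> mf f0.
pose sf := Measure_isSigmaFinite.Build _ _ _ (m1 \x m2)%E
  (product_measure_sigma_finite m1 m2).
pose m12 : {sigma_finite_measure set (T1 * T2)%type -> \bar R} :=
  HB.pack (m1 \x m2)%E sf.
have mF := @measurable_fun_fubini_tonelli_F _ _ _ _ R m3 f mf f0.
have F0 p : (0 <= fubini_F m3 f p)%E.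
  by apply: integral_ge0 => ? _; exact: f0.
transitivity (\int[m12]_p fubini_F m3 f p)%E; last exact: fubini_tonelli1.
exact: (@fubini_tonelli1 _ _ _ _ R m12 m3 f mf f0).
Qed.

(** * Three-dimensional marginals of a row *)

Section marginal_density.
Context {R : realType}.
Let q (s : R) : R := (1 + s ^+ 2)^-1.

Definition coord k n (U : 'M[R]_(k, n)) (i : 'I_k) (x : 'rV[R]_n) : R :=
  (x *m U^T) 0 i.

(** [F] is symmetric and idempotent, so [x *m F] and [x - x *m F] are the components of x in the row
    space of [F] and in its orthogonal complement, and the second has zero coordinates in the frame.
    Coordinates of a row can thus be read off its projection, which is what the density hypothesis
    speaks of. *)
Lemma frame_proj n (U : 'M[R]_(3, n)) (x : 'rV[R]_n) : U *m U^T = 1%:M ->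
  proj_orth (U^T *m U) x *m U^T = x *m U^T.
Proof.
move=> U1; set F := U^T *m U; set K := kermx F^T.
have FT : F^T = F by rewrite /F trmx_mul trmxK.
have UF : U *m F = U by rewrite /F mulmxA U1 mul1mx.
have FK0 : (F :&: K)%MS = 0.
  apply/eqP; rewrite -submx0; apply/rV_subP => v; rewrite sub_capmx.
  move=> /andP[/submxP[y vy] /sub_kermxP]; rewrite FT.
  suff -> : v *m F = v by move=> ->; exact: sub0mx.
  by rewrite vy /F -!mulmxA (mulmxA U) U1 mul1mx.
have full : (x <= F + K)%MS.
  have -> : x = x *m F + (x - x *m F) by rewrite addrC subrK.
  apply: addmx_sub_adds; first exact: submxMl.
  by apply/sub_kermxP; rewrite FT mulmxBl -mulmxA {2}/F -mulmxA UF subrr.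
rewrite /proj_orth -[in RHS](add_proj_mx FK0 full) mulmxDl.
have h : x *m proj_mx K F *m F = 0.
  by have /sub_kermxP := proj_mx_sub K F x; rewrite FT.
have FU : F *m U^T = U^T by rewrite /F -mulmxA U1 mulmx1.
by rewrite -[in X in _ = _ + X]FU mulmxA h mul0mx addr0.
Qed.

Context {d} {T : measurableType d} (P : probability T R) (K1 : R).

Definition bounded_marginals n (X : T -> 'rV[R]_n) :=
  forall F : 'M[R]_n, \rank F = 3%N ->
    exists rho : 'rV[R]_n -> R,
      is_density_on F (pushforward P (fun w => proj_orth F (X w))) rho /\
      forall x : 'rV[R]_n, (x <= F)%MS ->
        rho x <= K1 / Num.max 1 (norm2 x ^+ 2000).

Notation R3 :=
  (measurableTypeR R * measurableTypeR R * measurableTypeR R)%type.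

Definition coord3 n (U : 'M[R]_(3, n)) (x : 'rV[R]_n) : R3 :=
  (coord U 0 x, coord U 1 x, coord U 2%:R x).

Lemma measurable_coord k n (U : 'M[R]_(k, n)) i :
  measurable_fun setT (coord U i).
Proof.
apply: measurable_mulmx => j l; last exact: measurable_cst.
exact: measurable_mx_entry.
Qed.

Lemma measurable_coord3 n (U : 'M[R]_(3, n)) : measurable_fun setT (coord3 U).
Proof.
by apply/measurable_fun_pairP; split => /=; last exact: measurable_coord;
   apply/measurable_fun_pairP; split => /=; exact: measurable_coord.
Qed.

Lemma coord3_frame_map n (U : 'M[R]_(3, n)) (p : R3) : U *m U^T = 1%:M ->
  coord3 U (frame_map U p) = p.
Proof.
move=> U1.
have UU i j : (row i U *m U^T) 0 j = (i == j)%:R.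
  by rewrite -row_mul U1 !mxE.
have c j : coord U j (frame_map U p) =
    p.1.1 * (0 == j)%:R + p.1.2 * (1 == j)%:R + p.2 * (2%:R == j)%:R.
  have ad (r s : 'rV[R]_3) : (r + s) 0 j = r 0 j + s 0 j by rewrite mxE.
  have sc a (r : 'rV[R]_3) : (a *: r) 0 j = a * r 0 j by rewrite mxE.
  by rewrite /coord /frame_map !mulmxDl -!scalemxAl !ad !sc !UU.
case: p c => [[a b] e] c; rewrite /coord3 !c /=.
by rewrite !(mulr1,mulr0,addr0,add0r).
Qed.

Lemma norm2_frame_map n (U : 'M[R]_(3, n)) (p : R3) : U *m U^T = 1%:M ->
  norm2 (frame_map U p) = Num.sqrt (p.1.1 ^+ 2 + p.1.2 ^+ 2 + p.2 ^+ 2).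
Proof.
move=> U1.
have -> : norm2 (frame_map U p) =
    Num.sqrt ((frame_map U p *m (frame_map U p)^T) 0 0).
  move: (frame_map U p) => v.
  by congr Num.sqrt; rewrite mxE; apply: eq_bigr => j _; rewrite mxE expr2.
congr Num.sqrt.
have UU i j : row i U *m (row j U)^T = ((i == j)%:R)%:M.
  apply/matrixP => k l; rewrite !ord1; transitivity ((U *m U^T) i j).
    by rewrite !mxE; apply: eq_bigr => m _; rewrite !mxE.
  by rewrite U1 !mxE eqxx mulr1n.
have trD (v w : 'rV[R]_n) : (v + w)^T = v^T + w^T by rewrite linearD.
have trZ a (v : 'rV[R]_n) : (a *: v)^T = a *: v^T by rewrite linearZ.
rewrite /frame_map !trD !trZ !mulmxDl !mulmxDr -!scalemxAl -!scalemxAr !UU/=.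
by rewrite !mxE/= !mulr1n; ring.
Qed.

(** The density hypothesis holds for every orthonormal basis of the subspace, in particular for [U]
    itself; [coord3 U] inverts [frame_map U], which brings the integral over the subspace back to
    three coordinates. *)
Lemma marginal_law_le n (X : T -> 'rV[R]_n) (U : 'M[R]_(3, n)) (D : set R3) :
  measurable_fun setT X -> bounded_marginals X -> U *m U^T = 1%:M ->
  measurable D ->
  (P [set w | D (coord3 U (X w))] <=
   \int[lebesgue3]_(p in D)
     (K1 / Num.max 1 (Num.sqrt (p.1.1 ^+ 2 + p.1.2 ^+ 2 + p.2 ^+ 2) ^+ 2000))%:E)%E.
Proof.
move=> mX bX U1 mD.
pose F := U^T *m U.
have UF : (U :=: F)%MS.
  apply/eqmxP/andP; split; last exact: submxMl.
  by apply/submxP; exists U; rewrite mulmxA U1 mul1mx.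
have rF : \rank F = 3%N.
  rewrite -UF; apply/eqP; rewrite -/(row_free U); apply/row_freeP; exists U^T.
  exact: U1.
have [rho [[mrho rho0 dens] rhole]] := bX F rF.
have inFframe p : (frame_map U p <= F)%MS.
  rewrite -UF /frame_map; apply: addmx_sub; [apply: addmx_sub|];
    apply: scalemx_sub; exact: row_sub.
pose B := coord3 U @^-1` D.
have mB : measurable B.
  by rewrite -[B]setTI; exact: measurable_coord3.
have -> : [set w | D (coord3 U (X w))] =
    (fun w => proj_orth F (X w)) @^-1` B.
  by apply/seteqP; split => w; rewrite /B /= /coord3 /coord (frame_proj _ U1).
have := dens U (conj U1 UF) B mB; rewrite /pushforward => ->.
(* As [F] is idempotent, its row space is cut out by the finitely many equations [x *m F = x]. *)
have minF : measurable [set x : 'rV[R]_n | (x <= F)%MS].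
  have -> : [set x : 'rV[R]_n | (x <= F)%MS] =
      \bigcap_(j in [set: 'I_n]) [set x : 'rV[R]_n | (x *m F) 0 j - x 0 j = 0].
    apply/seteqP; split => [x /submxP[y ->] j _/=|x h].
      rewrite -mulmxA; suff -> : F *m F = F by rewrite subrr.
      by rewrite /F -!mulmxA (mulmxA U) U1 mul1mx.
    have -> : x = x *m F.
      by apply/rowP => j; apply/esym/eqP; rewrite -subr_eq0; apply/eqP; exact: h.
    exact: submxMl.
  apply: fin_bigcap_measurable => // j _.
  rewrite -[X in measurable X]setTI.
  have : measurable_fun setT (fun x : 'rV[R]_n => (x *m F) 0 j - x 0 j).
    apply: measurable_funB; last exact: measurable_mx_entry.
    by apply: measurable_mulmx => k l; [exact: measurable_mx_entry|exact: measurable_cst].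
  by move=> /(_ measurableT [set 0]); apply; exact: measurable_set1.
rewrite /lebesgue_frame (ge0_integral_pushforward (measurable_frame_map U))//; last 3 first.
- exact: measurableI.
- by apply/measurable_EFinP; apply: measurable_funS mrho => // x [].
- by move=> x /set_mem[xF _]; rewrite lee_fin; exact: rho0.
have -> : frame_map U @^-1` ([set x | (x <= F)%MS] `&` B) = D.
  apply/seteqP; split => p; rewrite /B /= (coord3_frame_map p U1).
    by case.
  by split.
apply: ge0_le_integral_nomeas => p _ /=; rewrite lee_fin.
  exact/rho0/inFframe.
by rewrite -(norm2_frame_map p U1); exact/rhole/inFframe.
Qed.

(** The twelfth power of the length of [(1, a, b, c)]: the moment that pays for the truncation of
    long rows. *)
Definition weight (a b c : R) : R := (1 + a ^+ 2 + b ^+ 2 + c ^+ 2) ^+ 6.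

(** [N] stands for a squared norm, so 1000 is half of 2000. The exponent 9 is 6 + 3: six factors for
    [weight], three to dominate the product of the three denominators of the Cauchy envelope. *)
Lemma expr9_le_expr1000 (N : R) : 0 <= N ->
  (1 + N) ^+ 9 <= 2 ^+ 9 * Num.max 1 (N ^+ 1000).
Proof.
move=> N0.
have N2 : 1 + N <= 2 * Num.max 1 N.
  by have [N1|N1] := lerP N 1; lra.
apply: (@le_trans _ _ ((2 * Num.max 1 N) ^+ 9)).
  by apply: lerXn2r; rewrite ?nnegrE ?addr_ge0 ?mulr_ge0 ?le_max ?ler01.
rewrite exprMn; apply: ler_wpM2l; first exact: exprn_ge0.
have [N1|N1] := lerP N 1.
  by rewrite expr1n le_max lexx.
by rewrite le_max; apply/orP; right; apply: ler_weXn2l => //; exact: ltW.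
Qed.

Lemma weighted_decay_le (a b c : R) : 0 <= K1 ->
  weight a b c *
    (K1 / Num.max 1 (Num.sqrt (a ^+ 2 + b ^+ 2 + c ^+ 2) ^+ 2000)) <=
  2 ^+ 9 * K1 * (q a * (q b * q c)).
Proof.
move=> K10; set N : R := a ^+ 2 + b ^+ 2 + c ^+ 2.
have N0 : 0 <= N by rewrite /N !addr_ge0 ?sqr_ge0.
have q1 (s : R) : 0 < 1 + s ^+ 2 by rewrite ltr_pwDl ?sqr_ge0.
have -> : Num.sqrt N ^+ 2000 = N ^+ 1000.
  by rewrite (_ : 2000 = 2 * 1000)%N// exprM sqr_sqrtr.
pose D : R := (1 + a ^+ 2) * ((1 + b ^+ 2) * (1 + c ^+ 2)).
have D0 : 0 < D by rewrite !mulr_gt0.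
have key : weight a b c * D <= 2 ^+ 9 * Num.max 1 (N ^+ 1000).
  apply: le_trans (expr9_le_expr1000 N0).
  have -> : weight a b c = (1 + N) ^+ 6 by rewrite /weight /N !addrA.
  have -> : (1 + N) ^+ 9 = (1 + N) ^+ 6 * (1 + N) ^+ 3 by rewrite -exprD.
  apply: ler_wpM2l; first by rewrite exprn_ge0// addr_ge0.
  rewrite !exprS expr0 mulr1.
  have e1 : 1 + a ^+ 2 <= 1 + N by rewrite lerD2l /N -addrA lerDl addr_ge0 ?sqr_ge0.
  have e2 : 1 + b ^+ 2 <= 1 + N.
    by rewrite lerD2l /N addrAC lerDr addr_ge0 ?sqr_ge0.
  have e3 : 1 + c ^+ 2 <= 1 + N by rewrite lerD2l /N lerDr addr_ge0 ?sqr_ge0.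
  have p0 (s : R) : 0 <= 1 + s ^+ 2 by exact: ltW.
  exact: ler_pM (p0 a) (mulr_ge0 (p0 b) (p0 c)) e1 (ler_pM (p0 b) (p0 c) e2 e3).
have -> : q a * (q b * q c) = D^-1 by rewrite /q -!invfM.
have M0 : 0 < Num.max 1 (N ^+ 1000) by rewrite lt_max ltr01.
move: (Num.max 1 (N ^+ 1000)) M0 key => M M0 key.
rewrite [leLHS]mulrA ler_pdivrMr// [leRHS]mulrAC ler_pdivlMr//.
by have := ler_wpM2l K10 key; rewrite mulrCA mulrA [in leRHS]mulrCA mulrA.
Qed.

Lemma lebesgue3_fubini (H : R3 -> R) :
  measurable_fun setT H -> (forall p, 0 <= H p) ->
  (\int[lebesgue3]_p (H p)%:E = \int[lebesgue_measure]_a \int[lebesgue_measure]_b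
     \int[lebesgue_measure]_c (H ((a, b), c))%:E)%E.
Proof.
move=> mH H0.
have mHE : measurable_fun setT (EFin \o H) by exact/measurable_EFinP.
have HE0 p : (0 <= (EFin \o H) p)%E by rewrite lee_fin.
transitivity (\int[((lebesgue_measure \x lebesgue_measure) \x
    lebesgue_measure)%E]_p (EFin \o H) p)%E; first exact: eq_measure_integral.
exact: (@fubini_tonelli3 _ _ _ _ _ _ R lebesgue_measure lebesgue_measure
  lebesgue_measure (EFin \o H) mHE HE0).
Qed.

(** The factor [weight] is kept apart from [g] because the density absorbs it; what remains of the
    density is a product, so [g] can be integrated one coordinate at a time. *)
Lemma le_density_integral3 (m : {measure set R3 -> \bar R}) (f g : R3 -> R)
    (C : R) : 0 <= C ->
  (forall p, 0 <= f p) -> measurable_fun setT f ->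
  (forall p, 0 <= g p) -> measurable_fun setT g ->
  (forall D, measurable D -> (m D <= \int[lebesgue3]_(p in D) (f p)%:E)%E) ->
  (forall p, weight p.1.1 p.1.2 p.2 * f p <=
     C * (q p.1.1 * (q p.1.2 * q p.2))) ->
  (\int[m]_p (weight p.1.1 p.1.2 p.2 * g p)%:E <=
   C%:E * \int[lebesgue_measure]_a \int[lebesgue_measure]_b
     \int[lebesgue_measure]_c (q a * (q b * (q c * g ((a, b), c))))%:E)%E.
Proof.
move=> C0 f0 mf g0 mg mle decay.
have mp1 : measurable_fun [set: R3] (fun p => p.1.1 : R).
  exact: (measurableT_comp measurable_fst measurable_fst).
have mp2 : measurable_fun [set: R3] (fun p => p.1.2 : R).
  exact: (measurableT_comp measurable_snd measurable_fst).
have mp3 : measurable_fun [set: R3] (fun p => p.2 : R) by exact: measurable_snd.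
have mq (h : R3 -> R) : measurable_fun setT h ->
    measurable_fun setT (fun p => q (h p)).
  move=> mh; apply: measurable_funV; apply: measurable_funD => //.
  exact: measurable_funX.
have q0 s : 0 <= q s by rewrite invr_ge0 addr_ge0// sqr_ge0.
have W0 a b c : 0 <= weight a b c by rewrite exprn_ge0// !addr_ge0 ?sqr_ge0.
have G0 (p : R3) : 0 <= weight p.1.1 p.1.2 p.2 * g p by rewrite mulr_ge0.
apply: le_trans (le_density_integral f0 mf mle G0) _.
pose H (p : R3) : R := q p.1.1 * (q p.1.2 * (q p.2 * g p)).
have mH : measurable_fun setT H.
  by do 3![apply: measurable_funM; first exact: mq].
have H0 p : 0 <= H p by rewrite !mulr_ge0.
apply: (@le_trans _ _ (\int[lebesgue3]_p (C * H p)%:E)%E).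
  apply: ge0_le_integral_nomeas => p _; rewrite lee_fin; first by rewrite mulr_ge0.
  rewrite mulrAC (le_trans (ler_wpM2r (g0 _) (decay _)))//.
  by rewrite /H !mulrA.
rewrite ge0_integral_scale//; apply: lee_wpmul2l; first by rewrite lee_fin.
by rewrite (lebesgue3_fubini mH H0).
Qed.

Lemma integral_marginal_le n (X : T -> 'rV[R]_n) (U : 'M[R]_(3, n))
    (g : R -> R -> R -> R) : 0 <= K1 ->
  measurable_fun setT X -> bounded_marginals X -> U *m U^T = 1%:M ->
  measurable_fun setT (fun p : R3 => g p.1.1 p.1.2 p.2) ->
  (forall a b c, 0 <= g a b c) ->
  (\int[P]_w (weight (coord U 0 (X w)) (coord U 1 (X w)) (coord U 2%:R (X w)) *
     g (coord U 0 (X w)) (coord U 1 (X w)) (coord U 2%:R (X w)))%:E <=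
   (2 ^+ 9 * K1)%:E * \int[lebesgue_measure]_a \int[lebesgue_measure]_b
     \int[lebesgue_measure]_c (q a * (q b * (q c * g a b c)))%:E)%E.
Proof.
move=> K10 mX bX U1 mg g0.
have mXU : measurable_fun setT (coord3 U \o X).
  exact: (measurableT_comp (measurable_coord3 U) mX).
pose m : {measure set R3 -> \bar R} :=
  measure_function_pushforward__canonical__measure_function_Measure P mXU.
have mp1 : measurable_fun [set: R3] (fun p => p.1.1 : R).
  exact: (measurableT_comp measurable_fst measurable_fst).
have mp2 : measurable_fun [set: R3] (fun p => p.1.2 : R).
  exact: (measurableT_comp measurable_snd measurable_fst).
have mp3 : measurable_fun [set: R3] (fun p => p.2 : R) by exact: measurable_snd.
have W0 a b c : 0 <= weight a b c by rewrite exprn_ge0// !addr_ge0 ?sqr_ge0.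
pose G (p : R3) : R := weight p.1.1 p.1.2 p.2 * g p.1.1 p.1.2 p.2.
have G0 p : 0 <= G p by rewrite mulr_ge0.
have mG : measurable_fun setT G.
  apply: measurable_funM => //; apply: measurable_funX.
  apply: measurable_funD; last exact: measurable_funX.
  apply: measurable_funD; last exact: measurable_funX.
  by apply: measurable_funD => //; exact: measurable_funX.
rewrite [leLHS](_ : _ = \int[m]_p (G p)%:E)%E; last first.
  rewrite /m (ge0_integral_pushforward mXU)//; first exact/measurable_EFinP.
  by move=> p _; rewrite lee_fin.
apply: (le_density_integral3 (f := fun p => K1 / Num.max 1
    (Num.sqrt (p.1.1 ^+ 2 + p.1.2 ^+ 2 + p.2 ^+ 2) ^+ 2000))
    (g := fun p => g p.1.1 p.1.2 p.2)).
- exact: mulr_ge0 (exprn_ge0 _ (ler0n _ _)) K10.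
- move=> p; apply: divr_ge0 K10 _; rewrite le_max; apply/orP; left.
  exact: ler01.
- apply: measurable_funM; first exact: measurable_cst.
  apply: measurable_funV; apply: measurable_maxr; first exact: measurable_cst.
  apply: measurable_funX; apply: measurable_sqrt.
  apply: measurable_funD; last exact: measurable_funX.
  by apply: measurable_funD; exact: measurable_funX.
- by move=> p; exact: g0.
- exact: mg.
- by move=> D mD; exact: (marginal_law_le mX bX U1 mD).
- by move=> p; exact: (weighted_decay_le _ _ _ K10).
Qed.

End marginal_density.

(** * Expectations over a single row *)

Section row_estimates.
Context {R : realType}.
Notation mu := (@lebesgue_measure R).
Let q (s : R) : R := (1 + s ^+ 2)^-1.

Let q0 s : 0 <= q s.
Proof. by rewrite invr_ge0 addr_ge0// sqr_ge0. Qed.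

Let mq : measurable_fun setT q.
Proof. by apply: measurable_funV; apply: measurable_funD. Qed.

Lemma integral_qqq_le (h : R -> R) (M : R) : (forall c, 0 <= h c) ->
  measurable_fun setT h -> (\int[mu]_c (q c * h c)%:E <= M%:E)%E ->
  (\int[mu]_a \int[mu]_b \int[mu]_c (q a * (q b * (q c * h c)))%:E <=
    (16 * M)%:E)%E.
Proof.
move=> h0 mh hM.
have mqh : measurable_fun setT (fun c => q c * h c) by exact: measurable_funM.
have qh0 c : 0 <= q c * h c by rewrite mulr_ge0.
have inner a b : (\int[mu]_c (q a * (q b * (q c * h c)))%:E <= (q a * M * q b)%:E)%E.
  under eq_integral do rewrite mulrA.
  rewrite ge0_integral_scale ?mulr_ge0//.
  apply: le_trans (lee_wpmul2l _ hM) _; first by rewrite lee_fin mulr_ge0.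
  by rewrite -EFinM lee_fin mulrAC.
have M0 : 0 <= M.
  by rewrite -lee_fin (le_trans _ hM)// integral_ge0// => c _; rewrite lee_fin.
have middle a : (\int[mu]_b \int[mu]_c (q a * (q b * (q c * h c)))%:E <=
    (4 * M * q a)%:E)%E.
  apply: (@le_trans _ _ (\int[mu]_b (q a * M * q b)%:E)%E).
    apply: ge0_le_integral_nomeas => b _; last exact: inner.
    by apply: integral_ge0 => c _; rewrite lee_fin !mulr_ge0.
  rewrite ge0_integral_scale ?mulr_ge0//.
  apply: le_trans (lee_wpmul2l _ integral_cauchy1_le) _.
    by rewrite lee_fin mulr_ge0.
  by rewrite -EFinM lee_fin le_eqVlt; apply/orP; left; apply/eqP; ring.
apply: (@le_trans _ _ (\int[mu]_a (4 * M * q a)%:E)%E).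
  apply: ge0_le_integral_nomeas => a _; last exact: middle.
  by do 2!apply: integral_ge0 => ? _; rewrite lee_fin !mulr_ge0.
rewrite ge0_integral_scale ?mulr_ge0//.
apply: le_trans (lee_wpmul2l _ integral_cauchy1_le) _.
  by rewrite lee_fin mulr_ge0.
by rewrite -EFinM lee_fin le_eqVlt; apply/orP; left; apply/eqP; ring.
Qed.

Lemma weight_ge1 (a b c : R) : 1 <= weight a b c.
Proof. by rewrite exprn_ege1// -!addrA lerDl !addr_ge0 ?sqr_ge0. Qed.

Lemma sum_norm_le_weight (a b c : R) :
  1 + `|a| + `|b| + `|c| <= 3 * weight a b c.
Proof.
have N1 : 1 <= 1 + a ^+ 2 + b ^+ 2 + c ^+ 2.
  by rewrite -!addrA lerDl !addr_ge0 ?sqr_ge0.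
apply: (@le_trans _ _ (3 * (1 + a ^+ 2 + b ^+ 2 + c ^+ 2))).
  rewrite -(real_normK (num_real a)) -(real_normK (num_real b)).
  rewrite -(real_normK (num_real c)).
  by have := sqr_ge0 (`|a| - 1); have := sqr_ge0 (`|b| - 1);
     have := sqr_ge0 (`|c| - 1); nra.
by rewrite ler_pM2l//; apply: ler_eXnr.
Qed.

Context {d} {T : measurableType d} (P : probability T R) (K1 : R).
Context (n : nat) (X : T -> 'rV[R]_n) (U : 'M[R]_(3, n)).
Hypothesis K10 : 0 <= K1.
Hypothesis mX : measurable_fun setT X.
Hypothesis bX : bounded_marginals P K1 X.
Hypothesis U1 : U *m U^T = 1%:M.

Notation x0 := (fun w => coord U 0 (X w)).
Notation x1 := (fun w => coord U 1 (X w)).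
Notation x2 := (fun w => coord U 2%:R (X w)).
Let C0 : R := 2 ^+ 9 * K1.

Let C00 : 0 <= C0.
Proof. by rewrite mulr_ge0// exprn_ge0. Qed.

Let mx k : measurable_fun setT (fun w => coord U k (X w)).
Proof. exact: (measurableT_comp (measurable_coord U k) mX). Qed.

Notation R3 :=
  (measurableTypeR R * measurableTypeR R * measurableTypeR R)%type.

Let mp1 : measurable_fun [set: R3] (fun p => p.1.1 : R).
Proof. exact: (measurableT_comp measurable_fst measurable_fst). Qed.
Let mp2 : measurable_fun [set: R3] (fun p => p.1.2 : R).
Proof. exact: (measurableT_comp measurable_snd measurable_fst). Qed.
Let mp3 : measurable_fun [set: R3] (fun p => p.2 : R).
Proof. exact: measurable_snd. Qed.

(** The gain in the shift comes from the triangle inequality in the form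
    [1 + |a| <= (1 + |x|) (1 + |x + a|)] for sums of absolute values: the first factor is at most
    [3 * weight], the second is the numerator in [key_integral]. Hence [7800 = 3 * 2600]. *)
Lemma integral_row_key (b t a0 a1 a2 : R) : 0 < b -> 0 < t ->
  (\int[P]_w ((b ^+ 2 * ((x0 w + a0) ^+ 2 + (x1 w + a1) ^+ 2) +
      t ^+ 2 * (x2 w + a2) ^+ 2)^-1)%:E <=
   (7800 * C0 / (b * t * (1 + `|a0| + `|a1| + `|a2|)))%:E)%E.
Proof.
move=> b0 t0.
pose g (p0 p1 p2 : R) : R := (1 + `|p0 + a0| + `|p1 + a1| + `|p2 + a2|) /
      (b ^+ 2 * ((p0 + a0) ^+ 2 + (p1 + a1) ^+ 2) +
       t ^+ 2 * (p2 + a2) ^+ 2).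
have den0 (p0 p1 p2 : R) : 0 <= b ^+ 2 * ((p0 + a0) ^+ 2 + (p1 + a1) ^+ 2) +
       t ^+ 2 * (p2 + a2) ^+ 2.
  exact: addr_ge0 (mulr_ge0 (sqr_ge0 _) (addr_ge0 (sqr_ge0 _) (sqr_ge0 _)))
    (mulr_ge0 (sqr_ge0 _) (sqr_ge0 _)).
have g0 p0 p1 p2 : 0 <= g p0 p1 p2 by rewrite divr_ge0// !addr_ge0.
have mD (f : R3 -> R) (a : R) : measurable_fun setT f ->
    measurable_fun setT (fun p => f p + a) by move=> mf; exact: measurable_funD.
have mg : measurable_fun setT (fun p : R3 => g p.1.1 p.1.2 p.2).
  apply: measurable_funM.
    apply: measurable_funD; last by apply: measurableT_comp => //; exact: mD.
    apply: measurable_funD; last by apply: measurableT_comp => //; exact: mD.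
    apply: measurable_funD; first exact: measurable_cst.
    by apply: measurableT_comp => //; exact: mD.
  apply: measurable_funV; apply: measurable_funD.
    apply: measurable_funM; first exact: measurable_cst.
    by apply: measurable_funD; apply: measurable_funX; exact: mD.
  apply: measurable_funM; first exact: measurable_cst.
  by apply: measurable_funX; exact: mD.
have H := integral_marginal_le K10 mX bX U1 mg g0.
pose L : R := 1 + `|a0| + `|a1| + `|a2|.
have L0 : 0 < L by rewrite !ltr_pwDl.
apply: (@le_trans _ _ (\int[P]_w (3 / L *
    (weight (x0 w) (x1 w) (x2 w) * g (x0 w) (x1 w) (x2 w)))%:E)%E).
  apply: ge0_le_integral_nomeas => w _; first by rewrite lee_fin invr_ge0.
  rewrite lee_fin /g.
  move: (x0 w) (x1 w) (x2 w) (den0 (x0 w) (x1 w) (x2 w)) => u v z.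
  move: (_ + _ * (z + a2) ^+ 2) => D D0.
  rewrite mulrA mulrA ler_peMl ?invr_ge0// mulrAC -mulrA mulrCA -mulrA.
  have Wle := sum_norm_le_weight u v z.
  move: (weight u v z) Wle => W Wle.
  rewrite [leRHS](_ : _ = 3 * W * (1 + `|u + a0| + `|v + a1| + `|z + a2|) / L);
    last by field; rewrite gt_eqF.
  rewrite ler_pdivlMr// mul1r.
  apply: le_trans (ler_wpM2r _ Wle); last by rewrite !addr_ge0.
  have tr (x y : R) : `|x| <= `|y| + `|y + x|.
    by rewrite -{1}(addKr y x) (le_trans (ler_normD _ _))// normrN.
  have XY : 0 <= (`|u| + `|v| + `|z|) * (`|u + a0| + `|v + a1| + `|z + a2|).
    by rewrite mulr_ge0// !addr_ge0.
  have := tr a0 u; have := tr a1 v; have := tr a2 z; rewrite /L => h2 h1 h0.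
  rewrite [leRHS](_ : _ = 1 + (`|u| + `|v| + `|z|) +
    (`|u + a0| + `|v + a1| + `|z + a2|) + (`|u| + `|v| + `|z|) *
    (`|u + a0| + `|v + a1| + `|z + a2|)); last by ring.
  by move: XY; move: (_ * _) => XY XY0; lra.
have mG : measurable_fun setT (fun w =>
    weight (x0 w) (x1 w) (x2 w) * g (x0 w) (x1 w) (x2 w)).
  apply: measurable_funM.
    apply: measurable_funX; apply: measurable_funD; last exact: measurable_funX.
    apply: measurable_funD; last exact: measurable_funX.
    by apply: measurable_funD => //; exact: measurable_funX.
  exact: (measurableT_comp mg (measurableT_comp (measurable_coord3 U) mX)).
rewrite ge0_integral_scale//; first last.
- by move=> w; rewrite mulr_ge0// (le_trans ler01 (weight_ge1 _ _ _)).
- by rewrite divr_ge0// ltW.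
have H2 : (\int[P]_w (weight (x0 w) (x1 w) (x2 w) * g (x0 w) (x1 w) (x2 w))%:E <=
    C0%:E * (2600 / (b * t))%:E)%E.
  apply: le_trans H _; apply: lee_wpmul2l; first by rewrite lee_fin.
  exact: key_integral.
apply: le_trans (lee_wpmul2l _ H2) _; first by rewrite lee_fin divr_ge0// ltW.
rewrite -!EFinM lee_fin le_eqVlt; apply/orP; left; apply/eqP.
by rewrite -/L; field; rewrite !gt_eqF.
Qed.

(** Only the third coordinate, later the one along the normal, enters; the other two integrate to at
    most 4 each, so [64 = 4 * 4 * 4]. This serves indices without good pairs, and null
    hyperplanes. *)
Lemma integral_row_one (t a : R) : 0 < t ->
  (\int[P]_w ((1 + t ^+ 2 * (x2 w + a) ^+ 2)^-1)%:E <= (64 * C0 / t)%:E)%E.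
Proof.
move=> t0.
pose h (c : R) := (1 + t ^+ 2 * (c + a) ^+ 2)^-1.
have h0 c : 0 <= h c by rewrite invr_ge0 addr_ge0// mulr_ge0 ?sqr_ge0.
have mh : measurable_fun setT h.
  apply: measurable_funV; apply: measurable_funD => //.
  by apply: measurable_funM => //; apply: measurable_funX; exact: measurable_funD.
have mg : measurable_fun setT (fun p : R3 => h p.2) by exact: (measurableT_comp mh).
have H := integral_marginal_le (g := fun _ _ c => h c) K10 mX bX U1 mg (fun _ _ => h0).
apply: le_trans (le_trans _ H) _.
  apply: ge0_le_integral_nomeas => w _; first by rewrite lee_fin h0.
  by rewrite lee_fin; exact: ler_peMl (h0 (x2 w)) (weight_ge1 _ _ _).
apply: (@le_trans _ _ (C0%:E * (16 * (4 / t))%:E)%E); last first.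
  rewrite -EFinM lee_fin le_eqVlt; apply/orP; left; apply/eqP.
  by field; rewrite gt_eqF.
apply: lee_wpmul2l; first by rewrite lee_fin.
apply: integral_qqq_le => //.
have := @integral_cauchy_le R 1 t a ltr01 t0; rewrite mul1r; apply: le_trans.
apply: ge0_le_integral_nomeas => c _; rewrite lee_fin; first by rewrite mulr_ge0.
rewrite expr1n ler_piMl// /q invf_le1 ?ltr_pwDl ?sqr_ge0//.
by rewrite lerDl sqr_ge0.
Qed.

(** The integrand of [integral_row_one] equals 1 on the hyperplane for every t, while its integral
    is of order [1 / t]. *)
Lemma row_null_hyperplane (a : R) : P [set w | x2 w + a = 0] = 0%E.
Proof.
have mE : measurable [set w | x2 w + a = 0].
  have : measurable_fun setT (fun w => x2 w + a) by exact: measurable_funD.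
  by move=> /(_ measurableT _ (measurable_set1 0)); rewrite setTI.
have le t : 0 < t -> (P [set w | (x2 w + a)%R = 0%R] <= (64 * C0 / t)%:E)%E.
  move=> t0; apply: le_trans (integral_row_one a t0).
  rewrite -[X in P X]setIT -integral_indic//.
  apply: ge0_le_integral_nomeas => w _; rewrite lee_fin//.
  rewrite indicE; case: (boolP (w \in _)) => [/set_mem/= ->|_].
    by rewrite expr0n mulr0 addr0 invr1.
  by rewrite invr_ge0 addr_ge0// mulr_ge0 ?sqr_ge0.
apply/eqP; rewrite eq_le measure_ge0 andbT.
apply/lee_addgt0Pr => e e0; rewrite add0e.
(* The [+ 1] keeps this value of t positive even if [C0] is 0. *)
have t0 : 0 < (64 * C0 + 1) / e by rewrite divr_gt0// ltr_wpDl// mulr_ge0.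
apply: le_trans (le _ t0) _; rewrite lee_fin invf_div mulrA ler_pdivrMr.
  by rewrite mulrC ler_pM2l// lerDl.
by rewrite ltr_wpDl// mulr_ge0.
Qed.

Lemma integral_row_weight :
  (\int[P]_w (weight (x0 w) (x1 w) (x2 w))%:E <= (64 * C0)%:E)%E.
Proof.
have m1 : measurable_fun [set: R3] (fun=> 1 : R) by exact: measurable_cst.
have H := integral_marginal_le (g := fun _ _ _ => 1) K10 mX bX U1 m1
  (fun _ _ _ => ler01).
apply: le_trans (le_trans _ H) _.
  by apply: ge0_le_integral_nomeas => w _; rewrite lee_fin ?mulr1//
     (le_trans ler01 (weight_ge1 _ _ _)).
apply: (@le_trans _ _ (C0%:E * (16 * 4)%:E)%E); last first.
  by rewrite -EFinM lee_fin le_eqVlt; apply/orP; left; apply/eqP; ring.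
apply: lee_wpmul2l; first by rewrite lee_fin.
apply: integral_qqq_le => //.
by under eq_integral do rewrite mulr1; exact: integral_cauchy1_le.
Qed.

End row_estimates.

(** * Gram matrices, projections and orthonormal frames *)

Section linear_algebra.
Context {R : realType} {n : nat}.
Implicit Types (S : {set 'I_n}) (B : 'M[R]_n).

Definition dot (x y : 'rV[R]_n) : R := (x *m y^T) 0 0.

Lemma dotE x y : dot x y = \sum_k x 0 k * y 0 k.
Proof. by rewrite /dot mxE; apply: eq_bigr => k _; rewrite mxE. Qed.

Lemma dot_ge0 x : 0 <= dot x x.
Proof. by rewrite dotE sumr_ge0// => k _; rewrite -expr2 sqr_ge0. Qed.

Lemma dot_eq0 x : (dot x x == 0) = (x == 0).
Proof.
apply/eqP/eqP => [|->]; last by rewrite /dot mul0mx mxE.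
rewrite dotE => /eqP; rewrite psumr_eq0; last by move=> k _; rewrite -expr2 sqr_ge0.
move=> /allP h; apply/rowP => k; rewrite mxE; apply/eqP.
by have := h k (mem_index_enum _); rewrite /= -expr2 sqrf_eq0.
Qed.

Definition mask S B : 'M[R]_n := \matrix_(k, j) if k \in S then B k j else 0.

Definition coset_diag S : 'M[R]_n := \matrix_(k, l) ((k == l) && (k \notin S))%:R.

(* The Gram matrix of the rows in S, completed by an identity block so that it
   stays square of size n. *)
Definition gram S B : 'M[R]_n := mask S B *m (mask S B)^T + coset_diag S.

(* The inverse of B if B is invertible and 0 otherwise, whereas invmx B = B for
   singular B. *)
Definition adj_inv B : 'M[R]_n := (\det B)^-1 *: \adj B.

(* When the rows of B in S are free, the orthogonal projection onto the
   orthogonal complement of their span. *)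
Definition coproj S B : 'M[R]_n :=
  1%:M - (mask S B)^T *m adj_inv (gram S B) *m mask S B.

Lemma adj_invE B : B \in unitmx -> adj_inv B = invmx B.
Proof. by rewrite /adj_inv /invmx => ->. Qed.

Lemma mask_set_row S i x B : i \notin S -> mask S (set_row i x B) = mask S B.
Proof.
move=> iS; apply/matrixP => k j; rewrite !mxE; case: ifP => // kS.
by case: eqP => // ki; rewrite -ki kS in iS.
Qed.

(** This is what makes the weight of a row computable: resampling the row leaves the subspace onto
    which it is projected unchanged. *)
Lemma coproj_set_row S i x B : i \notin S ->
  coproj S (set_row i x B) = coproj S B.
Proof. by move=> iS; rewrite /coproj /gram mask_set_row. Qed.

Lemma gram_quad S B (c : 'rV[R]_n) :
  (c *m gram S B *m c^T) 0 0 =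
  dot (c *m mask S B) (c *m mask S B) + \sum_(k | k \notin S) c 0 k ^+ 2.
Proof.
rewrite /gram mulmxDr mulmxDl mxE; congr (_ + _).
  by rewrite /dot trmx_mul !mulmxA.
rewrite mxE [RHS]big_mkcond/=; apply: eq_bigr => k _.
rewrite mxE (bigD1 k)//= big1 ?addr0; last first.
  by move=> l lk; rewrite !mxE (negPf lk) mulr0.
by rewrite !mxE eqxx/=; case: (k \notin S); rewrite ?mulr1 ?mulr0 ?mul0r ?expr2.
Qed.

(** A relation between the rows in [S], extended by 0, lies in the kernel of the Gram matrix.
    Conversely, on a kernel vector the quadratic form is a vanishing sum of squares: the coordinates
    outside [S] vanish, and the rest is a relation. *)
Lemma det_gram_neq0P S B :
  reflect (forall c : 'rV[R]_n, c *m mask S B = 0 -> forall k, k \in S -> c 0 k = 0)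
    (\det (gram S B) != 0).
Proof.
apply: (iffP idP) => [dG c cW k kS|free].
  pose c' : 'rV[R]_n := \row_k if k \in S then c 0 k else 0.
  have c'W : c' *m mask S B = 0.
    rewrite -cW; apply/rowP => j; rewrite !mxE; apply: eq_bigr => m _.
    by rewrite !mxE; case: ifP => // _; rewrite !mulr0.
  have : c' == 0.
    apply/negPn/negP => c'0; move: dG; apply/negP; rewrite negbK; apply/det0P.
    exists c' => //; rewrite /gram mulmxDr mulmxA c'W mul0mx add0r.
    apply/rowP => j; rewrite !mxE big1// => m _; rewrite !mxE.
    by case: ifP => mS; rewrite ?mul0r// andbF mulr0.
  by move=> /eqP/rowP/(_ k); rewrite !mxE kS.
apply/negP => /det0P[c c0 cG].
have := gram_quad S B c; rewrite cG mul0mx mxE => /esym/eqP.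
rewrite paddr_eq0 ?dot_ge0//; last by rewrite sumr_ge0// => k _; exact: sqr_ge0.
rewrite dot_eq0 psumr_eq0; last by move=> k _; exact: sqr_ge0.
move=> /andP[/eqP /free cS /allP cNS]; move/negP: c0; apply.
apply/eqP/rowP => k; rewrite mxE; have [/cS//|kNS] := boolP (k \in S).
by have := cNS k (mem_index_enum _); rewrite kNS/= sqrf_eq0 => /eqP.
Qed.

Lemma unit_gram S B : B \in unitmx -> \det (gram S B) != 0.
Proof.
move=> uB; apply/det_gram_neq0P => c cW k kS.
pose c' : 'rV[R]_n := \row_k if k \in S then c 0 k else 0.
have c'B : c' *m B = 0.
  rewrite -cW; apply/rowP => j; rewrite !mxE; apply: eq_bigr => m _.
  by rewrite !mxE; case: ifP => // _; rewrite ?mul0r ?mulr0.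
have c'0 : c' = 0 by rewrite -(mulmxK uB c') c'B mul0mx.
by have /rowP/(_ k) := c'0; rewrite !mxE kS.
Qed.

Lemma gram_setT B : \det (gram [set: 'I_n] B) = \det B ^+ 2.
Proof.
have -> : gram [set: 'I_n] B = B *m B^T.
  rewrite /gram (_ : mask [set: 'I_n] B = B); last by apply/matrixP => k j; rewrite !mxE inE.
  rewrite (_ : coset_diag [set: 'I_n] = 0) ?addr0//.
  by apply/matrixP => k j; rewrite !mxE inE andbF.
by rewrite det_mulmx det_tr expr2.
Qed.

(** Counting dimensions by determinants: the vectors to be avoided are stored in the rows of a
    square matrix, and a row left at zero makes it singular. *)
Lemma exists_unit_orth (N : 'M[R]_n) j : row j N = 0 ->
  exists x : 'rV[R]_n, dot x x = 1 /\ x *m N^T = 0.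
Proof.
move=> Nj.
have /det0P[x x0 xN] : \det N^T == 0.
  rewrite det_tr; apply/det0P; exists (delta_mx 0 j); last by rewrite -rowE.
  by apply/eqP => /rowP/(_ j); rewrite !mxE !eqxx/=; apply/eqP; rewrite oner_eq0.
have d0 : 0 < dot x x by rewrite lt_def dot_ge0 dot_eq0 x0.
exists ((Num.sqrt (dot x x))^-1 *: x); split; last by rewrite -scalemxAl xN scaler0.
have e (a b : R) (v : 'M[R]_1) : (a *: (b *: v)) 0 0 = a * (b * v 0 0).
  by rewrite !mxE.
rewrite /dot linearZ/= -scalemxAl -scalemxAr e -/(dot x x).
by rewrite mulrA -invfM -expr2 sqr_sqrtr ?dot_ge0// mulVf// gt_eqF.
Qed.

Definition frame3 (x y z : 'rV[R]_n) : 'M[R]_(3, n) :=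
  \matrix_(k, j) [:: x 0 j; y 0 j; z 0 j]`_k.

Lemma row_frame3 x y z (k : 'I_3) : row k (frame3 x y z) = [:: x; y; z]`_k.
Proof.
apply/rowP => j; rewrite !mxE.
by case: k => [[|[|[|//]]] h] /=; rewrite ?mxE.
Qed.

Lemma mulmx_frame3_tr m (X : 'M[R]_(m, n)) x y z (k : 'I_m) (l : 'I_3) :
  (X *m (frame3 x y z)^T) k l = dot (row k X) ([:: x; y; z]`_l).
Proof.
rewrite -(row_frame3 x y z) dotE mxE; apply: eq_bigr => j _; rewrite !mxE//.
Qed.

Lemma dotC x y : dot x y = dot y x.
Proof. by rewrite !dotE; apply: eq_bigr => k _; rewrite mulrC. Qed.

(** The Gram-Schmidt process, started at nu, completes the rows outside [i, j, l]. Both [U^T *m U]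
    and [coproj] fix the frame and vanish on those rows, which together span the whole space. *)
Lemma coproj_frame B (i j l : 'I_n) (nu : 'rV[R]_n) : B \in unitmx ->
  i != j -> i != l -> j != l -> dot nu nu = 1 ->
  (forall k, k != i -> dot (row k B) nu = 0) ->
  exists U : 'M[R]_(3, n),
    [/\ U *m U^T = 1%:M, row 2%:R U = nu,
        U^T *m U = coproj (~: [set i; j; l]) B &
        forall k, k != i -> k != j -> k != l -> row k B *m U^T = 0].
Proof.
move=> uB ij il jl nunu Bnu.
set S := ~: [set i; j; l]; pose W := mask S B.
have rW k : row k W = if k \in S then row k B else 0.
  by apply/rowP => m; rewrite !mxE; case: ifP; rewrite !mxE.
have iS : i \notin S by rewrite !inE eqxx.
have jS : j \notin S by rewrite !inE eqxx orbT.
have lS : l \notin S by rewrite !inE eqxx !orbT.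
(* The three rows masked in [W] are slots for the vectors found so far; an empty slot is the zero
   row that [exists_unit_orth] requires. *)
pose N (a b c : 'rV[R]_n) := set_row i a (set_row j b (set_row l c W)).
have rN a b c k : row k (N a b c) = if k == i then a else if k == j then b
    else if k == l then c else row k W by rewrite !row_set_row.
have NW a b c x : x *m (N a b c)^T = 0 -> forall k, k \in S -> dot (row k B) x = 0.
  move=> h k kS; have /rowP/(_ k) := h; rewrite mxE [RHS]mxE => <-.
  have -> : row k B = row k (N a b c).
    rewrite rN rW kS; case: eqP => [ki|_]; first by rewrite -ki kS in iS.
    case: eqP => [ki|_]; first by rewrite -ki kS in jS.
    by case: eqP => [ki|_] //; rewrite -ki kS in lS.
  by rewrite dotE; apply: eq_bigr => m _; rewrite !mxE mulrC.
have Nk a b c x : x *m (N a b c)^T = 0 -> forall k, dot (row k (N a b c)) x = 0.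
  move=> h k; have /rowP/(_ k) := h; rewrite mxE [RHS]mxE => <-.
  by rewrite dotE; apply: eq_bigr => m _; rewrite !mxE mulrC.
have [y [yy yN]] : exists x, dot x x = 1 /\ x *m (N nu 0 0)^T = 0.
  by apply: (@exists_unit_orth _ j); rewrite rN eq_sym (negPf ij) eqxx.
have [x [xx xN]] : exists x, dot x x = 1 /\ x *m (N nu y 0)^T = 0.
  apply: (@exists_unit_orth _ l); rewrite rN eq_sym (negPf il).
  by rewrite eq_sym (negPf jl) eqxx.
have ynu : dot nu y = 0 by have := Nk _ _ _ _ yN i; rewrite rN eqxx.
have xnu : dot nu x = 0 by have := Nk _ _ _ _ xN i; rewrite rN eqxx.
have xy : dot y x = 0.
  by have := Nk _ _ _ _ xN j; rewrite rN eq_sym (negPf ij) eqxx.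
pose U := frame3 x y nu.
have UU : U *m U^T = 1%:M.
  apply/matrixP => k m; rewrite mulmx_frame3_tr row_frame3 mxE.
  case: k => [[|[|[|//]]] ?]; case: m => [[|[|[|//]]] ?] //=;
    by rewrite ?xx ?yy ?nunu ?xy ?xnu ?ynu// dotC ?xy ?xnu ?ynu.
have WU : W *m U^T = 0.
  apply/matrixP => k m; rewrite mulmx_frame3_tr rW mxE.
  case: ifP => kS; last by rewrite /dot mul0mx mxE.
  case: m => [[|[|[|//]]] ?] /=; rewrite ?(NW _ _ _ _ yN)// ?(NW _ _ _ _ xN)//.
  by apply: Bnu; apply: contraNneq iS => <-.
pose N3 := N nu y x.
(* Column m of [E] marks the slot, among [l, j, i], that holds row m of [U]. *)
pose E : 'M[R]_(n, 3) := \matrix_(k, m) (k == nth k [:: l; j; i] m)%:R.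
have N3E : N3 = W + E *m U.
  apply/matrixP => k m; rewrite !mxE 3!big_ord_recl big_ord0 addr0 !mxE/=.
  case: (eqVneq k i) => [->|ki].
    by rewrite (negPf iS) (negPf ij) (negPf il) !mul0r !add0r mul1r.
  case: (eqVneq k j) => [->|kj].
    by rewrite (negPf jS) (negPf jl) !mul0r !add0r addr0 mul1r.
  case: (eqVneq k l) => [->|kl].
    by rewrite (negPf lS) !mul0r !add0r !addr0 mul1r.
  by rewrite !mul0r !addr0.
have uN3 : N3 \in unitmx.
  rewrite unitmxE unitfE; apply/negP => /det0P[c c0 cN].
  have cE : c *m E = 0.
    have := congr1 (mulmx^~ U^T) cN; rewrite N3E mulmxDr mulmxDl mul0mx.
    by rewrite -!mulmxA WU UU mulmx1 mulmx0 add0r.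
  have cW : c *m W = 0 by move: cN; rewrite N3E mulmxDr mulmxA cE mul0mx addr0.
  have cEk (m : 'I_3) : c 0 (nth i [:: l; j; i] m) = 0.
    have /rowP/(_ m) := cE; rewrite mxE [RHS]mxE => <-.
    rewrite (bigD1 (nth i [:: l; j; i] m))//= big1 ?addr0 => [|k km]; rewrite mxE.
      by case: m => [[|[|[|//]]] ?] /=; rewrite eqxx mulr1.
    suff /negPf -> : k != nth k [:: l; j; i] m by rewrite mulr0.
    by move: km; case: m => [[|[|[|//]]] ?].
  move/negP: c0; apply; apply/eqP/rowP => k; rewrite [RHS]mxE.
  have [kS|] := boolP (k \in S).
    by have /det_gram_neq0P := unit_gram S uB; apply; rewrite ?cW.
  rewrite !inE negbK => /orP[/orP[]|] /eqP ->.
  - exact: (cEk 2%:R).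
  - exact: (cEk 1).
  - exact: (cEk 0).
have UW : U *m W^T = 0 by rewrite -[U]trmxK -trmx_mul WU trmx0.
(* The difference of both sides is orthogonal to every row of the invertible matrix [N3]. *)
have complete (X : 'M[R]_n) : X *m W^T = 0 -> X *m U^T *m U = X.
  move=> XW; apply/esym/eqP; rewrite -subr_eq0; apply/eqP.
  have uT : N3^T \in unitmx by rewrite unitmx_tr.
  rewrite -[LHS](mulmxK uT) (_ : _ *m N3^T = 0) ?mul0mx//.
  rewrite N3E linearD/= trmx_mul mulmxDr !mulmxBl !mulmxA XW.
  by rewrite -!mulmxA UW !mulmx0 (mulmxA U) UU mul1mx !subrr addr0.
exists U; split => //.
- by rewrite row_frame3.
- pose G := gram S B; have uG : G \in unitmx by rewrite unitmxE unitfE unit_gram.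
  (* The identity block completing the Gram matrix is harmless: [W^T] annihilates it and [invmx G]
     fixes it. *)
  have WE : W^T *m coset_diag S = 0.
    apply/matrixP => k m; rewrite !mxE big1// => p _; rewrite !mxE.
    by case: ifP => pS; rewrite ?mul0r// andbF mulr0.
  have GE : invmx G *m coset_diag S = coset_diag S.
    have EE : coset_diag S *m coset_diag S = coset_diag S.
      apply/matrixP => k m; rewrite !mxE (bigD1 k)//= big1 ?addr0 => [|p pk].
        by rewrite !mxE eqxx; case: (k \in S); rewrite ?mul0r ?mul1r ?andbF.
      by rewrite !mxE eq_sym (negPf pk) mul0r.
    have : G *m coset_diag S = coset_diag S.
      by rewrite /G /gram mulmxDl -mulmxA WE mulmx0 add0r EE.
    by move=> {1}<-; rewrite mulKmx.
  have QW : coproj S B *m W^T = 0.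
    rewrite /coproj -/W adj_invE// mulmxBl mul1mx -!mulmxA.
    have -> : W *m W^T = G - coset_diag S by rewrite /G /gram addrK.
    by rewrite mulmxBr mulVmx// GE mulmxBr mulmx1 WE subr0 subrr.
  have QU : coproj S B *m U^T = U^T.
    by rewrite /coproj -/W mulmxBl mul1mx -!mulmxA WU !mulmx0 subr0.
  by rewrite -(complete _ QW) QU.
- move=> k ki kj kl; have := congr1 (row k) WU; rewrite row_mul rW row0.
  by rewrite !inE (negPf ki) (negPf kj) (negPf kl).
Qed.

End linear_algebra.

Lemma sum_ord3 (R : nmodType) (F : 'I_3 -> R) :
  \sum_k F k = F 0 + F 1 + F 2%:R.
Proof.
rewrite 3!big_ord_recl big_ord0 addr0 addrA.
by congr (F _ + F _ + F _); apply: val_inj.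
Qed.

(** * Columns of the inverse matrix *)

Section inverse_columns.
Context {R : realType} {n : nat}.
Implicit Types (B : 'M[R]_n) (nu : 'rV[R]_n).

Lemma coord_dot k (U : 'M[R]_(k, n)) i (x : 'rV[R]_n) :
  coord U i x = dot x (row i U).
Proof. by rewrite /coord dotE mxE; apply: eq_bigr => j _; rewrite !mxE. Qed.

Lemma coordD k (U : 'M[R]_(k, n)) i (x y : 'rV[R]_n) :
  coord U i (x + y) = coord U i x + coord U i y.
Proof. by rewrite /coord mulmxDl mxE. Qed.

Lemma coord_row k (U : 'M[R]_(k, n)) i j :
  coord U i (row j U) = (U *m U^T) j i.
Proof. by rewrite /coord -row_mul mxE. Qed.

Lemma norm_frame k (U : 'M[R]_(k, n)) (x : 'rV[R]_n) : U *m U^T = 1%:M ->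
  dot (x *m (U^T *m U)) (x *m (U^T *m U)) = \sum_i coord U i x ^+ 2.
Proof.
move=> U1; rewrite /coord mulmxA; move: (x *m U^T) => c.
rewrite /dot trmx_mul -mulmxA (mulmxA U) U1 mul1mx mxE.
by apply: eq_bigr => i _; rewrite mxE expr2.
Qed.

Definition col_sqnorm (B : 'M[R]_n) (i : 'I_n) : R := \sum_k B k i ^+ 2.

Lemma hs_norm_sq (B : 'M[R]_n) : hs_norm B ^+ 2 = \sum_i col_sqnorm B i.
Proof.
rewrite /hs_norm sqr_sqrtr; first exact: exchange_big.
by rewrite sumr_ge0// => i _; rewrite sumr_ge0// => j _; exact: sqr_ge0.
Qed.

Lemma exists_unit_normal B i : B \in unitmx ->
  exists nu, dot nu nu = 1 /\ forall k, k != i -> dot (row k B) nu = 0.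
Proof.
move=> uB; have [nu [nn h]] : exists x, dot x x = 1 /\ x *m (set_row i 0 B)^T = 0.
  by apply: (@exists_unit_orth _ _ _ i); rewrite row_set_row eqxx.
exists nu; split => // k ki; have /rowP/(_ k) := h; rewrite mxE [RHS]mxE => <-.
by rewrite dotE; apply: eq_bigr => m _; rewrite !mxE (negPf ki) mulrC.
Qed.

Section fixed_row.
Variables (B : 'M[R]_n) (i : 'I_n) (nu : 'rV[R]_n).
Hypothesis uB : B \in unitmx.
Hypothesis nunu : dot nu nu = 1.
Hypothesis Bnu : forall k, k != i -> dot (row k B) nu = 0.
Let u : R := dot (row i B) nu.
Let C := invmx B.
Let kappa : 'rV[R]_n := nu *m C.
Definition ratio (k : 'I_n) : R := u * kappa 0 k.

Let Bnu_delta : B *m nu^T = u *: delta_mx i 0.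
Proof.
apply/matrixP => k l; rewrite !ord1 [RHS]mxE [delta_mx _ _ _ _]mxE eqxx andbT.
rewrite -[LHS]/((B *m nu^T) k 0).
have -> : (B *m nu^T) k 0 = dot (row k B) nu.
  by rewrite dotE mxE; apply: eq_bigr => m _; rewrite !mxE.
by case: eqVneq => [->|/Bnu ->]; rewrite ?mulr1 ?mulr0.
Qed.

Let nu_col : nu^T = u *: col i C.
Proof. by rewrite -(mulKmx uB nu^T) Bnu_delta -scalemxAr -colE. Qed.

Lemma row_normal_neq0 : u != 0.
Proof.
apply/eqP => u0; have : nu = 0 by rewrite -[nu]trmxK nu_col u0 scale0r trmx0.
by move=> nu0; move: nunu; rewrite nu0 /dot mul0mx mxE => /eqP; rewrite eq_sym oner_eq0.
Qed.

Let C_col k : C k i = nu 0 k / u.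
Proof.
have /matrixP/(_ k 0) := nu_col; rewrite !mxE => ->.
by rewrite mulrAC mulfV ?mul1r// row_normal_neq0.
Qed.

Lemma col_sqnorm_inv : col_sqnorm C i = (u ^+ 2)^-1.
Proof.
rewrite /col_sqnorm; under eq_bigr do rewrite C_col exprMn exprVn.
rewrite -mulr_suml; suff -> : \sum_k nu 0 k ^+ 2 = 1 by rewrite mul1r.
by rewrite -nunu dotE; apply: eq_bigr => k _; rewrite expr2.
Qed.

Lemma ratio_self : ratio i = 1.
Proof.
rewrite /ratio /kappa mxE; under eq_bigr do rewrite C_col mulrA.
by rewrite -mulr_suml -dotE nunu mul1r mulfV// row_normal_neq0.
Qed.

(** Bessel's inequality for each column of the inverse: [kappa 0 l] is its component along the unit
    vector nu, and the expanded square is that of the residual. *)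
Lemma hs_norm_inv_ge : \sum_k ratio k ^+ 2 <= u ^+ 2 * hs_norm C ^+ 2.
Proof.
rewrite hs_norm_sq mulr_sumr; apply: ler_sum => l _.
rewrite /ratio exprMn ler_wpM2l ?sqr_ge0//.
have : 0 <= \sum_k (C k l - kappa 0 l * nu 0 k) ^+ 2.
  by rewrite sumr_ge0// => k _; exact: sqr_ge0.
rewrite (eq_bigr (fun k => C k l ^+ 2 - 2 * kappa 0 l * (nu 0 k * C k l) +
    kappa 0 l ^+ 2 * (nu 0 k * nu 0 k))); last by move=> k _; ring.
rewrite big_split/= sumrB -!mulr_sumr -dotE nunu.
have -> : \sum_k nu 0 k * C k l = kappa 0 l by rewrite /kappa mxE.
by rewrite /col_sqnorm; lra.
Qed.

(* nu is the combination of the rows of B with coefficients kappa; pairing it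
   with directions orthogonal to nu and to all but three rows leaves a linear
   relation between the coordinates of these three rows. *)
Lemma row_coord_le (j l : 'I_n) (U : 'M[R]_(3, n)) : i != j -> i != l -> j != l ->
  U *m U^T = 1%:M -> row 2%:R U = nu ->
  (forall k, k != i -> k != j -> k != l -> row k B *m U^T = 0) ->
  coord U 0 (row i B) ^+ 2 + coord U 1 (row i B) ^+ 2 <=
  (ratio j ^+ 2 + ratio l ^+ 2) *
    (\sum_k coord U k (row j B) ^+ 2 + \sum_k coord U k (row l B) ^+ 2).
Proof.
move=> ij il jl U1 U2 BU.
have nuE : nu = kappa *m B by rewrite /kappa mulmxKV.
have rel (m : 'I_3) : m != 2%:R -> coord U m (row i B) =
    - (ratio j * coord U m (row j B) + ratio l * coord U m (row l B)).
  move=> m2.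
  have cnu : coord U m nu = 0 by rewrite -U2 coord_row U1 mxE eq_sym (negPf m2).
  have : coord U m nu = \sum_k kappa 0 k * coord U m (row k B).
    rewrite {1}nuE /coord -mulmxA mxE; apply: eq_bigr => k _.
    by congr (_ * _); rewrite -row_mul [RHS]mxE.
  rewrite cnu (bigD1 i)//= (bigD1 j) 1?eq_sym//=.
  rewrite (bigD1 l)/= ?(eq_sym l) ?il ?jl// big1 ?addr0; last first.
    move=> k /andP[/andP[ki kj] kl]; by rewrite /coord BU ?mxE ?mulr0.
  move=> /(congr1 (fun x => u * x)); rewrite mulr0 !mulrDr !mulrA -!/(ratio _).
  by rewrite ratio_self mul1r => /esym/eqP; rewrite addr_eq0 => /eqP.
have sq (a b x y : R) : (a * x + b * y) ^+ 2 <= (a ^+ 2 + b ^+ 2) * (x ^+ 2 + y ^+ 2).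
  by have := sqr_ge0 (a * y - b * x); nra.
rewrite !rel// !sqrrN (le_trans (lerD (sq _ _ _ _) (sq _ _ _ _)))//.
rewrite -mulrDr ler_wpM2l ?addr_ge0 ?sqr_ge0//.
by rewrite !sum_ord3 addrACA lerD// lerDl sqr_ge0.
Qed.

(** Column i of the inverse is [nu / u], so the share is the inverse of the square of
    [u * hs_norm C]. On the event this square dominates both terms of the denominator, hence half
    their sum. *)
Lemma column_share_le (t : R) : 0 < t ->
  col_sqnorm C i / hs_norm C ^+ 2 * (t <= hs_norm C)%R%:R <=
  2 / (\sum_k ratio k ^+ 2 + t ^+ 2 * u ^+ 2).
Proof.
move=> t0; have u0 := row_normal_neq0.
have u2 : 0 < u ^+ 2 by rewrite lt_def sqrf_eq0 u0 sqr_ge0.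
have D0 : 0 < \sum_k ratio k ^+ 2 + t ^+ 2 * u ^+ 2.
  have S0 : 0 <= \sum_k ratio k ^+ 2 by apply: sumr_ge0 => k _; exact: sqr_ge0.
  exact: ltr_wpDl S0 (mulr_gt0 (exprn_gt0 _ t0) u2).
case: (lerP t (hs_norm C)) => tH; last by rewrite mulr0 divr_ge0// ltW.
rewrite mulr1 col_sqnorm_inv -invfM.
have H0 : 0 < hs_norm C by exact: lt_le_trans tH.
have uH0 : 0 < u ^+ 2 * hs_norm C ^+ 2 by exact: mulr_gt0 u2 (exprn_gt0 _ H0).
rewrite ler_pdivlMr// mulrC ler_pdivrMr//.
rewrite mulr_natl mulr2n lerD ?hs_norm_inv_ge//.
rewrite mulrC ler_wpM2l ?sqr_ge0// lerXn2r ?nnegrE// ltW//.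
Qed.
End fixed_row.
End inverse_columns.

(** * The h-index of the good pairs *)

Section h_index.
Variable n : nat.
Variable g : 'I_n -> 'I_n -> 'I_n -> bool.
Hypothesis g_triple : forall i j l, i != j -> i != l -> j != l ->
  [|| g i j l, g j i l | g l i j].

Definition out_degree (i j : 'I_n) : nat := #|[set l | g i j l]%SET|.

Definition h_property (i : 'I_n) (h : nat) : bool :=
  (h <= #|[set j | (h <= out_degree i j)%N]%SET|)%N.

Definition h_index (i : 'I_n) : nat :=
  \max_(h < n.+1 | h_property i h) h.

Lemma h_property_le i h : h_property i h -> (h <= n)%N.
Proof. by move=> /leq_trans; apply; rewrite -[X in (_ <= X)%N]card_ord max_card. Qed.

Lemma h_index_property i : h_property i (h_index i).
Proof.
have P0 : h_property i (@ord0 n) by [].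
rewrite /h_index (@bigop.bigmax_eq_arg _ ord0 (fun h : 'I_n.+1 => h_property i h)
  (fun h : 'I_n.+1 => h : nat) P0).
by case: arg_maxnP.
Qed.

Lemma h_property_index i h : h_property i h -> (h <= h_index i)%N.
Proof.
move=> Ph; have hn : (h < n.+1)%N by rewrite ltnS (h_property_le Ph).
exact: (@leq_bigmax_cond _ (fun h : 'I_n.+1 => h_property i h)
  (fun h : 'I_n.+1 => h : nat) (Ordinal hn) Ph).
Qed.

(* Among the k indices in question every triple is good in some orientation, which
   gives about k^3 / 3 good triples, whereas each index carries at most 2 k m. *)
Lemma card_small_h_index m : (0 < m)%N ->
  (#|[set i | (h_index i < m)%N]%SET| <= 9 * m)%N.
Proof.
move=> m0; set I := [set i | _]%SET; set k := #|I|.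
have sumI (F : 'I_n -> nat) c : (forall i, i \in I -> F i <= c)%N ->
    (\sum_(i in I) F i <= k * c)%N.
  by move=> h; rewrite -sum_nat_const leq_sum.
have few i : i \in I -> (#|[set j | (m <= out_degree i j)%N]%SET| <= m)%N.
  rewrite inE => him; rewrite leqNgt; apply/negP => /ltnW Pm.
  by have := leq_trans him (h_property_index Pm); rewrite ltnn.
pose N := (\sum_(i in I) \sum_(j in I) \sum_(l in I) g i j l)%N.
(* For each i at most m indices j have degree at least m, and each of them contributes at most k;
   every other j contributes less than m. *)
have upper : (N <= k * (k * m + k * m))%N.
  apply: (@sumI _ _) => i iI.
  apply: (@leq_trans
    (\sum_(j in I) (k * (m <= out_degree i j)%N + m))%N).
    apply: leq_sum => j _; case: (leqP m (out_degree i j)) => mj.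
      rewrite muln1 (leq_trans _ (leq_addr _ _))// -[X in (_ <= X)%N]muln1.
      by apply: (@sumI _ _) => l _; exact: leq_b1.
    rewrite muln0 add0n (leq_trans _ (ltnW mj))// /out_degree -sum1dep_card.
    rewrite big_mkcond [X in (_ <= X)%N]big_mkcond/=; apply: leq_sum => l _.
    by case: (l \in I); case: (g i j l).
  rewrite big_split/= sum_nat_const leq_add2r -big_distrr/= leq_mul2l.
  apply/orP; right; apply: leq_trans (few _ iI).
  rewrite -sum1dep_card big_mkcond [X in (_ <= X)%N]big_mkcond/=.
  by apply: leq_sum => j _; case: (j \in I); case: (m <= _)%N.
(* The three orientations of a triple contribute [3 * N]; triples with a coincidence, to which
   [g_triple] does not apply, are covered by the other term. *)
have lower : (k * (k * k) <= 3 * N + 3 * (k * k))%N.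
  have one (i : 'I_n) : i \in I -> (\sum_(j in I) (i == j) = 1)%N.
    move=> iI; rewrite (bigD1 i)//= eqxx big1 ?addn0// => j /andP[_].
    by rewrite eq_sym => /negPf ->.
  have N2 : (\sum_(i in I) \sum_(j in I) \sum_(l in I) g j i l = N)%N.
    by rewrite exchange_big.
  have N3 : (\sum_(i in I) \sum_(j in I) \sum_(l in I) g l i j = N)%N.
    under eq_bigr do rewrite exchange_big/=.
    by rewrite exchange_big.
  have D1 : (\sum_(i in I) \sum_(j in I) \sum_(l in I) (i == j) = k * k)%N.
    rewrite -sum_nat_const; apply: eq_bigr => i iI.
    under eq_bigr do rewrite sum_nat_const.
    by rewrite -big_distrr/= one// muln1.
  have D2 : (\sum_(i in I) \sum_(j in I) \sum_(l in I) (i == l) = k * k)%N.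
    rewrite -sum_nat_const; apply: eq_bigr => i iI.
    by under eq_bigr do rewrite one//; rewrite sum_nat_const muln1.
  have D3 : (\sum_(i in I) \sum_(j in I) \sum_(l in I) (j == l) = k * k)%N.
    rewrite -sum_nat_const; apply: eq_bigr => i iI.
    by rewrite (eq_bigr (fun=> 1%N)) ?sum_nat_const ?muln1.
  have : (\sum_(i in I) \sum_(j in I) \sum_(l in I) 1 <=
    \sum_(i in I) \sum_(j in I) \sum_(l in I)
      (g i j l + g j i l + g l i j + (i == j) + (i == l) + (j == l)))%N.
    apply: leq_sum => i _; apply: leq_sum => j _; apply: leq_sum => l _.
    case: eqVneq => [_|ij]; first by rewrite !addn1 addSn.
    case: eqVneq => [_|il]; first by rewrite addn1.
    case: eqVneq => [_|jl]; first by rewrite addn1.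
    by have /or3P[] := g_triple ij il jl => ->; rewrite ?addn1 ?addnS.
  under eq_bigr do under eq_bigr do rewrite sum_nat_const muln1.
  under eq_bigr do rewrite sum_nat_const.
  rewrite sum_nat_const => /leq_trans; apply.
  under eq_bigr do under eq_bigr do rewrite !big_split/=.
  under eq_bigr do rewrite !big_split/=.
  by rewrite !big_split/= N2 N3 D1 D2 D3 -/N; lia.
have [k0|k0] := posnP k; first by rewrite k0.
(* Cancelling [k * k] leaves [k <= 6 * m + 3], which is at most [9 * m] as m is positive. *)
have : (k * (k * k) <= k * (k * (6 * m + 3)))%N by nia.
by rewrite !leq_pmul2l//; lia.
Qed.

End h_index.

Lemma exists_subset_card (T : finType) (A : {set T}) h : (h <= #|A|)%N ->
  exists B : {set T}, B \subset A /\ #|B| = h.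
Proof.
move=> hA; exists [set x in take h (enum A)]%SET; split.
  by apply/fintype.subsetP => x; rewrite inE => /mem_take; rewrite mem_enum.
rewrite cardsE (card_uniqP _) ?take_uniq ?enum_uniq//.
by rewrite size_take -cardE; case: ltngtP hA => // ->.
Qed.

(** Exactly h vertices j of large degree are kept, with exactly h edges each. The in-degrees are
    then bounded as well, because only h vertices emit edges. *)
Lemma exists_regular_edges n (g : 'I_n -> 'I_n -> 'I_n -> bool) (i : 'I_n) :
  let h := h_index g i in
  exists e : 'I_n -> 'I_n -> bool,
    [/\ forall j l, e j l -> g i j l,
        (\sum_j \sum_l e j l = h * h)%N,
        forall j, (\sum_l e j l <= h)%N &
        forall l, (\sum_j e j l <= h)%N].
Proof.
move=> h; have [J [JA Jh]] := exists_subset_card (h_index_property g i).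
have sub j : j \in J -> exists N : {set 'I_n},
    N \subset [set l | g i j l]%SET /\ #|N| = h.
  move=> jJ; apply: exists_subset_card.
  by have /fintype.subsetP/(_ j jJ) := JA; rewrite inE.
have [N HN] : exists N : 'I_n -> {set 'I_n}, forall j, j \in J ->
    N j \subset [set l | g i j l]%SET /\ #|N j| = h.
  exists (fun j => if pselect (j \in J) is left jJ then projT1 (cid (sub j jJ))
    else finset.set0) => j jJ.
  by case: pselect => // jJ'; exact: (projT2 (cid (sub j jJ'))).
have sumN j : j \in J -> (\sum_l (l \in N j) = h)%N.
  move=> /HN[_ <-]; rewrite -sum1_card [in RHS]big_mkcond/=.
  by apply: eq_bigr => l _; case: (l \in N j).
have sumJ : (\sum_j (j \in J) = h)%N.
  rewrite [RHS](esym Jh) -sum1_card [in RHS]big_mkcond/=.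
  by apply: eq_bigr => l _; case: (l \in J).
exists (fun j l => (j \in J) && (l \in N j)); split.
- by move=> j l /andP[/HN[/fintype.subsetP NA _] /NA]; rewrite inE.
- rewrite -[in RHS]sumJ big_distrl/=; apply: eq_bigr => j _.
  have [jJ|_] := boolP (j \in J); first by rewrite mul1n sumN.
  by rewrite mul0n big1.
- move=> j; have [jJ|_] := boolP (j \in J); first by rewrite sumN.
  by rewrite big1.
- move=> l; rewrite -[X in (_ <= X)%N]sumJ; apply: leq_sum => j _.
  by case: (j \in J); case: (l \in N j).
Qed.

(** * Fourth roots and the sum of inverse three-quarter powers *)

Section fourth_root.
Context {R : realType}.

(** The exponents of n and h in the estimates are multiples of 1/4, so they become integral powers
    of this quantity, within reach of [ring] and [field]. *)
Definition root4 (n : nat) : R := Num.sqrt (Num.sqrt n%:R).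

Lemma root4_ge0 n : 0 <= root4 n.
Proof. exact: sqrtr_ge0. Qed.

Lemma root4_sq n : root4 n ^+ 2 = Num.sqrt n%:R.
Proof. by rewrite sqr_sqrtr ?sqrtr_ge0. Qed.

Lemma root4_pow4 n : root4 n ^+ 4 = n%:R.
Proof. by rewrite (_ : 4 = 2 * 2)%N// exprM root4_sq sqr_sqrtr. Qed.

Lemma root4_ge1 n : (0 < n)%N -> 1 <= root4 n.
Proof.
move=> n0; rewrite -[X in X <= _]sqrtr1 -[X in Num.sqrt X]sqrtr1.
by rewrite !ler_sqrt ?ler1n// sqrtr_ge0.
Qed.

Lemma root4_le m n : (m <= n)%N -> root4 m <= root4 n.
Proof. by move=> mn; rewrite !ler_wsqrtr// ler_nat. Qed.

Lemma root4S_le n : (0 < n)%N -> root4 n.+1 <= 2 * root4 n.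
Proof.
move=> n0; have p1 := root4_ge1 n0.
have : root4 n.+1 ^+ 4 <= (2 * root4 n) ^+ 4.
  rewrite exprMn !root4_pow4 -natrX -natrM ler_nat.
  by rewrite (leq_trans (_ : _ <= 2 * n)%N) ?leq_mul// mul2n -addnn -addn1 leq_add2l.
by rewrite ler_pXn2r ?nnegrE ?mulr_ge0 ?root4_ge0.
Qed.

(** Discrete form of the fact that [x^(-3/4)] has antiderivative [4 x^(1/4)]: a difference of fourth
    powers equal to 1 is factored. *)
Lemma inv_root4_cube_le m : (root4 m.+1 ^+ 3)^-1 <= 4 * (root4 m.+1 - root4 m).
Proof.
have p1 : 0 < root4 m.+1 by apply: lt_le_trans (root4_ge1 _).
have qp : root4 m <= root4 m.+1 by exact: root4_le.
have q0 := root4_ge0 m.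
rewrite invf_ple ?posrE ?exprn_gt0//; last first.
  rewrite mulr_gt0// subr_gt0 lt_neqAle qp andbT; apply/eqP => e.
  by have := root4_pow4 m.+1; rewrite -e root4_pow4 => /eqP; rewrite eqr_nat; lia.
have e : root4 m.+1 ^+ 4 - root4 m ^+ 4 = 1 by rewrite !root4_pow4 -natrB// subSnn.
set p := root4 m.+1 in p1 qp e *; set q := root4 m in q0 qp e *.
have d0 : 0 < 4 * (p - q).
  rewrite mulr_gt0// subr_gt0 lt_neqAle qp andbT; apply/eqP => h.
  by move: e; rewrite h subrr => /eqP; rewrite eq_sym oner_eq0.
rewrite -div1r ler_pdivrMr// -[X in X <= _]e.
have -> : p ^+ 4 - q ^+ 4 = (p - q) * (p ^+ 3 + p ^+ 2 * q + p * q ^+ 2 + q ^+ 3) by ring.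
rewrite (_ : p ^+ 3 * _ = (p - q) * (4 * p ^+ 3)); last by ring.
rewrite ler_wpM2l ?subr_ge0//.
have h2 : q ^+ 2 <= p ^+ 2 by rewrite lerXn2r ?nnegrE// ltW.
have h3 : q ^+ 3 <= p ^+ 3 by rewrite lerXn2r ?nnegrE// ltW.
have h4 : p ^+ 2 * q <= p ^+ 3 by rewrite [leRHS]exprSr ler_wpM2l// sqr_ge0.
have h5 : p * q ^+ 2 <= p ^+ 3 by rewrite [leRHS]exprS ler_wpM2l// ltW.
by lra.
Qed.

(** Summation by parts: the worst case has nine indices at each value, so the sum is at most 9 times
    a sum of inverse cubes, and [36 = 9 * 4]. *)
Lemma sum_inv_root4_cube_le n (f : 'I_n -> nat) :
  (forall m, #|[set i | (f i <= m)%N]%SET| <= 9 * m)%N ->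
  forall m, \sum_(i | (f i <= m)%N) (root4 (f i) ^+ 3)^-1 <= 36 * root4 m.
Proof.
move=> cf m; pose phi m : R := (root4 m ^+ 3)^-1.
have phi0 k : 0 <= phi k by rewrite invr_ge0 exprn_ge0// root4_ge0.
pose N m : nat := #|[set i | (f i <= m)%N]%SET|.
have N0 : N 0%N = 0%N by have := cf 0%N; rewrite -/(N 0%N); lia.
have NS k : (N k.+1 = N k + #|[set i | f i == k.+1]%SET|)%N.
  rewrite /N -!sum1dep_card (bigID (fun i => (f i <= k)%N))/=.
  congr (_ + _)%N; apply: eq_bigl => i; first by apply/andP/idP; lia.
  by apply/andP/eqP; lia.
suff : \sum_(i | (f i <= m)%N) phi (f i) + ((9 * m)%:R - (N m)%:R) * phi m <= 36 * root4 m.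
  apply: le_trans; rewrite lerDl mulr_ge0// subr_ge0 ler_nat; exact: cf.
elim: m => [|m IH].
  rewrite N0 subrr mul0r addr0 big_pred0 ?mulr_ge0 ?root4_ge0// => i.
  apply/negbTE/negP => i0.
  suff : (0 < N 0)%N by rewrite N0.
  by rewrite card_gt0; apply/set0Pn; exists i; rewrite inE.
have split_sum : \sum_(i | (f i <= m.+1)%N) phi (f i) =
    \sum_(i | (f i <= m)%N) phi (f i) + #|[set i | f i == m.+1]%SET|%:R * phi m.+1.
  rewrite (bigID (fun i => (f i <= m)%N))/=; congr (_ + _).
    by apply: eq_bigl => i; apply/andP/idP; lia.
  rewrite mulr_natl -sumr_const; rewrite (eq_bigl (fun i => i \in [set i | f i == m.+1]%SET)).
    by apply: eq_bigr => i; rewrite inE => /eqP ->.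
  by move=> i; rewrite inE; apply/andP/eqP; lia.
have mono : ((9 * m)%:R - (N m)%:R) * phi m.+1 <= ((9 * m)%:R - (N m)%:R) * phi m.
  case: (posnP m) => [->|m0]; first by rewrite N0 subrr !mul0r.
  rewrite ler_wpM2l ?subr_ge0 ?ler_nat//; first exact: cf.
  have r0 k : (0 < k)%N -> 0 < root4 k by move=> k0; apply: lt_le_trans (root4_ge1 k0).
  rewrite lef_pV2 ?posrE ?exprn_gt0 ?r0//.
  by rewrite lerXn2r ?nnegrE ?root4_ge0 ?root4_le.
have step := inv_root4_cube_le m; rewrite -/(phi m.+1) in step.
rewrite split_sum NS mulnS (natrD _ 9) (natrD _ (N m)).
move: IH mono step.
move: (\sum_(i | _) _) => S; move: (root4 m) (root4 m.+1) (phi m) (phi m.+1) => a b c d.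
move: (9 * m)%:R (N m)%:R (#|_|%:R) => x y z; lra.
Qed.
End fourth_root.

(** Jensen's inequality for [1 / x], obtained by summing the tangent line inequality at [Y]. *)
Lemma inv_avg_le {R : realFieldType} (I : finType) (e : I -> R) (X : I -> R) (N Y : R) :
  0 < N -> 0 < Y -> (forall i, 0 <= e i) -> (forall i, 0 < X i) ->
  \sum_i e i = N -> \sum_i e i * X i <= N * Y ->
  Y^-1 <= N^-1 * \sum_i e i / X i.
Proof.
move=> N0 Y0 e0 X0 eN eX.
rewrite ler_pdivlMl//.
have tangent i : 2 * Y^-1 * e i - Y ^- 2 * (e i * X i) <= e i / X i.
  rewrite (_ : _ - _ = e i * (2 * Y^-1 - Y ^- 2 * X i)); last by ring.
  rewrite ler_wpM2l// -subr_ge0.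
  have -> : (X i)^-1 - (2 * Y^-1 - Y ^- 2 * X i) = (X i)^-1 * (1 - X i / Y) ^+ 2.
    by field; rewrite !gt_eqF.
  by rewrite mulr_ge0 ?sqr_ge0// invr_ge0 ltW.
apply: le_trans (ler_sum _ (fun i _ => tangent i)).
rewrite sumrB -!mulr_sumr eN.
have : Y ^- 2 * (\sum_i e i * X i) <= Y ^- 2 * (N * Y).
  by rewrite ler_wpM2l// invr_ge0 sqr_ge0.
have -> : Y ^- 2 * (N * Y) = N * Y^-1 by field; rewrite gt_eqF.
lra.
Qed.

(** * Null sets, and frames with a prescribed third vector *)

Section null_and_frames.
Context {R : realType}.

Lemma ge0_ae_le_integral {d} {T : measurableType d} (P : {measure set T -> \bar R})
    (N : set T) (f g : T -> \bar R) : measurable N -> P N = 0%E ->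
  measurable_fun setT f -> (forall w, 0 <= f w)%E -> (forall w, 0 <= g w)%E ->
  (forall w, ~ N w -> f w <= g w)%E -> (\int[P]_w f w <= \int[P]_w g w)%E.
Proof.
move=> mN PN mf f0 g0 fg.
rewrite (@ge0_negligible_integral _ _ _ P setT N f)// integral_mkcond.
apply: ge0_le_integral_nomeas => w _; rewrite patchE; case: ifPn => //.
by rewrite inE => -[_]; exact: fg.
Qed.

Lemma exists_frame n (v : 'rV[R]_n) : (3 <= n)%N -> dot v v = 1 ->
  exists U : 'M[R]_(3, n), U *m U^T = 1%:M /\ row 2%:R U = v.
Proof.
move=> n3 v1; have n0 : (0 < n)%N by exact: leq_trans n3.
have n1 : (1 < n)%N by exact: leq_trans n3.
have n2 : (2 < n)%N by [].
pose o0 := Ordinal n0; pose o1 := Ordinal n1; pose o2 := Ordinal n2.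
have [x [x1 xv]] : exists x, dot x x = 1 /\ x *m (set_row o0 v 0)^T = 0.
  apply: (@exists_unit_orth _ _ _ o1); rewrite row_set_row/=.
  by apply/rowP => k; rewrite !mxE.
have [y [y1 yvx]] : exists y, dot y y = 1 /\
    y *m (set_row o1 x (set_row o0 v 0))^T = 0.
  apply: (@exists_unit_orth _ _ _ o2); rewrite !row_set_row/=.
  by apply/rowP => k; rewrite !mxE.
have dot_row (z : 'rV[R]_n) (B : 'M[R]_n) k : z *m B^T = 0 -> dot z (row k B) = 0.
  move=> /rowP/(_ k); rewrite [RHS]mxE mxE => <-; rewrite dotE.
  by apply: eq_bigr => j _; rewrite !mxE.
have xv0 : dot x v = 0 by have := dot_row _ _ o0 xv; rewrite row_set_row.
have yx0 : dot y x = 0 by have := dot_row _ _ o1 yvx; rewrite row_set_row.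
have yv0 : dot y v = 0 by have := dot_row _ _ o0 yvx; rewrite !row_set_row.
exists (frame3 y x v); split; last by rewrite row_frame3.
apply/matrixP => k l; rewrite mulmx_frame3_tr row_frame3 mxE.
case: k => [[|[|[|//]]] hk]; case: l => [[|[|[|//]]] hl] //=;
  by rewrite ?(dotC x y) ?(dotC v x) ?(dotC v y).
Qed.

End null_and_frames.

(** * Almost sure independence of the rows *)

Section random_matrix.
Context {R : realType} {d} {T : measurableType d} (P : probability T R) (K1 : R).
Context (n : nat) (A : T -> 'M[R]_n) (M : 'M[R]_n).
Hypothesis K10 : 0 <= K1.
Hypothesis n3 : (3 <= n)%N.
Hypothesis mA : measurable_fun setT A.
Hypothesis indA : independent_rows P A.
Hypothesis bA : forall i, bounded_marginals P K1 (fun w => row i (A w)).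

Let mrow i : measurable_fun setT (fun w => row i (A w)).
Proof. exact: (measurableT_comp (measurable_row i) mA). Qed.

Lemma set_row_add i x (Y : 'M[R]_n) :
  set_row i x Y + M = set_row i (x + row i M) (Y + M).
Proof. by apply/matrixP => k j; rewrite !mxE; case: eqP => // ->. Qed.

Lemma measurable_gram_det S :
  measurable_fun setT (fun Y : 'M[R]_n => \det (gram S (Y + M))).
Proof.
have mY : forall i j, measurable_fun setT (fun Y : 'M[R]_n => (Y + M) i j).
  apply: measurable_addmx => i j; last exact: measurable_cst.
  exact: measurable_mx_entry.
have mm : forall i j, measurable_fun setT (fun Y : 'M[R]_n => mask S (Y + M) i j).
  by move=> i j; under eq_fun do rewrite mxE; case: (i \in S);
    [exact: mY|exact: measurable_cst].
apply: measurable_det => i j; apply: measurable_addmx => [k l|k l].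
  by apply: measurable_mulmx => // a b; exact: measurable_trmx.
exact: measurable_cst.
Qed.

Let null_gram S := [set Y : 'M[R]_n | \det (gram S (Y + M)) = 0].

Let measurable_null_gram S : measurable (null_gram S).
Proof.
rewrite /null_gram; have := measurable_gram_det S measurableT (measurable_set1 0).
by rewrite setTI.
Qed.

Let null_gram_event S : P (A @^-1` null_gram S) =
  (\int[P]_w (\1_(null_gram S) (A w))%:E)%E.
Proof.
rewrite (_ : (fun w => _) = (fun w => (\1_(A @^-1` null_gram S) w)%:E)).
  rewrite integral_indic ?setIT//; have := mA measurableT (measurable_null_gram S).
  by rewrite setTI.
by apply/funext => w; rewrite !indicE.
Qed.

(** Induction on the size of [S]: once the rows in [S'] are free, the resampled row k can create a
    dependence only if it is orthogonal to a fixed unit vector v orthogonal to those rows, and this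
    is a null hyperplane. *)
Lemma gram_neq0_ae S : P (A @^-1` null_gram S) = 0%E.
Proof.
have [s] := ubnP #|S|; elim: s S => // s IH S; rewrite ltnS => Ss.
have [->|[k kS]] := finset.set_0Vmem S.
  rewrite (_ : A @^-1` _ = set0) ?measure0//; apply/seteqP; split => // w /= /eqP.
  by apply/negP/det_gram_neq0P => c _ k; rewrite inE.
pose S' := (S :\ k)%SET.
have S's : (#|S'| < s)%N by rewrite (leq_trans _ Ss)// [leqRHS](cardsD1 k) kS.
have kS' : k \notin S' by rewrite !inE eqxx.
have P0 := IH _ S's.
have mphi : measurable_fun setT (fun Y => (\1_(null_gram S) Y)%:E : \bar R).
  by apply/measurable_EFinP; exact: measurable_indic.
have phi0 Y : (0 <= (\1_(null_gram S) Y)%:E :> \bar R)%E by rewrite lee_fin.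
rewrite null_gram_event (integral_resample mA indA k mphi phi0).
apply/eqP; rewrite eq_le integral_ge0 ?andbT; last first.
  by move=> w _; apply: integral_ge0.
rewrite -(integral0 P setT); apply: (@ge0_ae_le_integral _ _ _ P (A @^-1` null_gram S')) => //.
- by have := mA measurableT (measurable_null_gram S'); rewrite setTI.
- exact: (@measurable_integral_resample _ _ _ P _ _ A mA k
    (fun Y => (\1_(null_gram S) Y)%:E) mphi phi0).
- by move=> w; exact: integral_ge0.
move=> w /= /eqP dS'; set B := A w + M in dS' *.
have [v [v1 vB]] : exists v, dot v v = 1 /\ v *m (mask S' B)^T = 0.
  apply: (@exists_unit_orth _ _ _ k); apply/rowP => j.
  by rewrite !mxE (negPf kS').
have [U [U1 U2]] := exists_frame n3 v1.
have <- := row_null_hyperplane K10 (mrow k) (bA k) U1 (coord U 2%:R (row k M)).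
rewrite -[X in P X]setIT -integral_indic//; last first.
  have : measurable_fun setT (fun w => coord U 2%:R (row k (A w)) + coord U 2%:R (row k M)).
    apply: measurable_funD => //.
    exact: (measurableT_comp (measurable_coord _ _)).
  by move=> /(_ measurableT _ (measurable_set1 0)); rewrite setTI.
apply: ge0_le_integral_nomeas => w' _; rewrite lee_fin// !indicE.
case: (boolP (_ \in null_gram S)) => //; rewrite inE/= /null_gram/= set_row_add -/B => h.
rewrite mem_set//= -coordD coord_dot U2.
apply/eqP/negPn/negP => xv; move: h; apply/eqP.
apply/det_gram_neq0P => c cB.
(* Pairing the relation with v isolates its coefficient at k; the rest is a relation between the
   free rows of [S']. *)
have ck : c 0 k = 0.
  have vW : mask S (set_row k (row k (A w') + row k M) B) *m v^T =
      dot (row k (A w') + row k M) v *: delta_mx k 0.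
    apply/colP => m; rewrite [RHS]mxE [delta_mx _ _ _ _]mxE eqxx andbT.
    case: eqVneq => [->|mk].
      rewrite mulr1 dotE mxE; apply: eq_bigr => j _.
      by rewrite !mxE kS eqxx.
    have /rowP/(_ m) := vB; rewrite mulr0 [RHS]mxE => <-; rewrite !mxE.
    by apply: eq_bigr => j _; rewrite !mxE !inE mk (negPf mk) mulrC.
  have : c *m mask S (set_row k (row k (A w') + row k M) B) *m v^T = 0.
    by rewrite cB mul0mx.
  rewrite -mulmxA vW -scalemxAr -colE => /rowP/(_ 0); rewrite !mxE => /eqP.
  by rewrite mulf_eq0 (negPf xv) => /eqP.
move: dS' => /det_gram_neq0P free l lS; case: (eqVneq l k) => [->//|lk].
apply: free; last by rewrite !inE lk.
rewrite -[RHS]cB; apply/rowP => j; rewrite !mxE; apply: eq_bigr => m _.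
rewrite !mxE !inE; case: eqP => [->|//]; rewrite ck !mul0r//.
Qed.
End random_matrix.

(** * Shares of the columns in the indicator of the event *)

Section share.
Context {R : realType} {n : nat}.
Implicit Types (B : 'M[R]_n).

(* The contribution of column i to the indicator of the event t <= hs_norm B^-1;
   the contributions add up to that indicator. *)
Definition share (t : R) (i : 'I_n) B : R :=
  col_sqnorm (adj_inv B) i / hs_norm (adj_inv B) ^+ 2 *
  (t <= hs_norm (adj_inv B))%R%:R.

Lemma col_sqnorm_ge0 B i : 0 <= col_sqnorm B i.
Proof. by apply: sumr_ge0 => k _; exact: sqr_ge0. Qed.

Lemma share_ge0 t i B : 0 <= share t i B.
Proof. by rewrite !mulr_ge0 ?col_sqnorm_ge0// invr_ge0 sqr_ge0. Qed.

Lemma sum_share t B : 0 < t ->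
  \sum_i share t i B = (t <= hs_norm (adj_inv B))%R%:R.
Proof.
move=> t0; rewrite /share -!mulr_suml -hs_norm_sq.
case: lerP => [tH|_]; last by rewrite mulr0.
by rewrite divff ?mulr1// expf_neq0// gt_eqF// (lt_le_trans t0).
Qed.

Lemma share_singular t i B : 0 < t -> B \notin unitmx -> share t i B = 0.
Proof.
move=> t0; rewrite unitmxE unitfE negbK => /eqP B0.
rewrite /share /adj_inv B0 invr0 scale0r.
by rewrite /col_sqnorm big1 ?mul0r// => k _; rewrite mxE expr0n.
Qed.

(** All [ratio] but that of i itself, which is 1, are dropped. This is the bound for an index
    without usable pairs. *)
Lemma share_le_one t i B (nu y : 'rV[R]_n) (U : 'M[R]_(3, n)) : 0 < t ->
  dot nu nu = 1 -> (forall k, k != i -> dot (row k B) nu = 0) ->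
  row 2%:R U = nu ->
  share t i (set_row i y B) <= 2 * (1 + t ^+ 2 * coord U 2%:R y ^+ 2)^-1.
Proof.
move=> t0 nunu Bnu U2; set B' := set_row i y B.
have d0 : 0 < 1 + t ^+ 2 * coord U 2%:R y ^+ 2.
  by rewrite ltr_pwDl// mulr_ge0 ?sqr_ge0.
have [uB|nB] := boolP (B' \in unitmx); last first.
  by rewrite share_singular// mulr_ge0// invr_ge0 ltW.
have B'nu k : k != i -> dot (row k B') nu = 0.
  by move=> ki; rewrite row_set_row (negPf ki) Bnu.
rewrite /share adj_invE//.
apply: (le_trans (column_share_le uB nunu B'nu t0)).
rewrite row_set_row eqxx coord_dot U2 ler_wpM2l//.
rewrite coord_dot U2 in d0.
have r1 : 1 <= \sum_k ratio B' i nu k ^+ 2.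
  rewrite (bigD1 i)//= ratio_self// expr1n lerDl.
  by apply: sumr_ge0 => k _; exact: sqr_ge0.
by rewrite lef_pV2 ?posrE ?lerD2r// (lt_le_trans d0)// lerD2r.
Qed.

(** Here r is the fourth root of h, so on an edge [row_coord_le] bounds the bracket by [h / 4] times
    the squared ratios of j and l, plus the term in t. Summed over the [h * h] edges, each index
    occurs at most h times as j and h times as l; the mean is below the denominator of
    [column_share_le], and [inv_avg_le] applies. *)
Lemma share_le_edges t i B (nu y : 'rV[R]_n) (r : R) (h : nat)
    (e : 'I_n -> 'I_n -> bool) (U : 'I_n -> 'I_n -> 'M[R]_(3, n))
    (L : 'I_n -> 'I_n -> R) : 0 < t -> 0 < r -> r ^+ 4 = h%:R ->
  dot nu nu = 1 -> (forall k, k != i -> dot (row k B) nu = 0) ->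
  (forall j l, U j l *m (U j l)^T = 1%:M) ->
  (forall j l, row 2%:R (U j l) = nu) ->
  (forall j l, e j l -> [&& i != j, i != l & j != l]) ->
  (forall j l, e j l -> forall k, k != i -> k != j -> k != l ->
     row k B *m (U j l)^T = 0) ->
  (\sum_j \sum_l e j l = h * h)%N ->
  (forall j, \sum_l e j l <= h)%N -> (forall l, \sum_j e j l <= h)%N ->
  (forall j l, 0 < L j l) ->
  (forall j l, e j l -> \sum_k coord (U j l) k (row j B) ^+ 2 +
     \sum_k coord (U j l) k (row l B) ^+ 2 <= L j l ^+ 2) ->
  share t i (set_row i y B) <= 2 * (r ^+ 8)^-1 *
    \sum_j \sum_l (e j l)%:R *
      ((r ^+ 2 / (2 * L j l)) ^+ 2 *
         (coord (U j l) 0 y ^+ 2 + coord (U j l) 1 y ^+ 2) +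
       t ^+ 2 * coord (U j l) 2%:R y ^+ 2)^-1.
Proof.
move=> t0 r0 rh nunu Bnu U1 U2 ed eU eh degl degr L0 LB; set B' := set_row i y B.
have r8 : r ^+ 8 = h%:R * h%:R by rewrite (_ : 8 = 4 + 4)%N// exprD rh.
have [uB|nB] := boolP (B' \in unitmx); last first.
  rewrite share_singular// mulr_ge0//.
    by rewrite mulr_ge0// invr_ge0 exprn_ge0// ltW.
  apply: sumr_ge0 => j _; apply: sumr_ge0 => l _; rewrite mulr_ge0// invr_ge0.
  by rewrite addr_ge0// mulr_ge0 ?addr_ge0 ?sqr_ge0.
have B'nu k : k != i -> dot (row k B') nu = 0.
  by move=> ki; rewrite row_set_row (negPf ki) Bnu.
have u0 := row_normal_neq0 uB nunu B'nu.
pose rho k := ratio B' i nu k ^+ 2; pose D := t ^+ 2 * dot y nu ^+ 2.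
have rho0 k : 0 <= rho k by exact: sqr_ge0.
have D0 : 0 < D.
  apply: mulr_gt0; first exact: exprn_gt0.
  rewrite lt_def sqr_ge0 andbT sqrf_eq0.
  by move: u0; rewrite row_set_row eqxx.
have UD j l : t ^+ 2 * coord (U j l) 2%:R y ^+ 2 = D by rewrite coord_dot U2.
have Y0 : 0 < \sum_k rho k + D by rewrite ltr_wpDl// sumr_ge0.
rewrite /share adj_invE//.
apply: (le_trans (column_share_le uB nunu B'nu t0)).
rewrite row_set_row eqxx -/D -mulrA ler_wpM2l//.
rewrite (pair_bigA _ (fun j l => (e j l)%:R * ((r ^+ 2 / (2 * L j l)) ^+ 2 *
         (coord (U j l) 0 y ^+ 2 + coord (U j l) 1 y ^+ 2) +
       t ^+ 2 * coord (U j l) 2%:R y ^+ 2)^-1))/=.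
apply: (@inv_avg_le _ _ (fun p => (e p.1 p.2)%:R)
  (fun p => (r ^+ 2 / (2 * L p.1 p.2)) ^+ 2 *
         (coord (U p.1 p.2) 0 y ^+ 2 + coord (U p.1 p.2) 1 y ^+ 2) +
       t ^+ 2 * coord (U p.1 p.2) 2%:R y ^+ 2)) => //.
- exact: exprn_gt0.
- by move=> p; rewrite UD ltr_wpDl// mulr_ge0 ?addr_ge0 ?sqr_ge0.
- rewrite -(pair_bigA _ (fun j l => (e j l)%:R))/= r8 -natrM -eh natr_sum.
  by apply: eq_bigr => j _; rewrite natr_sum.
have edge j l : (e j l)%:R * ((r ^+ 2 / (2 * L j l)) ^+ 2 *
         (coord (U j l) 0 y ^+ 2 + coord (U j l) 1 y ^+ 2) +
       t ^+ 2 * coord (U j l) 2%:R y ^+ 2) <=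
    r ^+ 4 / 4 * ((e j l)%:R * rho j) + r ^+ 4 / 4 * ((e j l)%:R * rho l) +
    (e j l)%:R * D.
  case: (boolP (e j l)) => [ejl|_]; last by rewrite !mul0r !mulr0 !addr0.
  rewrite !mul1r UD lerD2r -mulrDr.
  have /and3P[ij il jl] := ed _ _ ejl.
  have B'U k : k != i -> k != j -> k != l -> row k B' *m (U j l)^T = 0.
    by move=> ki kj kl; rewrite row_set_row (negPf ki) eU.
  have := row_coord_le uB nunu B'nu ij il jl (U1 j l) (U2 j l) B'U.
  rewrite !row_set_row eqxx (eq_sym j) (eq_sym l) (negPf ij) (negPf il) => c.
  have L2 : 0 < L j l ^+ 2 by exact: exprn_gt0.
  apply: (@le_trans _ _ ((r ^+ 2 / (2 * L j l)) ^+ 2 *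
      ((rho j + rho l) * L j l ^+ 2))).
    rewrite ler_wpM2l ?sqr_ge0// (le_trans c)// ler_wpM2l ?LB//.
    exact: addr_ge0 (rho0 _) (rho0 _).
  by rewrite le_eqVlt; apply/orP; left; apply/eqP; field; rewrite gt_eqF.
rewrite -(pair_bigA _ (fun j l => (e j l)%:R * ((r ^+ 2 / (2 * L j l)) ^+ 2 *
         (coord (U j l) 0 y ^+ 2 + coord (U j l) 1 y ^+ 2) +
       t ^+ 2 * coord (U j l) 2%:R y ^+ 2)))/=.
apply: le_trans (ler_sum _ (fun j _ => ler_sum _ (fun l _ => edge j l))) _.
rewrite -[X in _ <= _ * (X + _)]/(\sum_k rho k).
under [leLHS]eq_bigr do rewrite !big_split/= -!mulr_sumr -!mulr_suml.
rewrite !big_split/= -!mulr_sumr.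
have s1 : \sum_j (\sum_l (e j l)%:R) * rho j <= h%:R * \sum_k rho k.
  rewrite mulr_sumr; apply: ler_sum => j _; rewrite ler_wpM2r//.
  by rewrite -natr_sum ler_nat.
have s2 : \sum_j \sum_l (e j l)%:R * rho l <= h%:R * \sum_k rho k.
  rewrite exchange_big mulr_sumr; apply: ler_sum => l _/=.
  by rewrite -mulr_suml ler_wpM2r// -natr_sum ler_nat.
have s3 : \sum_j (\sum_l (e j l)%:R) * D = h%:R * h%:R * D.
  rewrite -mulr_suml -natrM -eh natr_sum; congr (_ * _).
  by apply: eq_bigr => j _; rewrite natr_sum.
rewrite s3 r8 rh.
have h0 : 0 <= h%:R / 4 :> R by rewrite divr_ge0.
have S0 : 0 <= \sum_k rho k by exact: sumr_ge0.
apply: (@le_trans _ _ (h%:R / 4 * (h%:R * \sum_k rho k) +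
    h%:R / 4 * (h%:R * \sum_k rho k) + h%:R * h%:R * D)).
  by rewrite !lerD// ler_wpM2l.
have hS : 0 <= (h%:R : R) * (h%:R * \sum_k rho k) by rewrite !mulr_ge0.
by move: hS; move: (\sum_k rho k) (h%:R) => S H; lra.
Qed.

End share.

Lemma integral_sum_le {R : realType} {d} {T : measurableType d}
    (P : {measure set T -> \bar R}) (I : finType) (a c : I -> R) (f : I -> T -> R) :
  (forall i, 0 <= a i) -> (forall i w, 0 <= f i w) ->
  (forall i, measurable_fun setT (f i)) ->
  (forall i, \int[P]_w (f i w)%:E <= (c i)%:E)%E ->
  (\int[P]_w (\sum_i a i * f i w)%:E <= (\sum_i a i * c i)%:E)%E.
Proof.
move=> a0 f0 mf fc; under eq_integral do rewrite -sumEFin.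
rewrite ge0_integral_sum//; last 2 first.
- by move=> i; apply/measurable_EFinP; apply: measurable_funM.
- by move=> i w _; rewrite lee_fin mulr_ge0.
rewrite -sumEFin; apply: lee_sum => i _.
by rewrite ge0_integral_scale// EFinM; apply: lee_wpmul2l; rewrite ?lee_fin.
Qed.

(** The power 10 of s matches the factor [r ^+ 10] in the averaged bound, and the twelfth moment
    then costs [p ^+ 12 / p ^+ 10], that is sqrt n, in the sum over all triples. *)
Lemma le_truncation {R : realFieldType} (s w : R) : 0 < s -> 1 <= w ->
  w <= s + w ^+ 12 / s ^+ 10.
Proof.
move=> s0 w1; have w0 : 0 < w by exact: lt_le_trans w1.
have [ws|sw] := lerP w s.
  by rewrite (le_trans ws)// lerDl divr_ge0 ?exprn_ge0// ltW.
apply: (@le_trans _ _ (w ^+ 12 / s ^+ 10)); last by rewrite lerDr ltW.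
rewrite ler_pdivlMr ?exprn_gt0//.
rewrite (_ : w ^+ 12 = w * (w * w ^+ 10)); last by ring.
rewrite ler_wpM2l ?(ltW w0)//; apply: (@le_trans _ _ (w ^+ 10)).
  by rewrite lerXn2r ?nnegrE ?ltW.
by rewrite ler_peMl// exprn_ge0// ltW.
Qed.

(** * Good triples and the weights of projected rows *)

Section good_triples.
Context {R : realType} {n : nat}.
Implicit Types (B M Y : 'M[R]_n) (i j l : 'I_n) (x : 'rV[R]_n).

Definition proj_sqnorm B i j l x : R :=
  dot (x *m coproj (~: [set i; j; l]) B) (x *m coproj (~: [set i; j; l]) B).

(* A triple is oriented towards the index whose row of M has the longest
   projection: the gain 1 / (1 + |a|) of integral_row_key for that row then
   absorbs the deterministic parts of the other two rows. *)
Definition good B M i j l : bool :=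
  [&& [&& i != j, i != l & j != l],
    proj_sqnorm B i j l (row j M) <= proj_sqnorm B i j l (row i M) &
    proj_sqnorm B i j l (row l M) <= proj_sqnorm B i j l (row i M)].

(** The projection depends only on the set of the three indices, so the three orientations compare
    the same three numbers, one of which is largest. *)
Lemma good_triple B M i j l : i != j -> i != l -> j != l ->
  [|| good B M i j l, good B M j i l | good B M l i j].
Proof.
move=> ij il jl; rewrite /good ij il jl (eq_sym j i) ij (eq_sym l i) il (eq_sym l j) jl/=.
have -> : proj_sqnorm B j i l = proj_sqnorm B i j l.
  by rewrite /proj_sqnorm (finset.setUC [set j] [set i])%SET.
have -> : proj_sqnorm B l i j = proj_sqnorm B i j l.
  by rewrite /proj_sqnorm -finset.setUA finset.setUC.
move: (proj_sqnorm B i j l (row i M)) (proj_sqnorm B i j l (row j M)) => a b.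
move: (proj_sqnorm B i j l (row l M)) => c.
by case: (lerP b a); case: (lerP c a); case: (lerP c b) => //=; lra.
Qed.

Definition row_weight B i j l x : R := (1 + proj_sqnorm B i j l x) ^+ 6.

(** All pairs of distinct companions are summed, not only the selected edges: the selection depends
    on the rows, whereas this sum has an expectation that can be computed term by term. [Y] is the
    random part of [B]. *)
Definition weight_sum B Y i : R :=
  \sum_j \sum_l [&& i != j, i != l & j != l]%:R *
    (row_weight B i j l (row j Y) + row_weight B i j l (row l Y)).

Lemma proj_sqnorm_ge0 B i j l x : 0 <= proj_sqnorm B i j l x.
Proof. exact: dot_ge0. Qed.

Lemma row_weight_ge0 B i j l x : 0 <= row_weight B i j l x.
Proof. by rewrite exprn_ge0// addr_ge0// proj_sqnorm_ge0. Qed.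

Lemma weight_sum_ge0 B Y i : 0 <= weight_sum B Y i.
Proof.
apply: sumr_ge0 => j _; apply: sumr_ge0 => l _.
by rewrite mulr_ge0 ?addr_ge0 ?row_weight_ge0.
Qed.

Lemma proj_sqnorm_frame B i j l (U : 'M[R]_(3, n)) x : U *m U^T = 1%:M ->
  U^T *m U = coproj (~: [set i; j; l]) B ->
  proj_sqnorm B i j l x = \sum_k coord U k x ^+ 2.
Proof. by move=> U1 UQ; rewrite /proj_sqnorm -UQ norm_frame. Qed.

Lemma sqnorm_add_le (U : 'M[R]_(3, n)) x y (a : R) :
  0 <= a -> \sum_k coord U k y ^+ 2 <= a ^+ 2 ->
  \sum_k coord U k (x + y) ^+ 2 <=
    2 * (1 + a) ^+ 2 * (1 + \sum_k coord U k x ^+ 2).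
Proof.
move=> a0 ya.
apply: (@le_trans _ _ (\sum_k (2 * coord U k x ^+ 2 + 2 * coord U k y ^+ 2))).
  apply: ler_sum => k _; rewrite coordD.
  by have := sqr_ge0 (coord U k x - coord U k y); lra.
rewrite big_split/= -!mulr_sumr.
have : 0 <= \sum_k coord U k x ^+ 2 by apply: sumr_ge0 => k _; exact: sqr_ge0.
move: ya; move: (\sum_k coord U k y ^+ 2) (\sum_k coord U k x ^+ 2) => s u su u0.
have au : 0 <= a * u by exact: mulr_ge0.
have aau : 0 <= a * (a * u) by exact: mulr_ge0.
by rewrite -mulrA sqrrD; lra.
Qed.

Lemma exists_frames B i (nu : 'rV[R]_n) : (3 <= n)%N -> B \in unitmx ->
  dot nu nu = 1 -> (forall k, k != i -> dot (row k B) nu = 0) ->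
  exists U : 'I_n -> 'I_n -> 'M[R]_(3, n),
    [/\ forall j l, U j l *m (U j l)^T = 1%:M,
        forall j l, row 2%:R (U j l) = nu,
        forall j l, [&& i != j, i != l & j != l] ->
          (U j l)^T *m U j l = coproj (~: [set i; j; l]) B &
        forall j l, [&& i != j, i != l & j != l] -> forall k, k != i -> k != j ->
          k != l -> row k B *m (U j l)^T = 0].
Proof.
move=> n3 uB nunu Bnu.
have ex j l : exists V : 'M[R]_(3, n), [/\ V *m V^T = 1%:M, row 2%:R V = nu &
    [&& i != j, i != l & j != l] ->
      V^T *m V = coproj (~: [set i; j; l]) B /\
      forall k, k != i -> k != j -> k != l -> row k B *m V^T = 0].
  have [/and3P[ij il jl]|_] := boolP [&& i != j, i != l & j != l].
    by have [V [V1 V2 V3 V4]] := coproj_frame uB ij il jl nunu Bnu; exists V.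
  (* A pair with a coincidence receives an arbitrary frame ending in nu, so that [U] is defined
     everywhere. *)
  by have [V [V1 V2]] := exists_frame n3 nunu; exists V.
exists (fun j l => projT1 (cid (ex j l))); split => j l.
- by case: cid => V [].
- by case: cid => V [].
- by move=> d; have [_ _ /(_ d)[]] := projT2 (cid (ex j l)).
- by move=> d; have [_ _ /(_ d)[]] := projT2 (cid (ex j l)).
Qed.

End good_triples.

(** * The expected share of a column, given the other rows *)

Section one_row.
Context {R : realType} {d} {T : measurableType d} (P : probability T R) (K1 : R).
Context (n : nat) (X : T -> 'rV[R]_n) (Y M : 'M[R]_n) (i : 'I_n) (t : R).
Hypothesis K10 : 0 <= K1.
Hypothesis n3 : (3 <= n)%N.
Hypothesis mX : measurable_fun setT X.
Hypothesis bX : bounded_marginals P K1 X.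
Hypothesis uB : Y + M \in unitmx.
Hypothesis t0 : 0 < t.
Let B := Y + M.
Variable cK : R.
Hypothesis cKE : cK = 7800 * (2 ^+ 9 * K1).
Let p : R := root4 n.

Let cK0 : 0 <= cK.
Proof. by rewrite cKE; apply: mulr_ge0; [exact: ler0n|rewrite mulr_ge0// exprn_ge0]. Qed.

Let cK64 : 64 * (2 ^+ 9 * K1) <= cK.
Proof.
have : 0 <= 2 ^+ 9 * K1 by rewrite mulr_ge0// exprn_ge0.
by rewrite cKE; move: (2 ^+ 9 * K1) => z; lra.
Qed.

Let p1 : 1 <= p.
Proof. by apply: root4_ge1; exact: leq_trans n3. Qed.

(** The first term is the main one, the second the cost of truncating long rows. Writing [h + 1] for
    the h-index includes the value 0. *)
Lemma integral_share_le :
  (\int[P]_w (share t i (set_row i (X w + row i M) B))%:E <=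
   (8 * cK / t * (4 * p / root4 (h_index (good B M) i).+1 ^+ 3 +
      weight_sum B Y i / p ^+ 10))%:E)%E.
Proof.
have p0 : 0 < p by exact: lt_le_trans p1.
have [nu [nunu Bnu]] := exists_unit_normal i uB.
have [U [U1 U2 UQ UB]] := exists_frames n3 uB nunu Bnu.
have K0 : 0 <= weight_sum B Y i / p ^+ 10.
  by rewrite divr_ge0 ?weight_sum_ge0// exprn_ge0// ltW.
(* With h-index 0 there are no edges to average over, but the claimed main term is then [4 * p], at
   least 4, and the crude bound is enough. *)
have [h0|h0] := posnP (h_index (good B M) i).
  apply: (@le_trans _ _ (\int[P]_w (2 * (1 + t ^+ 2 *
      (coord (U i i) 2%:R (X w) + coord (U i i) 2%:R (row i M)) ^+ 2)^-1)%:E)%E).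
    apply: ge0_le_integral_nomeas => w _; rewrite lee_fin ?share_ge0//.
    by rewrite -coordD; apply: (share_le_one (nu := nu)).
  rewrite ge0_integral_scale//; last 2 first.
  - by move=> w; rewrite invr_ge0 addr_ge0// mulr_ge0 ?sqr_ge0.
  - apply: measurable_funV; apply: measurable_funD => //.
    apply: measurable_funM => //; apply: measurable_funX; apply: measurable_funD => //.
    exact: (measurableT_comp (measurable_coord _ _) mX).
  apply: (@le_trans _ _ (2%:E * (64 * (2 ^+ 9 * K1) / t)%:E)%E).
    apply: lee_wpmul2l; first by rewrite lee_fin.
    exact: integral_row_one.
  rewrite -EFinM lee_fin h0 (_ : root4 1 = 1); last by rewrite /root4 !sqrtr1.
  rewrite expr1n divr1.
  apply: (@le_trans _ _ (8 * cK / t * (4 * 1))).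
    have ti : 0 <= t^-1 by rewrite invr_ge0 ltW.
    have := mulr_ge0 cK0 ti; have := ler_wpM2r ti cK64.
    by move: cK (64 * _) (t^-1) => a b c; lra.
  rewrite ler_wpM2l ?divr_ge0 ?mulr_ge0 ?(ltW t0)//.
  by have := p1; move: (weight_sum B Y i / p ^+ 10) K0 => a; lra.
set h := h_index (good B M) i in h0 *; pose r : R := root4 h.
have r0 : 0 < r by exact: lt_le_trans (root4_ge1 h0).
have [e [eg eh degl degr]] := exists_regular_edges (good B M) i.
pose a j l : R := `|coord (U j l) 0 (row i M)| + `|coord (U j l) 1 (row i M)| +
  `|coord (U j l) 2%:R (row i M)|.
pose w j l k : R := Num.sqrt (1 + proj_sqnorm B i j l (row k Y)).
(* [L] bounds the projected rows j and l of [B]: their parts in [M] are no longer than that of row i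
   because the triple is good, and [w] measures their random parts. *)
pose L j l : R := 2 * (1 + a j l) * (w j l j + w j l l).
have a0 j l : 0 <= a j l by rewrite !addr_ge0.
have w1 j l k : 1 <= w j l k.
  by rewrite -[X in X <= _]sqrtr1 ler_wsqrtr// lerDl proj_sqnorm_ge0.
have w2 j l k : w j l k ^+ 2 = 1 + proj_sqnorm B i j l (row k Y).
  by rewrite sqr_sqrtr// addr_ge0// proj_sqnorm_ge0.
have w12 j l k : w j l k ^+ 12 = row_weight B i j l (row k Y).
  by rewrite (_ : 12 = 2 * 6)%N// exprM w2.
have ww0 j l : 0 < w j l j + w j l l.
  by rewrite addr_gt0// (lt_le_trans ltr01).
have a1 j l : 0 < 1 + a j l by rewrite ltr_pwDl.
have L0 j l : 0 < L j l by rewrite /L mulr_gt0// mulr_gt0.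
have ed j l : e j l -> [&& i != j, i != l & j != l] by move/eg => /and3P[].
have LB j l : e j l -> \sum_k coord (U j l) k (row j B) ^+ 2 +
     \sum_k coord (U j l) k (row l B) ^+ 2 <= L j l ^+ 2.
  move=> ejl; have dist := ed _ _ ejl; have /and3P[_ gj gl] := eg _ _ ejl.
  have psE := proj_sqnorm_frame _ (U1 j l) (UQ j l dist).
  have ai : \sum_k coord (U j l) k (row i M) ^+ 2 <= a j l ^+ 2.
    rewrite sum_ord3 /a; move: (coord _ _ _) (coord _ 1 _) (coord _ 2%:R _) => x y z.
    rewrite -(real_normK (num_real x)) -(real_normK (num_real y)).
    rewrite -(real_normK (num_real z)); move: (normr_ge0 x) (normr_ge0 y) (normr_ge0 z).
    move: `|x| `|y| `|z| => x' y' z' x0 y0 z0.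
    have := mulr_ge0 x0 y0; have := mulr_ge0 x0 z0; have := mulr_ge0 y0 z0.
    lra.
  have term k : proj_sqnorm B i j l (row k M) <= proj_sqnorm B i j l (row i M) ->
      \sum_m coord (U j l) m (row k B) ^+ 2 <= 2 * (1 + a j l) ^+ 2 * w j l k ^+ 2.
    move=> gk; rewrite w2 psE (_ : row k B = row k Y + row k M); last first.
      by apply/rowP => m; rewrite !mxE.
    by apply: sqnorm_add_le => //; rewrite -psE (le_trans gk)// psE.
  apply: (le_trans (lerD (term _ gj) (term _ gl))).
  rewrite /L -mulrDr exprMn [X in _ <= X * _]exprMn.
  have := sqr_ge0 (1 + a j l); move: ((1 + a j l) ^+ 2) => s s0.
  have wj : 0 <= w j l j by rewrite (le_trans ler01).
  have wl : 0 <= w j l l by rewrite (le_trans ler01).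
  have := mulr_ge0 s0 (mulr_ge0 wj wl).
  have := mulr_ge0 s0 (mulr_ge0 wj wj); have := mulr_ge0 s0 (mulr_ge0 wl wl).
  by move: (w j l j) (w j l l) => u v; lra.
pose Z j l v : R := ((r ^+ 2 / (2 * L j l)) ^+ 2 *
         ((coord (U j l) 0 (X v) + coord (U j l) 0 (row i M)) ^+ 2 +
          (coord (U j l) 1 (X v) + coord (U j l) 1 (row i M)) ^+ 2) +
       t ^+ 2 * (coord (U j l) 2%:R (X v) + coord (U j l) 2%:R (row i M)) ^+ 2)^-1.
have Z0 j l v : 0 <= Z j l v.
  by rewrite invr_ge0 addr_ge0// mulr_ge0 ?addr_ge0 ?sqr_ge0.
have mc j l k m : measurable_fun setT (fun v => coord (U j l) k (X v) + coord (U j l) k m).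
  apply: measurable_funD => //.
  exact: (measurableT_comp (measurable_coord _ _) mX).
have mZ j l : measurable_fun setT (Z j l).
  apply: measurable_funV; apply: measurable_funD.
    apply: measurable_funM => //; apply: measurable_funD;
      by apply: measurable_funX; exact: mc.
  by apply: measurable_funM => //; apply: measurable_funX; exact: mc.
apply: (@le_trans _ _ (\int[P]_v (\sum_q
    (2 * (r ^+ 8)^-1 * (e q.1 q.2)%:R) * Z q.1 q.2 v)%:E)%E).
  apply: ge0_le_integral_nomeas => v _; rewrite lee_fin ?share_ge0//.
  have := share_le_edges (X v + row i M) t0 r0 (root4_pow4 h) nunu Bnu U1 U2 ed
    (fun j l ejl => UB j l (ed j l ejl)) eh degl degr L0 LB.
  move=> /le_trans; apply; rewrite pair_bigA/= mulr_sumr.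
  apply: ler_sum => q _; rewrite !coordD mulrA -/(Z _ _ _)//.
(* The factor [1 + a j l] of [L] cancels against the gain of [integral_row_key]; only the lengths of
   the random parts remain. *)
pose c j l : R := 4 * cK / (r ^+ 2 * t) * (w j l j + w j l l).
have ZE j l : (\int[P]_v (Z j l v)%:E <= (c j l)%:E)%E.
  have b0 : 0 < r ^+ 2 / (2 * L j l).
    by rewrite divr_gt0 ?exprn_gt0// mulr_gt0.
  apply: (le_trans (integral_row_key K10 mX bX (U1 j l) _ _ _ b0 t0)).
  rewrite lee_fin -cKE -!addrA (addrA `|_|) -/(a j l) /c /L.
  rewrite le_eqVlt; apply/orP; left; apply/eqP.
  move: (ww0 j l) (a1 j l); move: (w j l j + w j l l) (a j l) cK => u v k u0 v0.
  by field; rewrite !gt_eqF.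
apply: le_trans (integral_sum_le (c := fun q => c q.1 q.2)
  (a := fun q => 2 * (r ^+ 8)^-1 * (e q.1 q.2)%:R) _ _ _ _) _ => //.
- by move=> q; rewrite !mulr_ge0// invr_ge0 exprn_ge0// ltW.
rewrite lee_fin.
(* With the truncation level [(n / h)^(1/4)], division by [r ^+ 10] leaves [2 * p / r ^+ 3] as main
   term and makes the coefficient of [weight_sum] free of h. *)
pose s := p / r; have s0 : 0 < s by rewrite divr_gt0.
have edge j l : (e j l)%:R * (w j l j + w j l l) <=
    2 * s * (e j l)%:R + (s ^+ 10)^-1 * ([&& i != j, i != l & j != l]%:R *
    (row_weight B i j l (row j Y) + row_weight B i j l (row l Y))).
  have [ejl|_] := boolP (e j l); last first.
    rewrite mul0r mulr0 add0r !mulr_ge0 ?addr_ge0 ?row_weight_ge0//.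
    by rewrite invr_ge0 exprn_ge0// ltW.
  rewrite (ed _ _ ejl) !mul1r mulr1 -!w12.
  have := le_truncation s0 (w1 j l j); have := le_truncation s0 (w1 j l l).
  by move: (s ^- 10) => z; lra.
have sumE : \sum_j \sum_l (e j l)%:R * (w j l j + w j l l) <=
    2 * s * r ^+ 8 + (s ^+ 10)^-1 * weight_sum B Y i.
  apply: (le_trans (ler_sum _ (fun j _ => ler_sum _ (fun l _ => edge j l)))).
  under eq_bigr do rewrite big_split/= -!mulr_sumr.
  rewrite big_split/= -!mulr_sumr -/(weight_sum _ _ _) lerD2r.
  rewrite (_ : 8 = 4 + 4)%N// exprD root4_pow4 -natrM -eh natr_sum.
  by rewrite le_eqVlt; apply/orP; left; apply/eqP; congr (_ * _);
    apply: eq_bigr => j _; rewrite natr_sum.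
have -> : \sum_q 2 * (r ^+ 8)^-1 * (e q.1 q.2)%:R * c q.1 q.2 =
    8 * cK / (t * r ^+ 10) * \sum_j \sum_l (e j l)%:R * (w j l j + w j l l).
  rewrite pair_bigA/= mulr_sumr; apply: eq_bigr => q _; rewrite /c.
  by move: (w _ _ _ + _) => u; field; rewrite !gt_eqF.
have k0 : 0 <= 8 * cK / (t * r ^+ 10).
  by apply: divr_ge0; rewrite mulr_ge0 ?exprn_ge0// ltW.
apply: (le_trans (ler_wpM2l k0 sumE)).
have r'0 : 0 < (root4 h.+1 : R) by exact: lt_le_trans (root4_ge1 _).
(* The price of passing from h to [h + 1] is a factor 2, as [h + 1 <= 2 * h] for positive h. *)
have r3 : (root4 h.+1 : R) ^+ 3 <= 2 * r ^+ 3.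
  have rr' : r <= root4 h.+1 by exact: root4_le.
  rewrite -(ler_pM2l r'0) -exprS root4_pow4.
  apply: (@le_trans _ _ (r * (2 * r ^+ 3))); last first.
    by rewrite ler_wpM2r// mulr_ge0// exprn_ge0// ltW.
  by rewrite mulrCA -exprS (root4_pow4 h) -natrM ler_nat mul2n -addnn -addn1 leq_add2l.
apply: (@le_trans _ _ (8 * cK / t * (2 * p / r ^+ 3 + weight_sum B Y i / p ^+ 10))).
  rewrite le_eqVlt; apply/orP; left; apply/eqP; rewrite /s.
  by field; rewrite !gt_eqF.
rewrite ler_wpM2l ?divr_ge0 ?mulr_ge0 ?(ltW t0)// lerD2r.
rewrite ler_pdivrMr ?exprn_gt0// mulrAC ler_pdivlMr ?exprn_gt0//.
rewrite (_ : 4 * p * r ^+ 3 = 2 * p * (2 * r ^+ 3)); last by ring.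
by rewrite ler_wpM2l// mulr_ge0// ltW.
Qed.
End one_row.

(** * Summation over the columns *)

Section tail_bound.
Context {R : realType} {d} {T : measurableType d} (P : probability T R) (K1 : R).
Context (n : nat) (A : T -> 'M[R]_n) (M : 'M[R]_n).
Hypothesis K10 : 0 <= K1.
Hypothesis n3 : (3 <= n)%N.
Hypothesis mA : measurable_fun setT A.
Hypothesis indA : independent_rows P A.
Hypothesis bA : forall i, bounded_marginals P K1 (fun w => row i (A w)).

Let mrow i : measurable_fun setT (fun w => row i (A w)).
Proof. exact: (measurableT_comp (measurable_row i) mA). Qed.

Let mshift : forall i j, measurable_fun setT (fun Y : 'M[R]_n => (Y + M) i j).
Proof.
apply: measurable_addmx => i j; last exact: measurable_cst.
exact: measurable_mx_entry.
Qed.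

Let singular := [set Y : 'M[R]_n | Y + M \notin unitmx].

Let singularE : singular = [set Y | \det (gram [set: 'I_n] (Y + M)) = 0].
Proof.
rewrite /singular; apply/seteqP; split => Y /=; rewrite gram_setT unitmxE unitfE negbK.
  by move=> /eqP ->; rewrite expr0n.
by move=> /eqP; rewrite sqrf_eq0.
Qed.

Lemma measurable_singular : measurable (A @^-1` singular).
Proof.
have m : measurable singular.
  rewrite singularE.
  have := measurable_gram_det M [set: 'I_n]%SET measurableT (measurable_set1 0).
  by rewrite setTI.
by have := mA measurableT m; rewrite setTI.
Qed.

Lemma singular_null : P (A @^-1` singular) = 0%E.
Proof. by rewrite singularE; exact: (gram_neq0_ae M K10 n3 mA indA bA). Qed.

Let unit_off w : ~ (A @^-1` singular) w -> A w + M \in unitmx.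
Proof. by move=> /= /negP; rewrite negbK. Qed.

Lemma measurable_row_weight i j l k :
  measurable_fun setT (fun Y : 'M[R]_n => row_weight (Y + M) i j l (row k Y)).
Proof.
set S := (~: [set i; j; l])%SET.
have mm : forall a b, measurable_fun setT (fun Y : 'M[R]_n => mask S (Y + M) a b).
  by move=> a b; under eq_fun do rewrite mxE; case: (a \in S);
    [exact: mshift|exact: measurable_cst].
have mt : forall a b, measurable_fun setT (fun Y : 'M[R]_n => (mask S (Y + M))^T a b).
  exact: measurable_trmx.
have mQ : forall a b, measurable_fun setT (fun Y : 'M[R]_n => coproj S (Y + M) a b).
  apply: measurable_addmx => [a b|]; first exact: measurable_cst.
  apply: measurable_oppmx; apply: measurable_mulmx => //.
  apply: measurable_mulmx => //; apply: measurable_adj_inv.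
  apply: measurable_addmx => [|a b]; last exact: measurable_cst.
  exact: measurable_mulmx.
have mz : forall a b, measurable_fun setT
    (fun Y : 'M[R]_n => (row k Y *m coproj S (Y + M)) a b).
  apply: measurable_mulmx => // a b; under eq_fun do rewrite mxE.
  exact: measurable_mx_entry.
apply: measurable_funX; apply: measurable_funD; first exact: measurable_cst.
by apply: measurable_mulmx => // a b; exact: measurable_trmx.
Qed.

(** Row k itself is resampled. The projection depends only on the rows outside [i, j, l], so it
    stays fixed, and for almost all values of the other rows it has a frame to which
    [integral_row_weight] applies. *)
Lemma integral_row_weight_le i j l k : i != j -> i != l -> j != l ->
  k \in [set i; j; l]%SET ->
  (\int[P]_w (row_weight (A w + M) i j l (row k (A w)))%:E <=
   (64 * (2 ^+ 9 * K1))%:E)%E.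
Proof.
move=> ij il jl kijl.
pose phi Y : \bar R := (row_weight (Y + M) i j l (row k Y))%:E.
have mphi : measurable_fun setT phi.
  by apply/measurable_EFinP; exact: measurable_row_weight.
have phi0 Y : (0 <= phi Y)%E by rewrite lee_fin row_weight_ge0.
have C0 : 0 <= 64 * (2 ^+ 9 * K1) by rewrite mulr_ge0// mulr_ge0// exprn_ge0.
rewrite (integral_resample mA indA k mphi phi0).
apply: (@le_trans _ _ (\int[P]_w (64 * (2 ^+ 9 * K1))%:E)%E); last first.
  rewrite (integral_cst P measurableT).
  by rewrite [X in (_ * X)%E](probability_setT P) mule1.
apply: (ge0_ae_le_integral measurable_singular singular_null) => //.
- exact: (@measurable_integral_resample _ _ _ P _ _ A mA k phi mphi phi0).
- by move=> w; exact: integral_ge0.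
move=> w /unit_off uB.
have [nu [nunu Bnu]] := exists_unit_normal i uB.
have [U [U1 _ UQ _]] := coproj_frame uB ij il jl nunu Bnu.
apply: le_trans (integral_row_weight K10 (mrow k) (bA k) U1).
apply: ge0_le_integral_nomeas => w' _; first exact: phi0.
rewrite lee_fin /weight set_row_add /row_weight /proj_sqnorm coproj_set_row; last first.
  by rewrite finset.in_setC kijl.
rewrite row_set_row eqxx -/(proj_sqnorm _ i j l _) (proj_sqnorm_frame _ U1 UQ).
by rewrite sum_ord3 !addrA.
Qed.

Lemma integral_weight_sum_le i :
  (\int[P]_w (weight_sum (A w + M) (A w) i)%:E <=
   ((n * n)%:R * (2 * (64 * (2 ^+ 9 * K1))))%:E)%E.
Proof.
pose f (q : 'I_n * 'I_n) w : R := [&& i != q.1, i != q.2 & q.1 != q.2]%:R *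
  (row_weight (A w + M) i q.1 q.2 (row q.1 (A w)) +
   row_weight (A w + M) i q.1 q.2 (row q.2 (A w))).
have mW q k : measurable_fun setT
    (fun w => row_weight (A w + M) i q.1 q.2 (row k (A w))).
  exact: (measurableT_comp (measurable_row_weight i q.1 q.2 k) mA).
have C0 : 0 <= 64 * (2 ^+ 9 * K1) by rewrite mulr_ge0// mulr_ge0// exprn_ge0.
have fE : forall q, (\int[P]_w (f q w)%:E <= (2 * (64 * (2 ^+ 9 * K1)))%:E)%E.
  move=> q; rewrite /f; have [/and3P[d1 d2 d3]|_] := boolP [&& _, _ & _]; last first.
    under eq_integral do rewrite mul0r.
    by rewrite integral0 lee_fin mulr_ge0.
  under eq_integral do rewrite mul1r -[X in X + _]mul1r -[X in _ + X]mul1r.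
  rewrite ge0_integral_lincomb//; try by move=> w; exact: row_weight_ge0.
  rewrite !mul1e mulr_natl mulr2n EFinD leeD// integral_row_weight_le//.
    by rewrite !inE eqxx orbT.
  by rewrite !inE eqxx orbT.
have := integral_sum_le (a := fun=> 1) (f := f) (c := fun=> 2 * (64 * (2 ^+ 9 * K1)))
  _ _ _ fE.
rewrite -mulr_sumr sumr_const card_prod !card_ord mul1r.
rewrite -[X in (_ -> _ -> _ -> (_ <= X%:E)%E)]mulr_natl.
move=> h; apply: le_trans (h _ _ _) => //.
- apply: ge0_le_integral_nomeas => w _; first by rewrite lee_fin weight_sum_ge0.
  by rewrite lee_fin /weight_sum pair_bigA/=; apply: ler_sum => q _; rewrite mul1r.
- by move=> q w; rewrite /f mulr_ge0// addr_ge0// row_weight_ge0.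
- by move=> q; apply: measurable_funM => //; exact: measurable_funD.
Qed.

Lemma measurable_share t i :
  measurable_fun setT (fun Y : 'M[R]_n => share t i (Y + M)).
Proof.
have ma : forall a b, measurable_fun setT (fun Y : 'M[R]_n => adj_inv (Y + M) a b).
  exact: measurable_adj_inv.
have mh : measurable_fun setT (fun Y : 'M[R]_n => hs_norm (adj_inv (Y + M))).
  exact: measurable_hs_norm.
apply: measurable_funM; first apply: measurable_funM.
- by apply: measurable_bigsum => k; exact: measurable_funX.
- by apply: measurable_funV; exact: measurable_funX.
have mt : measurable [set Y : 'M[R]_n | t <= hs_norm (adj_inv (Y + M))].
  have := mh measurableT _ (measurable_itv `[t, +oo[); rewrite setTI.
  by congr measurable; apply/seteqP; split => Y /=; rewrite in_itv/= andbT.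
rewrite (_ : (fun _ => _) = \1_[set Y : 'M[R]_n | t <= hs_norm (adj_inv (Y + M))]).
  exact: measurable_indic.
apply/funext => Y; rewrite indicE; congr ((nat_of_bool _)%:R).
by apply/idP/idP; rewrite inE.
Qed.

Lemma measurable_tail (t : R) :
  measurable [set w | t <= hs_norm (adj_inv (A w + M))].
Proof.
have mh : measurable_fun setT (fun w => hs_norm (adj_inv (A w + M))).
  apply: measurable_hs_norm; apply: measurable_adj_inv => i j.
  exact: (measurableT_comp (mshift i j) mA).
have := mh measurableT _ (measurable_itv `[t, +oo[); rewrite setTI.
by congr measurable; apply/seteqP; split => Y /=; rewrite in_itv/= andbT.
Qed.

Variable cK : R.
Hypothesis cKE : cK = 7800 * (2 ^+ 9 * K1).

(** In the constant, [288 = 4 * 36 * 2] comes from the sum of inverse cubes with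
    [root4 n.+1 <= 2 * p], and [128 = 2 * 64] from the two weights of each pair. *)
Lemma hs_norm_tail_le (t : R) : 0 < t ->
  (P [set w | (t * Num.sqrt n%:R <= hs_norm (adj_inv (A w + M)))%R] <=
   (8 * cK * (288 + 128 * (2 ^+ 9 * K1)) / t)%:E)%E.
Proof.
move=> t0; set p : R := root4 n.
have p1 : 1 <= p by apply: root4_ge1; exact: leq_trans n3.
have p0 : 0 < p by exact: lt_le_trans p1.
have C0 : 0 <= 2 ^+ 9 * K1 by rewrite mulr_ge0// exprn_ge0.
have cK0 : 0 <= cK by rewrite cKE; apply: mulr_ge0; first exact: ler0n.
set tau := t * Num.sqrt n%:R.
have tauE : tau = t * p ^+ 2 by rewrite /tau root4_sq.
have tau0 : 0 < tau by rewrite tauE mulr_gt0// exprn_gt0.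
have mE := measurable_tail tau.
pose phi i Y : \bar R := (share tau i (Y + M))%:E.
have mphi i : measurable_fun setT (phi i).
  by apply/measurable_EFinP; exact: measurable_share.
have phi0 i Y : (0 <= phi i Y)%E by rewrite lee_fin share_ge0.
rewrite -[X in P X]setIT -integral_indic//.
under eq_integral => w _.
  rewrite indicE (_ : _%:R = \sum_i share tau i (A w + M)); last first.
    rewrite sum_share//; congr ((nat_of_bool _)%:R).
    by apply/idP/idP; rewrite inE.
  rewrite -sumEFin; over.
rewrite ge0_integral_sum//; last 2 first.
- by move=> i; exact: (measurableT_comp (mphi i) mA).
- by move=> i w _; exact: phi0.
rewrite (eq_bigr (fun i => \int[P]_w \int[P]_w' phi i (set_row i (row i (A w')) (A w))))%E;
  last by move=> i _; rewrite -(integral_resample mA indA i (mphi i) (phi0 i)).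
have mres i := @measurable_integral_resample _ _ _ P _ _ A mA i (phi i) (mphi i) (phi0 i).
rewrite -ge0_integral_sum//; last by move=> i w _; exact: integral_ge0.
pose W w := \sum_i weight_sum (A w + M) (A w) i.
have W0 w : 0 <= W w by apply: sumr_ge0 => i _; exact: weight_sum_ge0.
have mWi i : measurable_fun setT (fun w => weight_sum (A w + M) (A w) i).
  apply: measurable_bigsum => j; apply: measurable_bigsum => l.
  apply: measurable_funM => //; apply: measurable_funD.
    exact: (measurableT_comp (measurable_row_weight i j l j) mA).
  exact: (measurableT_comp (measurable_row_weight i j l l) mA).
have mW : measurable_fun setT W by exact: measurable_bigsum.
have c0 : 0 <= 8 * cK / tau by rewrite divr_ge0 ?mulr_ge0// ltW.
have c1 : 0 <= 8 * cK / tau * (288 * p ^+ 2).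
  apply: (mulr_ge0 c0); apply: mulr_ge0; last exact: sqr_ge0.
  by rewrite ler0n.
have c2 : 0 <= 8 * cK / tau / p ^+ 10 by rewrite divr_ge0// exprn_ge0// ltW.
apply: (@le_trans _ _ (\int[P]_w (8 * cK / tau * (288 * p ^+ 2) * 1 +
    8 * cK / tau / p ^+ 10 * W w)%:E)%E).
  apply: (ge0_ae_le_integral measurable_singular singular_null).
  - by apply: emeasurable_sum => i; exact: mres.
  - by move=> w; apply: sume_ge0 => i _; exact: integral_ge0.
  - by move=> w; rewrite lee_fin mulr1 addr_ge0// mulr_ge0.
  move=> w /unit_off uB.
  (* Shifting by one makes the count at most [9 * m] for every m, including [m = 0]. *)
  pose f i := (h_index (good (A w + M) M) i).+1.
  have bound i : (\int[P]_w' phi i (set_row i (row i (A w')) (A w)) <=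
      (8 * cK / tau * (4 * p / root4 (f i) ^+ 3 +
        weight_sum (A w + M) (A w) i / p ^+ 10))%:E)%E.
    rewrite /phi; under eq_integral do rewrite set_row_add.
    exact: (integral_share_le i K10 n3 (mrow i) (bA i) uB tau0 cKE).
  apply: (le_trans (lee_sum _ (fun i _ => bound i))).
  rewrite sumEFin lee_fin -mulr_sumr big_split/= -mulr_suml -/(W w) mulr1.
  rewrite mulrDr [X in _ <= _ + X]mulrAC -[X in _ <= _ + X]mulrA lerD2r.
  rewrite ler_wpM2l// (eq_bigr (fun i => 4 * p * (root4 (f i) ^+ 3)^-1))//.
  rewrite -mulr_sumr.
  have card_f m : (#|[set i | (f i <= m)%N]%SET| <= 9 * m)%N.
    case: m => [|m].
      by rewrite muln0 leqn0 cards_eq0; apply/eqP/setP => i; rewrite !inE.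
    apply: (@leq_trans #|[set i | (h_index (good (A w + M) M) i < m.+1)%N]%SET|).
      by apply/subset_leq_card/fintype.subsetP => i; rewrite !inE.
    apply: card_small_h_index => //.
    exact: good_triple.
  (* The h-index is at most n, so the level [n + 1] takes in every column. *)
  have := @sum_inv_root4_cube_le R n f card_f n.+1.
  rewrite (eq_bigl xpredT); last first.
    by move=> i; rewrite /f ltnS (h_property_le (h_index_property _ i)).
  have := @root4S_le R n (leq_trans (ltnW (isT : (1 < 3)%N)) n3); rewrite -/p.
  move: (\sum_i _) (root4 n.+1) => S q q2 Sq.
  apply: (@le_trans _ _ (4 * p * (72 * p))); last first.
    by rewrite le_eqVlt; apply/orP; left; apply/eqP; ring.
  rewrite ler_wpM2l ?mulr_ge0 ?(ltW p0)//; lra.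
rewrite ge0_integral_lincomb//.
rewrite (integral_cst P measurableT) [X in (1 * X)%E](probability_setT P) !mule1.
(* There are at most [n ^ 3 = p ^ 12] terms; the truncation divides by [p ^ 10], and the remaining
   [p ^ 2] cancels the one in [tau]. *)
have WE : (\int[P]_w (W w)%:E <= (p ^+ 12 * (2 * (64 * (2 ^+ 9 * K1))))%:E)%E.
  have mo := integral_sum_le (a := fun=> 1) (f := fun i w => weight_sum (A w + M) (A w) i)
    (c := fun=> (n * n)%:R * (2 * (64 * (2 ^+ 9 * K1)))) _ _ mWi integral_weight_sum_le.
  apply: le_trans (le_trans _ (mo _ _)) _ => //.
  - apply: ge0_le_integral_nomeas => w _; rewrite lee_fin//.
    by rewrite /W; apply: ler_sum => i _; rewrite mul1r.
  - by move=> i w; exact: weight_sum_ge0.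
  rewrite lee_fin -mulr_sumr mul1r sumr_const card_ord -[leLHS]mulr_natl mulrA.
  rewrite (_ : p ^+ 12 = (p ^+ 4) ^+ 3); last by rewrite -exprM.
  by rewrite root4_pow4 natrM [X in _ <= X * _]exprS expr2.
apply: (le_trans (leeD2l _ (lee_wpmul2l _ WE))); first by rewrite lee_fin.
rewrite -EFinM -EFinD lee_fin tauE le_eqVlt; apply/orP; left; apply/eqP.
by move: (2 ^+ 9 * K1) => z; field; rewrite !gt_eqF.
Qed.

End tail_bound.

Theorem theorem1p3 (R : realType) (K1 : R) (hK1 : 0 < K1) :
  exists (n0 : nat) (v : R), 0 < v /\
  forall (n : nat), (n0 <= n)%N ->
  forall (d : measure_display) (T : measurableType d) (P : probability T R)
    (A : {RV P >-> 'M[R]_n}),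
  independent_rows P A ->
  (forall (i : 'I_n) (F : 'M[R]_n), \rank F = 3%N ->
    exists rho : 'rV[R]_n -> R,
      is_density_on F (pushforward P (fun w => proj_orth F (row i (A w)))) rho /\
      forall x : 'rV[R]_n, (x <= F)%MS ->
        rho x <= K1 / Num.max 1 (norm2 x ^+ 2000)) ->
  forall M : 'M[R]_n,
  forall t : R, 0 < t ->
    (P [set w | (A w + M)%R \in unitmx ->
                (t * Num.sqrt n%:R <= hs_norm (invmx (A w + M)))%R]
      <= (v / t)%:E)%E.
Proof.
have K10 := ltW hK1.
have [cK cKE] : exists cK : R, cK = 7800 * (2 ^+ 9 * K1) by eexists.
have C0 : 0 < 2 ^+ 9 * K1 by rewrite mulr_gt0// exprn_gt0.
have cK0 : 0 < cK.
  by rewrite cKE; apply: mulr_gt0 C0; rewrite ltr0n.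
(* Dimension 3 is the first in which an orthonormal frame of three vectors exists. *)
exists 3%N, (8 * cK * (288 + 128 * (2 ^+ 9 * K1))); split.
  apply: mulr_gt0; first exact: mulr_gt0.
  by apply: ltr_wpDr; [apply: mulr_ge0; rewrite ?ler0n ?ltW|rewrite ltr0n].
move=> n n3 d T P A indA bA M t t0.
have mA : measurable_fun setT A by exact: measurable_funPT.
have tail := hs_norm_tail_le M K10 n3 mA indA bA cKE t0.
apply: le_trans tail.
set E := [set w | t * _ <= _].
have null := singular_null M K10 n3 mA indA bA.
set N := A @^-1` _ in null.
(* The implication holds trivially at singular matrices, so the event is the tail event for
   [adj_inv] together with the null set [N]. *)
have EN : [set w | A w + M \in unitmx ->
    t * Num.sqrt n%:R <= hs_norm (invmx (A w + M))] = E `|` N.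
  apply/seteqP; split => w /=.
    have [uB h|nB _] := boolP (A w + M \in unitmx); [left|by right].
    by rewrite /E/= adj_invE// h.
  move=> [h uB|/negP nB //]; by rewrite -adj_invE.
rewrite EN (le_trans (measureU2 _ _ _))//.
- exact: measurable_tail.
- exact: measurable_singular.
by rewrite [X in (_ + X)%E]null adde0.
Qed.
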